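(* Let $A=(A_1,\ldots,A_N)$ be an $N$-tuple of complex $n\times m$ matrices with $\bigcap_{\ell}\ker A_\ell=\{0\}$ and $\bigcap_\ell\ker A_\ell^\dagger=\{0\}$, and suppose that $A$ is not $(\mathbf{1}/n,\mathbf{1}/m)$-scalable. Let $(x_k,y_k)$ be the gradient-descent sequence in $P_n^1\times P_m^1$ given, with $L=2$, by $$(x_{k+1},y_{k+1}) = \exp_{x_k,y_k} \Bigl( - \frac{1}{L}\nabla f_A(x_k,y_k)\Bigr),\qquad (x_0,y_0) = (I,I).$$ Let $(G_k,H_k)_{k\ge1}$ be the sequence of pairs of Hermitian matrices defined by $(x_k,y_k) = (e^{kG_k/L},e^{kH_k/L})$. Suppose that $G_k = \sigma_k^{\dagger}\, \mathrm{diag}(a^k)\, \sigma_k$ and $H_k = \tau_k^{\dagger}\, \mathrm{diag}(b^k)\, \tau_k$ for unitary matrices $\sigma_k$, $\tau_k$ and nondecreasing and nonincreasing vectors $a^k\in\mathbb{R}^n$ and $b^k\in\mathbb{R}^m$, respectively (i.e. $a^k_1\le\cdots\le a^k_n$ and $b^k_1\ge\cdots\ge b^k_m$). Then $\sigma_k A \tau_k^{\dagger}$ accumulates to coarse DM-decompositions of $A$ (every accumulation point of the sequence is a coarse DM-decomposition of $A$). The convergence is linear in the following sense: there are $c > 0$, $M > 0$ such that for all $k \geq M$ and all $\ell \in \{1,\ldots,N\}$ it holds $$|(\sigma_k A_{\ell} \tau_k^\dagger)_{ij}| \leq e^{-ck} \qquad ((i,j) \in I_{\alpha} \times J_{\alpha'}:\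 \alpha > \alpha').$$
   Context: $n,m,N\ge1$; $\dagger$ is conjugate transpose; $gBh^\dagger:=(gB_1h^\dagger,\ldots,gB_Nh^\dagger)$. $A$ is $(\mathbf{1}/n,\mathbf{1}/m)$-scalable ($\mathbf 1$ the all-ones vector) if for every $\epsilon>0$ there are $g\in GL_n(\mathbb C),h\in GL_m(\mathbb C)$ with $\|\sum_\ell gA_\ell h^\dagger hA_\ell^\dagger g^\dagger-\frac1nI\|_{\rm F}^2+\|\sum_\ell hA_\ell^\dagger g^\dagger gA_\ell h^\dagger-\frac1mI\|_{\rm F}^2\le\epsilon^2$. $P_n^1$ is the manifold of $n\times n$ positive definite Hermitian matrices of determinant one, with metric $\langle X,Y\rangle_x=\mathrm{tr}\,x^{-1}Xx^{-1}Y$ and exponential map $\exp_x(H)=x^{1/2}e^{x^{-1/2}Hx^{-1/2}}x^{1/2}$; $P_n^1\times P_m^1$ has the product metric, and $\exp_{x,y}$ acts componentwise. The Kempf–Ness function is $f_A(x,y):=\log\mathrm{tr}\sum_\ell xA_\ell yA_\ell^\dagger$ on $P_n^1\times P_m^1$, with Riemannian gradient $\nabla f_A$. Coarse DM-decomposition: $\mathcal{S}_A$ is the set of pairs of subspaces $X\subseteq\mathbb{C}^n,Y\subseteq\mathbb{C}^m$ with $u^\top A_\ell\bar v=0$ for all $u\in X,v\in Y,\ell$. $\phi(X,Y):=(\dim X,\dim Y)$. $\mathcal{E}_A$ is the set of $(X,Y)\in\mathcal{S}_A$ such that $\phi(X,Y)$ is an extreme point, other than $(0,0)$, of $\mathrm{Conv}\,\phi(\mathcal{S}_A)$.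 It is finite and can be arranged as $\mathcal{E}_A=\{(X_\alpha,Y_\alpha)\}_{\alpha=0}^\theta$ with $\mathbb{C}^n=X_0\supset\cdots\supset X_\theta=\{0\}$, $\{0\}=Y_0\subset\cdots\subset Y_\theta=\mathbb{C}^m$ (strict inclusions). A coarse DM-decomposition of $A$ is a tuple $gAh^\dagger$ where $g\in GL_n$ has a basis of $X_\alpha$ as its last $\dim X_\alpha$ rows for every $\alpha$, and $h\in GL_m$ has a basis of $Y_\alpha$ as its first $\dim Y_\alpha$ rows for every $\alpha$. $I_\alpha\subseteq\{1,\ldots,n\}$ is the set of indices among the last $\dim X_{\alpha-1}$ but not among the last $\dim X_\alpha$; $J_\alpha\subseteq\{1,\ldots,m\}$ is the set of indices among the first $\dim Y_\alpha$ but not among the first $\dim Y_{\alpha-1}$ ($1\le\alpha\le\theta$). *)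

(* Defs.v *)
From HB Require Import structures.
From mathcomp Require Import all_boot all_order all_algebra.
From mathcomp Require Import complex.
From mathcomp Require Import all_classical all_reals all_analysis.

Set Implicit Arguments.
Unset Strict Implicit.
Unset Printing Implicit Defensive.

Import Order.TTheory GRing.Theory Num.Theory.
Import numFieldNormedType.Exports.
Export numFieldNormedType.Exports.

Local Open Scope classical_set_scope.
Local Open Scope complex_scope.
Local Open Scope sesquilinear_scope.
Local Open Scope ring_scope.

(* Complex numbers are R[i] for R : realType; [M ^t*] is the conjugate transpose
   of M, and [Normc.normc z : R] is the modulus |z| as a real number. *)

Definition frob2 (R : realType) (n m : nat) (M : 'M[R[i]]_(n, m)) : R :=
  \sum_i \sum_j Normc.normc (M i j) ^+ 2.

Definition conj_tuple (R : realType) (n m N : nat)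
    (g : 'M[R[i]]_n) (A : 'I_N -> 'M[R[i]]_(n, m)) (h : 'M[R[i]]_m) :
    'I_N -> 'M[R[i]]_(n, m) :=
  fun l => g *m A l *m h^t*.

Definition op_scalable (R : realType) (n m N : nat)
    (A : 'I_N -> 'M[R[i]]_(n, m)) : Prop :=
  forall eps : R, 0 < eps ->
  exists (g : 'M[R[i]]_n) (h : 'M[R[i]]_m),
    [/\ g \in unitmx, h \in unitmx &
      frob2 (\sum_l (g *m A l *m h^t* *m h *m (A l)^t* *m g^t*)
               - (n%:R^-1)%:M)
      + frob2 (\sum_l (h *m (A l)^t* *m g^t* *m g *m A l *m h^t*)
               - (m%:R^-1)%:M)
      <= eps ^+ 2].

(* The entries of the exponential series converge absolutely; as R[i] carries no
   library topology, real and imaginary parts are summed separately. *)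
Definition mexp (R : realType) (n : nat) (M : 'M[R[i]]_n) : 'M[R[i]]_n :=
  let S (K : nat) : 'M[R[i]]_n := \sum_(0 <= k < K) (k`!%:R^-1) *: (M ^+ k) in
  \matrix_(i, j) (limn (fun K => complex.Re (S K i j))
                  +i* limn (fun K => complex.Im (S K i j))).

Definition posdefmx (R : realType) (n : nat) (M : 'M[R[i]]_n) : Prop :=
  M \is hermsymmx /\
  forall u : 'cV[R[i]]_n, u != 0 -> 0 < (u^t* *m M *m u) 0 0.

(* x^{1/2}: the unique positive definite square root when x is positive
   definite (and 0 when there is no such root). *)
Definition sqrtmx (R : realType) (n : nat) (x : 'M[R[i]]_n) : 'M[R[i]]_n :=
  xget 0 [set r | posdefmx r /\ r *m r = x].

(* exp_x(H) = x^{1/2} e^{x^{-1/2} H x^{-1/2}} x^{1/2} *)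
Definition riem_exp (R : realType) (n : nat) (x H : 'M[R[i]]_n) : 'M[R[i]]_n :=
  let s := sqrtmx x in
  s *m mexp (invmx s *m H *m invmx s) *m s.

(* The tangent space at x of the manifold of positive definite Hermitian
   matrices of determinant one: d(det)_x(H) = det x * tr (x^{-1} H). *)
Definition tangent_vec (R : realType) (n : nat) (x H : 'M[R[i]]_n) : Prop :=
  H \is hermsymmx /\ \tr (invmx x *m H) = 0.

(* The trace is real for x positive definite and U, V Hermitian. *)
Definition riem_metric (R : realType) (n : nat) (x U V : 'M[R[i]]_n) : R :=
  complex.Re (\tr (invmx x *m U *m invmx x *m V)).

(* The trace is a positive real for x, y positive definite and A nonzero. *)
Definition kempf_ness (R : realType) (n m N : nat)
    (A : 'I_N -> 'M[R[i]]_(n, m)) (x : 'M[R[i]]_n) (y : 'M[R[i]]_m) : R :=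
  ln (complex.Re (\tr (\sum_l (x *m A l *m y *m (A l)^t*)))).

(* (g.1, g.2) is the tangent vector at (x, y) representing the differential of
   f_A; d f_A(U, V) is the derivative at t = 0 of f_A along the geodesic
   t |-> exp_{x,y}(tU, tV). *)
Definition is_riem_grad (R : realType) (n m N : nat)
    (A : 'I_N -> 'M[R[i]]_(n, m)) (x : 'M[R[i]]_n) (y : 'M[R[i]]_m)
    (g : 'M[R[i]]_n * 'M[R[i]]_m) : Prop :=
  [/\ tangent_vec x g.1, tangent_vec y g.2 &
    forall (U : 'M[R[i]]_n) (V : 'M[R[i]]_m), tangent_vec x U -> tangent_vec y V ->
      is_derive (0 : R) (1 : R)
        (fun t : R => kempf_ness A (riem_exp x (t%:C *: U))
                                   (riem_exp y (t%:C *: V)) : R)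
        (riem_metric x g.1 U + riem_metric y g.2 V)].

Definition riem_grad (R : realType) (n m N : nat)
    (A : 'I_N -> 'M[R[i]]_(n, m)) (x : 'M[R[i]]_n) (y : 'M[R[i]]_m) :
    'M[R[i]]_n * 'M[R[i]]_m :=
  xget (0, 0) [set g | is_riem_grad A x y g].

(* Vectors of C^n are row vectors here, so u^T A_l conj(v) reads u *m A l *m v^t*. *)
Definition SA (R : realType) (n m N : nat) (A : 'I_N -> 'M[R[i]]_(n, m)) :
    set ({vspace 'rV[R[i]]_n} * {vspace 'rV[R[i]]_m}) :=
  [set P : {vspace 'rV[R[i]]_n} * {vspace 'rV[R[i]]_m} |
     forall u v l, u \in P.1 -> v \in P.2 -> u *m A l *m v^t* = 0].

Definition dimpair (R : realType) (n m : nat)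
    (P : {vspace 'rV[R[i]]_n} * {vspace 'rV[R[i]]_m}) : R^o * R^o :=
  ((\dim P.1)%:R, (\dim P.2)%:R).

Definition convex_hull (R : realType) (V : lmodType R) (K : set V) : set V :=
  smallest (fun C : set V => convex_set (C : set (convex_lmodType V))) K.

Definition extreme_point (R : realType) (V : lmodType R) (K : set V) (p : V) :
    Prop :=
  K p /\
  forall (q r : V) (t : R), K q -> K r -> 0 < t < 1 ->
    p = t *: q + (1 - t) *: r -> q = p /\ r = p.

Definition EA (R : realType) (n m N : nat) (A : 'I_N -> 'M[R[i]]_(n, m)) :
    set ({vspace 'rV[R[i]]_n} * {vspace 'rV[R[i]]_m}) :=
  [set P | [/\ SA A P, dimpair P != 0 &
    extreme_point (convex_hull (@dimpair R n m @` SA A)) (dimpair P)]].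

(* E_A = {(X_a, Y_a) : 0 <= a <= theta}, with X strictly decreasing from C^n to 0
   and Y strictly increasing from 0 to C^m; values beyond theta are irrelevant. *)
Definition EA_chain (R : realType) (n m N : nat)
    (A : 'I_N -> 'M[R[i]]_(n, m)) (theta : nat)
    (X : nat -> {vspace 'rV[R[i]]_n}) (Y : nat -> {vspace 'rV[R[i]]_m}) : Prop :=
  [/\ EA A = [set P | exists2 a, (a <= theta)%N & P = (X a, Y a)],
      X 0%N = fullv /\ X theta = 0%VS,
      Y 0%N = 0%VS /\ Y theta = fullv,
      forall a, (a < theta)%N -> (X a.+1 <= X a)%VS /\ X a.+1 != X a &
      forall a, (a < theta)%N -> (Y a <= Y a.+1)%VS /\ Y a != Y a.+1].

Definition first_rows (R : realType) (n d : nat) (g : 'M[R[i]]_n) :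
    seq 'rV[R[i]]_n :=
  [seq row i g | i : 'I_n <- enum 'I_n & (i < d)%N].

Definition last_rows (R : realType) (n d : nat) (g : 'M[R[i]]_n) :
    seq 'rV[R[i]]_n :=
  [seq row i g | i : 'I_n <- enum 'I_n & (n - d <= i)%N].

Definition coarse_DM (R : realType) (n m N : nat)
    (A : 'I_N -> 'M[R[i]]_(n, m)) (theta : nat)
    (X : nat -> {vspace 'rV[R[i]]_n}) (Y : nat -> {vspace 'rV[R[i]]_m})
    (B : 'I_N -> 'M[R[i]]_(n, m)) : Prop :=
  exists (g : 'M[R[i]]_n) (h : 'M[R[i]]_m),
    [/\ g \in unitmx, h \in unitmx,
        forall a, (a <= theta)%N -> basis_of (X a) (last_rows (\dim (X a)) g),
        forall a, (a <= theta)%N -> basis_of (Y a) (first_rows (\dim (Y a)) h) &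
        B = conj_tuple g A h].

(* I_a and J_a, for a >= 1, with row and column indices counted from 0. *)
Definition Iblock (R : realType) (n : nat) (X : nat -> {vspace 'rV[R[i]]_n})
    (a : nat) : {set 'I_n} :=
  [set i : 'I_n | (n - \dim (X a.-1) <= i)%N & ~~ (n - \dim (X a) <= i)%N].

Definition Jblock (R : realType) (m : nat) (Y : nat -> {vspace 'rV[R[i]]_m})
    (a : nat) : {set 'I_m} :=
  [set j : 'I_m | (j < \dim (Y a))%N & ~~ (j < \dim (Y a.-1))%N].

(* B is an accumulation point (limit of a subsequence) of the sequence S. *)
Definition accumulation_point (R : realType) (n m N : nat)
    (S : nat -> 'I_N -> 'M[R[i]]_(n, m)) (B : 'I_N -> 'M[R[i]]_(n, m)) : Prop :=
  forall eps : R, 0 < eps -> forall K : nat,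
  exists2 k, (K <= k)%N &
    forall l i j, Normc.normc (S k l i j - B l i j) < eps.

Definition rdiag (R : realType) (n : nat) (a : 'rV[R]_n) : 'M[R[i]]_n :=
  diag_mx (map_mx (real_complex R) a).

(* Main.v *)
Require Import Defs.
From HB Require Import structures.
From mathcomp Require Import all_boot all_order all_algebra all_fingroup.
From mathcomp Require Import complex.
From mathcomp Require Import all_classical all_reals all_analysis.
From mathcomp Require Import ring lra zify.

Set Implicit Arguments.
Unset Strict Implicit.
Unset Printing Implicit Defensive.

Import Order.TTheory GRing.Theory Num.Theory.

Local Open Scope classical_set_scope.
Local Open Scope complex_scope.
Local Open Scope sesquilinear_scope.
Local Open Scope ring_scope.

(* For the blocks of the coarse DM-decomposition put, on the a-th block of size n_a x m_a,
   the weight p = C m_a / (n_a + m_a) on its rows and q = C n_a / (n_a + m_a) on its columns,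
   with C such that both have total mass 1.  Extremality of the chain makes p decrease and q
   increase from block to block, and (n^-1 - p, m^-1 - q) turns out to be the asymptotic
   velocity of 2 (log x_k, log y_k).

   A gradient step lowers f_A by at least half of |grad f_A|^2 at the new point, and a unitary
   frame adapted to the flags X_a, Y_a gives the weak duality bound
   |grad f_A|^2 >= kappa := |p - n^-1|^2 + |q - m^-1|^2, so f_A(x_k, y_k) <= K - k kappa / 2.
   Cauchy-Binet bounds the growth of log x_k and log y_k by half of the sum of the gradients.
   A coupling of p with q and compactness of the unitary groups bound f_A from below by
   <p, log x> + <q, log y> up to a constant.  The three facts together leave only a deviation
   of order sqrt k of (log x_k, log y_k) from (k/2) (n^-1 - p, m^-1 - q).  As
   |(sigma_k A_l tau_k^dagger)_ij|^2 (x_k)_i (y_k)_j <= exp (f_A(x_k, y_k)), where (x_k)_i and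
   (y_k)_j are the sorted eigenvalues, the entries below the diagonal blocks, where p_i + q_j is
   less than its value C in the diagonal blocks, decay exponentially.  An accumulation point
   therefore has zero blocks of the dimensions of the pairs (X_a, Y_a), and as these are
   extreme the zero blocks are carried by the pairs (X_a, Y_a) themselves. *)

(** The constant 1/2 in the descent estimate is decisive. Put z_k = (log x_k, log y_k), let S_k be
    the sum of the first k squared gradients and xi = (1/n - p, 1/m - q). The growth bound gives
    |z_k|^2 <= k S_k / 4. A descent of delta S_k and the lower bound on f_A give <xi, z_k> >= delta
    S_k - O(1). As |xi|^2 = kappa, expanding |z_k - k xi / 2|^2 leaves at most k S_k (1/4 - delta) +
    k^2 kappa / 4 + O(k), and S_k >= k kappa makes this O(k) for delta = 1/2. The standard estimate
    for a 2-smooth function and step length 1/2 has delta = 1/4, and then the quadratic term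
    survives. Measuring the gradient at the new point instead of the old one gains the missing
    quarter. The same pair (p, q) is the test direction of weak duality, the weight of the lower
    bound and the source of the velocity; the three uses fit together because |p|^2 + |q|^2 equals
    C, the value of p_i + q_j on the diagonal blocks. *)

(** * Partial sums, couplings and block marginals *)

Definition partial_sum (R : nmodType) (p : nat -> R) (x : nat) : R := \sum_(0 <= i < x) p i.

Lemma partial_sum0 (R : nmodType) (p : nat -> R) : partial_sum p 0 = 0.
Proof. by rewrite /partial_sum big_geq. Qed.

Lemma partial_sumS (R : nmodType) (p : nat -> R) x :
  partial_sum p x.+1 = partial_sum p x + p x.
Proof. by rewrite /partial_sum big_nat_recr. Qed.

Lemma partial_sum_le (R : numDomainType) (p : nat -> R) x y :
  (forall i, 0 <= p i) -> (x <= y)%N -> partial_sum p x <= partial_sum p y.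
Proof.
move=> p0 /subnK <-; elim: (y - x)%N => //= d IH.
by rewrite addSn partial_sumS (le_trans IH) // lerDl.
Qed.

Section Coupling.
Variables (R : realFieldType) (p q : nat -> R).
Hypotheses (p0 : forall i, 0 <= p i) (q0 : forall j, 0 <= q j).
Let P := partial_sum p.
Let Q := partial_sum q.

(* The mass shared by the i-th interval cut out by the partial sums of p and the
   j-th interval cut out by those of q. *)
Let w i j := Num.max 0 (Num.min (P i.+1) (Q j.+1) - Num.max (P i) (Q j)).
Let clamp a b t : R := Num.min (Num.max t a) b.

(** Writing an overlap as a difference of one function at the two ends of [c, d] makes the row and
    column sums of [w] telescope. *)
Let overlapE (a b c d : R) : a <= b -> c <= d ->
  Num.max 0 (Num.min b d - Num.max a c) = clamp a b d - clamp a b c.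
Proof.
move=> ab cd; rewrite /clamp.
case: (leP a c) => ac; case: (leP b d) => bd; case: (leP d a) => da; case: (leP c a) => ca;
  repeat (match goal with |- context [Num.min ?x ?y] => case: (leP x y) => ? end);
  repeat (match goal with |- context [Num.max ?x ?y] => case: (leP x y) => ? end); lra.
Qed.

Let PS i : P i <= P i.+1. Proof. exact: partial_sum_le. Qed.
Let QS i : Q i <= Q i.+1. Proof. exact: partial_sum_le. Qed.

Let w_row i j : w i j = clamp (P i) (P i.+1) (Q j.+1) - clamp (P i) (P i.+1) (Q j).
Proof. exact: overlapE. Qed.

Let w_col i j : w i j = clamp (Q j) (Q j.+1) (P i.+1) - clamp (Q j) (Q j.+1) (P i).
Proof. by rewrite /w minC [X in _ - X]maxC overlapE. Qed.

Let clamp_hi a b t : a <= b -> b <= t -> clamp a b t = b.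
Proof. by move=> ab bt; rewrite /clamp (max_idPl (le_trans ab bt)); apply/min_idPr. Qed.

Let clamp_lo a b t : a <= b -> t <= a -> clamp a b t = a.
Proof. by move=> ab bt; rewrite /clamp (max_idPr bt); apply/min_idPl. Qed.

(** [w] is a coupling of p and q, so the left side is the [w]-average of a_i + b_j; a positive
    [w i j] forces P i < Q j.+1, where the bound K is available. *)
Lemma coupling_le n m (a : 'I_n -> R) (b : 'I_m -> R) K :
  P n = 1 -> Q m = 1 ->
  (forall (i : 'I_n) (j : 'I_m), P i < Q j.+1 -> a i + b j <= K) ->
  \sum_(i < n) p i * a i + \sum_(j < m) q j * b j <= K.
Proof.
move=> Pn Qm ab.
have tele f k : \sum_(i < k) (f i.+1 - f i) = f k - f 0%N :> R.
  by rewrite -(big_mkord xpredT (fun i => f i.+1 - f i)) telescope_sumr.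
have bnd (s : nat -> R) k (i : 'I_k) : (forall i, 0 <= s i) -> partial_sum s k = 1 ->
    [/\ 0 <= partial_sum s i, partial_sum s i.+1 = partial_sum s i + s i &
        partial_sum s i.+1 <= 1].
  move=> s0 <-; split; [by rewrite -(partial_sum0 s) partial_sum_le | by rewrite partial_sumS |].
  exact: partial_sum_le.
have rowE (i : 'I_n) : \sum_(j < m) w i j = p i.
  under eq_bigr do rewrite w_row.
  rewrite (tele (fun j => clamp (P i) (P i.+1) (Q j))) Qm /Q partial_sum0.
  have [h1 h2 h3] := bnd p n i p0 Pn.
  by rewrite clamp_hi // clamp_lo //; rewrite /P h2 addrAC subrr add0r.
have colE (j : 'I_m) : \sum_(i < n) w i j = q j.
  under eq_bigr do rewrite w_col.
  rewrite (tele (fun i => clamp (Q j) (Q j.+1) (P i))) Pn /P partial_sum0.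
  have [h1 h2 h3] := bnd q m j q0 Qm.
  by rewrite clamp_hi // clamp_lo //; rewrite /Q h2 addrAC subrr add0r.
have -> : \sum_(i < n) p i * a i = \sum_(i < n) \sum_(j < m) w i j * a i.
  by apply: eq_bigr => i _; rewrite -mulr_suml rowE.
have -> : \sum_(j < m) q j * b j = \sum_(i < n) \sum_(j < m) w i j * b j.
  by rewrite exchange_big; apply: eq_bigr => j _; rewrite -mulr_suml colE.
rewrite -big_split /=.
have -> : K = \sum_(i < n) \sum_(j < m) w i j * K.
  under eq_bigr => i _ do rewrite -mulr_suml rowE.
  by rewrite -mulr_suml -(big_mkord xpredT p) -/(partial_sum p n) -/P Pn mul1r.
apply: ler_sum => i _; rewrite -big_split; apply: ler_sum => j _ /=.
rewrite -mulrDr.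
have [lt|ge] := ltP (P i) (Q j.+1).
  by apply: ler_wpM2l; [rewrite /w le_max lexx | exact: ab].
suff -> : w i j = 0 by rewrite !mul0r.
rewrite /w; apply/max_idPl; rewrite subr_le0.
by rewrite ge_min !le_max ge orbT.
Qed.

End Coupling.

Section Tangent.
Variables (R : realFieldType) (q : nat -> R).

(** Partial sums of a nondecreasing sequence are convex, and [q s], the slope just left of [s.+1],
    is a subgradient there. *)
Lemma partial_sum_tangent (qm : forall i j, (i <= j)%N -> q i <= q j) s t :
  partial_sum q s.+1 + (t%:R - s.+1%:R) * q s <= partial_sum q t.
Proof.
have [st|ts] := leqP s.+1 t.
  have [d ->] : exists d, t = (s.+1 + d)%N by exists (t - s.+1)%N; rewrite subnKC.
  elim: d {st} => [|d IH]; first by rewrite addn0 subrr mul0r addr0.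
  rewrite addnS [partial_sum q (_ + d).+1]partial_sumS -[(_ + d).+1%:R]natr1.
  have := qm s (s.+1 + d)%N ltac:(lia); lra.
have [d ->] : exists d, s = (t + d)%N by exists (s - t)%N; rewrite subnKC.
elim: d {ts} => [|d IH].
  by rewrite addn0 partial_sumS -natr1; lra.
rewrite addnS partial_sumS -!natr1 natrD.
have q01 := qm (t + d)%N (t + d).+1 (leqnSn _).
have := ler_wpM2l (ler0n R d) q01.
by move: IH; rewrite -natr1 natrD; lra.
Qed.

End Tangent.

(** The concave counterpart, with the slope just right of [s]. *)
Lemma partial_sum_tangent_anti (R : realFieldType) (p : nat -> R)
    (pm : forall i j, (i <= j)%N -> p j <= p i) s t :
  partial_sum p t <= partial_sum p s + (t%:R - s%:R) * p s.
Proof.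
have h := @partial_sum_tangent R (fun i => - p i) _ s t.
have E x : partial_sum (fun i => - p i) x = - partial_sum p x.
  by rewrite /partial_sum sumrN.
have {h} := h (fun i j ij => ltac:(rewrite lerN2; exact: pm)).
rewrite !E partial_sumS -natr1; lra.
Qed.

Lemma pos_lower_bound (R : realFieldType) (f : nat -> R) k :
  (forall a, (a < k)%N -> 0 < f a) -> exists2 c, 0 < c & forall a, (a < k)%N -> c <= f a.
Proof.
elim: k => [|k IH] f0; first by exists 1.
have [c c0 cf] := IH (fun a ak => f0 a (ltnW ak)).
exists (Num.min c (f k)); first by rewrite lt_min c0 f0.
by move=> a; rewrite ltnS leq_eqVlt => /predU1P[->|/cf ca]; rewrite ge_min ?lexx ?orbT // ca.
Qed.

Section Blocks.
Variables (D : nat -> nat) (theta : nat).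
Hypotheses (D0 : D 0%N = 0%N) (DS : forall a, (a < theta)%N -> (D a < D a.+1)%N).

(** Counts the thresholds [D b] passed by i, which is a on the interval from [D a] to [D a.+1].
    Counting keeps the value below theta and monotone for every i, also beyond [D theta], so the
    weights defined through it are positive and monotone on all of nat. *)
Definition block_index i := (\sum_(1 <= b < theta) (D b <= i))%N.

Lemma block_bound_mono a b : (a <= b <= theta)%N -> (D a <= D b)%N.
Proof.
case/andP => /subnK <-; elim: (b - a)%N => //= d IH h.
by rewrite addSn (leq_trans (IH _)) ?(ltnW h) // ltnW // DS.
Qed.

Lemma block_indexE a i : (a < theta)%N -> (D a <= i < D a.+1)%N -> block_index i = a.
Proof.
move=> ath /andP[Dai iDa]; rewrite /block_index.
rewrite (@big_cat_nat _ _ _ a.+1) //= (eq_big_nat _ _ (F2 := fun=> 1%N)); last first.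
  move=> b /andP[_ ba]; rewrite (leq_trans _ Dai) // block_bound_mono //.
  by rewrite -ltnS ba ltnW.
rewrite sum_nat_const_nat muln1 subn1 /= big1_seq ?addn0 // => b /=.
rewrite mem_index_iota => /andP[ab bt]; rewrite leqNgt (leq_trans iDa) //.
by rewrite block_bound_mono // ab ltnW.
Qed.

Lemma block_index_mono i j : (i <= j)%N -> (block_index i <= block_index j)%N.
Proof.
move=> ij; apply: leq_sum => b _; case: (leqP (D b) i) => //= Db.
by rewrite (leq_trans Db ij).
Qed.

Lemma block_index_lt i : (0 < theta)%N -> (block_index i < theta)%N.
Proof.
move=> t0; rewrite -(ltn_predK t0) ltnS /block_index.
apply: (leq_trans (n := (\sum_(1 <= b < theta) 1)%N)).
  by apply: leq_sum => b _; exact: leq_b1.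
by rewrite sum_nat_const_nat muln1 subn1.
Qed.

Lemma partial_sum_block (R : pzRingType) (f : nat -> R) a : (a <= theta)%N ->
  partial_sum (f \o block_index) (D a) =
  partial_sum (fun b => (D b.+1 - D b)%:R * f b) a.
Proof.
elim: a => [|a IH] ath; first by rewrite D0 !partial_sum0.
rewrite partial_sumS -IH 1?ltnW // /partial_sum.
rewrite (@big_cat_nat _ _ _ (D a)) //=; last exact: ltnW (DS ath).
congr (_ + _); rewrite (eq_big_nat _ _ (F2 := fun=> f a)) /=.
  by rewrite sumr_const_nat mulr_natl.
by move=> i h; rewrite (block_indexE ath h).
Qed.

End Blocks.

(* The marginals of the limit of the normalized scalings: mass C nb mb / (nb + mb) on
   the block of size nb x mb, spread uniformly over its rows and over its columns. *)
Lemma optimal_marginals (R : realFieldType) (D e : nat -> nat) theta :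
  (0 < theta)%N -> D 0%N = 0%N -> e 0%N = 0%N ->
  (forall a, (a < theta)%N -> (D a < D a.+1)%N) ->
  (forall a, (a < theta)%N -> (e a < e a.+1)%N) ->
  (forall a, (a.+1 < theta)%N ->
    (e a.+2 - e a.+1) * (D a.+1 - D a) < (e a.+1 - e a) * (D a.+2 - D a.+1))%N ->
  exists (p q : nat -> R) (C c : R),
  [/\ (forall i, 0 < p i) /\ (forall j, 0 < q j),
      (forall i j, (i <= j)%N -> p j <= p i) /\ (forall i j, (i <= j)%N -> q i <= q j),
      (forall a, (a <= theta)%N -> partial_sum p (D a) = partial_sum q (e a)) /\
      partial_sum p (D theta) = 1,
      partial_sum (fun i => p i ^+ 2) (D theta) + partial_sum (fun j => q j ^+ 2) (e theta) = C &
      0 < c /\ forall a b i j, (a < theta)%N -> (b < theta)%N ->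
        (D a <= i < D a.+1)%N -> (e b <= j < e b.+1)%N ->
        ((a <= b)%N -> C <= p i + q j) /\ ((b < a)%N -> p i + q j <= C - c)].
Proof.
move=> t0 D0 e0 DS eS slope.
pose nb a : R := (D a.+1 - D a)%:R; pose mb a : R := (e a.+1 - e a)%:R.
have nb0 a : (a < theta)%N -> 0 < nb a by move=> /DS; rewrite /nb ltr0n subn_gt0.
have mb0 a : (a < theta)%N -> 0 < mb a by move=> /eS; rewrite /mb ltr0n subn_gt0.
(* With the factor C the total mass is C S, hence C is the inverse of S. *)
pose S := partial_sum (fun b => nb b * mb b / (nb b + mb b)) theta.
have S0 : 0 < S.
  rewrite /S /partial_sum big_mkord.
  rewrite (bigD1 (Ordinal t0)) //= ltr_pwDl //.
    by rewrite divr_gt0 ?mulr_gt0 ?addr_gt0 ?nb0 ?mb0.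
  apply: sumr_ge0 => i _; rewrite divr_ge0 ?mulr_ge0 ?addr_ge0 // ltW // ?nb0 ?mb0 //.
pose C := S^-1.
have C0 : 0 < C by rewrite invr_gt0.
pose u a := C * mb a / (nb a + mb a); pose v a := C * nb a / (nb a + mb a).
have u0 a : (a < theta)%N -> 0 < u a.
  by move=> h; rewrite divr_gt0 ?mulr_gt0 ?addr_gt0 ?nb0 ?mb0.
have v0 a : (a < theta)%N -> 0 < v a.
  by move=> h; rewrite divr_gt0 ?mulr_gt0 ?addr_gt0 ?nb0 ?mb0.
have uv a : (a < theta)%N -> u a + v a = C.
  move=> h; have := nb0 _ h; have := mb0 _ h => m0 n0.
  by rewrite /u /v; field; rewrite gt_eqF // addr_gt0.
(* After cross-multiplication this is [mb a.+1 * nb a < mb a * nb a.+1], the slope hypothesis. *)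
have uS a : (a.+1 < theta)%N -> u a.+1 < u a.
  move=> h; have h' := ltnW h.
  have n0 := nb0 _ h'; have n1 := nb0 _ h; have m0 := mb0 _ h'; have m1 := mb0 _ h.
  rewrite /u ltr_pdivrMr ?addr_gt0 // mulrAC ltr_pdivlMr ?addr_gt0 //.
  have := slope _ h; rewrite -(ltr_nat R) !natrM -/(nb a) -/(nb a.+1) -/(mb a) -/(mb a.+1).
  by rewrite -(ltr_pM2l C0); nra.
(* The gap c is a lower bound for the finitely many jumps of u between consecutive blocks. *)
have [c c0 cu] : exists2 c, 0 < c & forall a, (a < theta.-1)%N -> c <= u a - u a.+1.
  by apply: pos_lower_bound => a h; rewrite subr_gt0 uS //; lia.
have umono a b : (a <= b < theta)%N -> u b <= u a.
  case/andP => /subnK <-; elim: (b - a)%N => //= d IH h.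
  by rewrite addSn (le_trans (ltW (uS _ _))) // IH // ltnW.
have vE a : (a < theta)%N -> v a = C - u a by move=> h; rewrite -(uv _ h) addrC addKr.
pose p i := u (block_index D theta i); pose q j := v (block_index e theta j).
have bt D' i : (block_index D' theta i < theta)%N by exact: block_index_lt.
exists p, q, C, c; split.
- by split=> i; rewrite ?u0 ?v0.
- split=> i j ij; first by rewrite umono // bt block_index_mono.
  rewrite /q !vE // lerD2l lerN2 umono // bt andbT.
  exact: block_index_mono.
- have E a : (a <= theta)%N -> partial_sum p (D a) =
      C * partial_sum (fun b => nb b * mb b / (nb b + mb b)) a.
    move=> ath; rewrite (partial_sum_block D0 DS u ath) /partial_sum mulr_sumr.
    by apply: eq_bigr => b _; rewrite /u -/(nb b); ring.
  split; last by rewrite E // /C mulVf // gt_eqF.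
  move=> a ath; rewrite E // (partial_sum_block e0 eS v ath) /partial_sum mulr_sumr.
  by apply: eq_bigr => b _; rewrite /v -/(mb b); ring.
(* On each block nb u^2 + mb v^2 = C^2 nb mb / (nb + mb), so the total is C^2 S = C. *)
- rewrite (partial_sum_block D0 DS (fun b => u b ^+ 2) (leqnn _)).
  rewrite (partial_sum_block e0 eS (fun b => v b ^+ 2) (leqnn _)).
  rewrite /partial_sum -big_split /=.
  rewrite (eq_big_nat _ _ (F2 := fun b => C ^+ 2 * (nb b * mb b / (nb b + mb b)))).
    by rewrite -mulr_sumr -/(partial_sum _ theta) -/S /C expr2 -mulrA mulVf ?mulr1 // gt_eqF.
  move=> b /andP[_ h]; rewrite -/(nb b) -/(mb b) /u /v.
  have := nb0 _ h; have := mb0 _ h => m0 n0; field.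
  by rewrite gt_eqF // addr_gt0.
- split=> // a b i j ath bth ia jb.
  rewrite /p /q (block_indexE DS ath ia) (block_indexE eS bth jb) vE //; split=> ab.
    by rewrite addrCA lerDl subr_ge0 umono // ab.
  have h : u a <= u b.+1 by rewrite umono // ab.
  have := cu b ltac:(lia); lra.
Qed.

(** * Extreme points of the dimension polygon *)

Section Extreme.
Variables (R : realType) (n m N : nat) (A : 'I_N -> 'M[R[i]]_(n, m)).

Lemma SA_fullv0 : SA A (fullv, 0%VS).
Proof. by move=> u v l _ /=; rewrite memv0 => /eqP ->; rewrite trmx0 map_mx0 mulmx0. Qed.

Lemma SA_0 : SA A (0%VS, 0%VS).
Proof. by move=> u v l; rewrite /= memv0 => /eqP -> _; rewrite !mul0mx. Qed.

(** A maximizer of a linear functional over the dimension pairs may lie inside an edge of the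
    polygon; among the maximizers the one with the largest first dimension is a vertex. *)
Lemma EA_maximizes (p q : R) : (0 < n)%N -> 0 < p -> 0 < q ->
  exists2 P, EA A P & forall P', SA A P' ->
    p * (\dim P'.1)%:R + q * (\dim P'.2)%:R <= p * (\dim P.1)%:R + q * (\dim P.2)%:R.
Proof.
move=> n0 p0 q0.
pose dims := fun z : 'I_n.+1 * 'I_m.+1 =>
  `[< exists P, [/\ SA A P, \dim P.1 = z.1 & \dim P.2 = z.2] >].
pose val (z : 'I_n.+1 * 'I_m.+1) : R := p * (nat_of_ord z.1)%:R + q * (nat_of_ord z.2)%:R.
have dl (k : nat) (V : {vspace 'rV[R[i]]_k}) : (\dim V < k.+1)%N.
  by rewrite ltnS (leq_trans (dimvS (subvf V))) // dimvf /dim /= mul1n.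
have dimsP P : SA A P -> exists2 z : 'I_n.+1 * 'I_m.+1, dims z &
    \dim P.1 = z.1 /\ \dim P.2 = z.2.
  by move=> SP; exists (Ordinal (dl _ P.1), Ordinal (dl _ P.2)) => //; apply/asboolP; exists P.
have [z0 dz0 _] := dimsP _ SA_0.
case: (@Order.TotalTheory.arg_maxP _ _ _ z0 dims val dz0) => z1 dz1 max1.
pose dims2 z := dims z && (val z == val z1).
have dz12 : dims2 z1 by rewrite /dims2 dz1 eqxx.
case: (@Order.TotalTheory.arg_maxP _ _ _ z1 dims2 (fun z : 'I_n.+1 * 'I_m.+1 => nat_of_ord z.1) dz12) => z /andP[dz /eqP vz] max2.
have /asboolP[P [SP P1 P2]] := dz.
have maxP P' : SA A P' ->
    p * (\dim P'.1)%:R + q * (\dim P'.2)%:R <= p * (\dim P.1)%:R + q * (\dim P.2)%:R.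
  move=> /dimsP[z' dz' [-> ->]]; rewrite P1 P2 -!/(val _) vz; exact: max1.
exists P => //.
(* The pair (C^n, 0) has the positive value p n, so the maximizer is not the origin. *)
have nz : dimpair P != 0.
  apply/eqP => -[/eqP + /eqP]; rewrite !pnatr_eq0 => /eqP d1 /eqP d2.
  have := maxP _ SA_fullv0; rewrite /= d1 d2 dimv0 !mulr0 addr0 dimvf /dim /= mul1n.
  by apply/negP; rewrite -ltNge addr0 mulr_gt0 // ltr0n.
split=> //.
(* Points lexicographically below the maximizer, first by value and then by first coordinate: a
   convex set that contains the hull and has the maximizer as an extreme point. *)
pose T' (x y : R) := p * x + q * y < val z \/
   (p * x + q * y = val z /\ x <= (\dim P.1)%:R).
pose T := [set w : R^o * R^o | T' w.1 w.2].
have T'conv (a1 a2 b1 b2 K : R) : 0 < K -> K < 1 -> T' a1 a2 -> T' b1 b2 ->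
    T' (K * a1 + (1 - K) * b1) (K * a2 + (1 - K) * b2).
  move=> k0 k1 + +; rewrite /T'.
  have k1' : 0 < 1 - K by rewrite subr_gt0.
  have -> : p * (K * a1 + (1 - K) * b1) + q * (K * a2 + (1 - K) * b2) =
    K * (p * a1 + q * a2) + (1 - K) * (p * b1 + q * b2) by ring.
  move: (p * a1 + q * a2) (p * b1 + q * b2) (val z) => x y M.
  have wavg (u v w : R) : u <= w -> v <= w -> K * u + (1 - K) * v <= w.
    by move=> /(ler_wpM2l (ltW k0)) h1 /(ler_wpM2l (ltW k1')) h2; lra.
  have avg (u v w : R) : u <= w -> v <= w -> u < w \/ v < w -> K * u + (1 - K) * v < w.
    move=> uw vw; rewrite -subr_ge0 in uw; rewrite -subr_ge0 in vw.
    have := mulr_ge0 (ltW k0) uw; have := mulr_ge0 (ltW k1') vw => h1 h2.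
    case=> h; rewrite -subr_gt0 in h.
      by have := mulr_gt0 k0 h; lra.
    by have := mulr_gt0 k1' h; lra.
  case=> [hx|[hx ha]] [hy|[hy hb]].
  - by left; apply: avg; [exact: ltW | exact: ltW | left].
  - by left; apply: avg; [exact: ltW | rewrite hy | left].
  - by left; apply: avg; [rewrite hx | exact: ltW | right].
  by right; split; [rewrite hx hy; ring | exact: wavg].
have T'ext (a1 a2 b1 b2 t : R) : 0 < t -> t < 1 -> T' a1 a2 -> T' b1 b2 ->
    (\dim P.1)%:R = t * a1 + (1 - t) * b1 -> (\dim P.2)%:R = t * a2 + (1 - t) * b2 ->
    a1 = (\dim P.1)%:R /\ a2 = (\dim P.2)%:R /\ b1 = (\dim P.1)%:R /\ b2 = (\dim P.2)%:R.
  move=> t0 t1; rewrite /T'.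
  have -> : val z = p * (\dim P.1)%:R + q * (\dim P.2)%:R by rewrite P1 P2.
  move: (\dim P.1)%:R (\dim P.2)%:R => d1 d2 Ta Tb E1 E2.
  have t1' : 0 < 1 - t by rewrite subr_gt0.
  have E : p * d1 + q * d2 = t * (p * a1 + q * a2) + (1 - t) * (p * b1 + q * b2).
    by rewrite E1 E2; ring.
  clear -t0 t1 t1' q0 E Ta Tb E1 E2.
  have [La Lb] : p * a1 + q * a2 <= p * d1 + q * d2 /\ p * b1 + q * b2 <= p * d1 + q * d2.
    by case: Ta => [?|[? _]]; case: Tb => [?|[? _]]; split; lra.
  have squeeze (u v w : R) : u <= w -> v <= w -> w = t * u + (1 - t) * v -> u = w /\ v = w.
    move=> uw vw e; rewrite -subr_ge0 in uw; rewrite -subr_ge0 in vw.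
    have h1 := mulr_ge0 (ltW t0) uw; have h2 := mulr_ge0 (ltW t1') vw.
    have e1 : t * (w - u) = 0 by lra.
    have e2 : (1 - t) * (w - v) = 0 by lra.
    move/eqP: e1; rewrite mulf_eq0 (gt_eqF t0) /= subr_eq0 => /eqP <-.
    by move/eqP: e2; rewrite mulf_eq0 (gt_eqF t1') /= subr_eq0 => /eqP <-.
  have [Ea Eb] := squeeze _ _ _ La Lb E.
  have [la lb] : a1 <= d1 /\ b1 <= d1.
    by case: Ta => [?|[_ ?]]; case: Tb => [?|[_ ?]]; split=> //; lra.
  have [ea eb] := squeeze _ _ _ la lb E1.
  have q0' : q != 0 by rewrite gt_eqF.
  by move: Ea Eb; rewrite ea eb => /addrI /(mulfI q0') -> /addrI /(mulfI q0') ->.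
have hullT : convex_hull (@dimpair R n m @` SA A) `<=` T.
  apply: smallest_sub.
    apply/convex_setW => a b; rewrite !inE => Ta Tb k k0 k1.
    move: Ta Tb; rewrite /T; case: a => a1 a2; case: b => b1 b2 Ta Tb.
    by rewrite inE; exact: (T'conv _ _ _ _ _ k0 k1 Ta Tb).
  move=> _ [P' SP' <-]; rewrite /T /T' /dimpair /=.
  have [z' dz' [e1 e2]] := dimsP _ SP'; rewrite e1 e2 -/(val z').
  have : val z' <= val z1 := max1 _ dz'; rewrite -vz le_eqVlt => /predU1P[E|lt]; [right|by left].
  split=> //; rewrite P1 ler_nat; apply: max2.
  by rewrite /dims2 dz' E vz eqxx.
split; first by apply: sub_gen_smallest; exists P.
move=> [a1 a2] [b1 b2] t /hullT Ta /hullT Tb /andP[t0 t1] [E1 E2].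
have [ea [eb [fa fb]]] := T'ext _ _ _ _ _ t0 t1 Ta Tb E1 E2.
by split; congr (_, _).
Qed.
End Extreme.

Lemma convex_hull_conv (R : realType) (V : lmodType R) (K : set V) (x y : V) (t : R) :
  convex_hull K x -> convex_hull K y -> 0 <= t -> t <= 1 ->
  convex_hull K (t *: x + (1 - t) *: y).
Proof.
move=> hx hy t0 t1 C [convC KC].
have := convC x y (Itv01 t0 t1); rewrite !inE; apply; [exact: hx | exact: hy].
Qed.

Lemma block_exists (D : nat -> nat) theta i : D 0%N = 0%N -> (i < D theta)%N ->
  exists2 a, (a < theta)%N & (D a <= i < D a.+1)%N.
Proof.
move=> D0; elim: theta => [|t IH]; first by rewrite D0.
case: (ltnP i (D t)) => [/IH[a /ltnW ? ?] _|h h']; first by exists a.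
by exists t; rewrite ?h ?h'.
Qed.

(** Cramer's rule gives la and nu; the last hypothesis, that the middle point is not beyond the
    segment between the outer ones, amounts to la + nu <= 1. *)
Lemma planar_combination (R : realFieldType) (d0 d1 d2 e0 e1 e2 : R) :
  0 <= d2 -> 0 <= e0 -> d2 < d1 -> d1 < d0 -> e0 < e1 -> e1 < e2 ->
  (e1 - e0) * (d1 - d2) <= (e2 - e1) * (d0 - d1) ->
  exists la nu : R,
    [/\ 0 < la, 0 < nu, la + nu <= 1, la * d0 + nu * d2 = d1 & la * e0 + nu * e2 = e1].
Proof.
move=> D2 E0 D21 D10 E01 E12 LE.
pose del := d0 * e2 - d2 * e0.
have del0 : 0 < del.
  rewrite subr_gt0 (@le_lt_trans _ _ (d0 * e0)) //.
    by rewrite ler_wpM2r //; lra.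
  by rewrite ltr_pM2l; lra.
pose la := (d1 * e2 - d2 * e1) / del; pose nu := (d0 * e1 - d1 * e0) / del.
have la0 : 0 < la.
  rewrite divr_gt0 // subr_gt0 (@le_lt_trans _ _ (d1 * e1)) //.
    by rewrite ler_wpM2r //; lra.
  by rewrite ltr_pM2l; lra.
have nu0 : 0 < nu.
  rewrite divr_gt0 // subr_gt0 (@le_lt_trans _ _ (d0 * e0)) //.
    by rewrite ler_wpM2r //; lra.
  by rewrite ltr_pM2l; lra.
have deln : del != 0 by rewrite gt_eqF.
exists la, nu; split=> //; last 2 first.
- by rewrite /la /nu /del in deln *; field.
- by rewrite /la /nu /del in deln *; field.
rewrite /la /nu -mulrDl ler_pdivrMr // mul1r /del.
by rewrite -subr_ge0 in LE; rewrite -subr_ge0; apply: le_trans LE _; rewrite le_eqVlt; apply/orP; left; apply/eqP; ring.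
Qed.

Section Chain.
Variables (R : realType) (n m N : nat) (A : 'I_N -> 'M[R[i]]_(n, m)).

Lemma convex_hull_SA P : SA A P -> convex_hull (@dimpair R n m @` SA A) (dimpair P).
Proof. by move=> SP; apply: sub_gen_smallest; exists P. Qed.

(* If the three points failed to be in strictly convex position, the middle one would be a
   convex combination of the two others and of the origin. *)
Lemma extreme_points_slope P0 P1 P2 : SA A P0 -> SA A P2 -> EA A P1 ->
  (\dim P2.1 < \dim P1.1)%N -> (\dim P1.1 < \dim P0.1)%N ->
  (\dim P0.2 < \dim P1.2)%N -> (\dim P1.2 < \dim P2.2)%N ->
  ((\dim P2.2 - \dim P1.2) * (\dim P0.1 - \dim P1.1) <
   (\dim P1.2 - \dim P0.2) * (\dim P1.1 - \dim P2.1))%N.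
Proof.
move=> S0 S2 [_ nz [_ ext]] d21 d10 e01 e12; rewrite ltnNge; apply/negP => le.
have h0 := convex_hull_SA S0; have h2 := convex_hull_SA S2.
have h00 := convex_hull_SA (@SA_0 R n m N A).
have z00 : @dimpair R n m (0%VS, 0%VS) = 0 by rewrite /dimpair /= !dimv0.
rewrite z00 in h00.
pose d0 : R := (\dim P0.1)%:R; pose d1 : R := (\dim P1.1)%:R; pose d2 : R := (\dim P2.1)%:R.
pose e0 : R := (\dim P0.2)%:R; pose e1 : R := (\dim P1.2)%:R; pose e2 : R := (\dim P2.2)%:R.
have LE : (e1 - e0) * (d1 - d2) <= (e2 - e1) * (d0 - d1).
  by move: le; rewrite -(ler_nat R) !natrM !natrB // ltnW.
have [la [nu [la0 nu0 t1 eqd eqe]]] : exists la nu : R,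
    [/\ 0 < la, 0 < nu, la + nu <= 1, la * d0 + nu * d2 = d1 & la * e0 + nu * e2 = e1].
  by apply: planar_combination => //; rewrite ?ltr_nat ?ler0n.
have pE (P : {vspace 'rV[R[i]]_n} * {vspace 'rV[R[i]]_m}) (x y : R) :
  (\dim P.1)%:R = x -> (\dim P.2)%:R = y -> dimpair P = (x, y) by move=> <- <-.
have P0E := pE P0 d0 e0 erefl erefl; have P1E := pE P1 d1 e1 erefl erefl.
have P2E := pE P2 d2 e2 erefl erefl.
(* The combination is taken in two stages: z on the segment from P0 to P2, then P1 = t z between z
   and the origin. For t < 1 extremality applied to the second stage makes P1 the origin; for t = 1
   the first stage makes it equal to P0. *)
pose t := la + nu.
have t0 : 0 < t by rewrite addr_gt0.
rewrite -/t in t1; have tn : t != 0 by rewrite gt_eqF.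
pose s := la / t.
have s0 : 0 < s by rewrite divr_gt0.
have s1 : s < 1 by rewrite /s ltr_pdivrMr // mul1r ltrDl.
have ts : t * s = la by rewrite /s mulrC divfK.
have ts' : t * (1 - s) = nu by rewrite mulrBr ts mulr1 /t addrC addKr.
pose z := s *: dimpair P0 + (1 - s) *: dimpair P2.
have hz := convex_hull_conv h0 h2 (ltW s0) (ltW s1).
have tz : t *: z = dimpair P1.
  rewrite /z scalerDr !scalerA ts ts' P0E P1E P2E.
  by congr (_, _); [exact: eqd | exact: eqe].
have [t1'|t1'] := eqVneq t 1.
  have := ext _ _ s h0 h2; rewrite s0 s1 -tz t1' scale1r => /(_ isT erefl) [E _].
  have : dimpair P0 = dimpair P1 by rewrite -tz t1' scale1r.
  by move=> [/eqP + _]; rewrite eqr_nat gtn_eqF.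
have := ext _ _ t hz h00; rewrite t0 lt_neqAle t1' t1 scaler0 addr0 => /(_ isT (esym tz)) [_ E].
by rewrite -E eqxx in nz.
Qed.

Variables (theta : nat) (X : nat -> {vspace 'rV[R[i]]_n}) (Y : nat -> {vspace 'rV[R[i]]_m}).
Hypotheses (n0 : (0 < n)%N) (m0 : (0 < m)%N) (hXY : EA_chain A theta X Y).

Lemma EA_chain_mem a : (a <= theta)%N -> EA A (X a, Y a).
Proof. by move=> h; case: hXY => -> *; exists a. Qed.

Lemma EA_chain_dimX a : (a < theta)%N -> (\dim (X a.+1) < \dim (X a))%N.
Proof.
case: hXY => _ _ _ hX _ /hX[sub ne]; rewrite ltn_neqAle dimvS // andbT.
by apply: contra ne => /eqP d; rewrite eqEdim sub d leqnn.
Qed.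

Lemma EA_chain_dimY a : (a < theta)%N -> (\dim (Y a) < \dim (Y a.+1))%N.
Proof.
case: hXY => _ _ _ _ hY /hY[sub ne]; rewrite ltn_neqAle dimvS // andbT.
by apply: contra ne => /eqP d; rewrite eqEdim sub d leqnn.
Qed.

Lemma dim_rV_le k (V : {vspace 'rV[R[i]]_k}) : (\dim V <= k)%N.
Proof. by rewrite (leq_trans (dimvS (subvf V))) // dimvf /dim /= mul1n. Qed.

Lemma dim_rV_full k : \dim (fullv : {vspace 'rV[R[i]]_k}) = k.
Proof. by rewrite dimvf /dim /= mul1n. Qed.

(** Rows are counted from the end of the X-flag, so block boundaries are n - dim X_a on the row side
    and dim Y_a on the column side. The inequality for all of S_A, not only for the chain, is what
    the lower bound on f_A rests on. *)
Lemma block_marginals :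
  exists (p q : nat -> R) (C c : R),
  [/\ (forall i, 0 < p i) /\ (forall j, 0 < q j),
      (forall i j, (i <= j)%N -> p j <= p i) /\ (forall i j, (i <= j)%N -> q i <= q j),
      [/\ partial_sum p n = 1, partial_sum q m = 1 &
        partial_sum (fun i => p i ^+ 2) n + partial_sum (fun j => q j ^+ 2) m = C],
      (forall P, SA A P -> partial_sum q (\dim P.2) <= partial_sum p (n - \dim P.1)) &
      0 < c /\ forall i j, (i < n)%N -> (j < m)%N ->
        if `[< exists a, [/\ (a <= theta)%N, (n - \dim (X a) <= i)%N & (j < \dim (Y a))%N] >]
        then p i + q j <= C - c else C <= p i + q j].
Proof.
have [EAE [X0 Xt] [Y0 Yt] _ _] := hXY.
pose D a := (n - \dim (X a))%N; pose e a := (\dim (Y a))%N.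
have D0 : D 0%N = 0%N by rewrite /D X0 dim_rV_full subnn.
have Dt : D theta = n by rewrite /D Xt dimv0 subn0.
have e0 : e 0%N = 0%N by rewrite /e Y0 dimv0.
have et : e theta = m by rewrite /e Yt dim_rV_full.
have t0 : (0 < theta)%N by rewrite lt0n; apply: contraL n0 => /eqP t; rewrite -Dt t D0.
have DS a : (a < theta)%N -> (D a < D a.+1)%N.
  by move=> h; have := EA_chain_dimX h; have := dim_rV_le (X a); rewrite /D; lia.
have eS a : (a < theta)%N -> (e a < e a.+1)%N by exact: EA_chain_dimY.
have slope a : (a.+1 < theta)%N ->
    ((e a.+2 - e a.+1) * (D a.+1 - D a) < (e a.+1 - e a) * (D a.+2 - D a.+1))%N.
  move=> h; have h' := ltnW h.
  have [S0 _ _] := EA_chain_mem (ltnW h'); have [S2 _ _] := EA_chain_mem h.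
  have := extreme_points_slope S0 S2 (EA_chain_mem h') (EA_chain_dimX h) (EA_chain_dimX h')
    (EA_chain_dimY h') (EA_chain_dimY h) => /=.
  have := dim_rV_le (X a); have := EA_chain_dimX h; have := EA_chain_dimX h'.
  rewrite -/(e _) -/(e _) -/(e _) /D => x1 x2 x3.
  have -> : (n - \dim (X a.+1) - (n - \dim (X a)) = \dim (X a) - \dim (X a.+1))%N by lia.
  by have -> : (n - \dim (X a.+2) - (n - \dim (X a.+1)) = \dim (X a.+1) - \dim (X a.+2))%N by lia.
have [p [q [C [c [pq0 [pm qm] [pq p1] sqC [c0 blk]]]]]] :=
  @optimal_marginals R D e theta t0 D0 e0 DS eS slope.
have q1 : partial_sum q m = 1 by rewrite -et -pq // p1.
rewrite Dt in p1 sqC; rewrite et in sqC.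
have [p0 q0] := pq0.
exists p, q, C, c; split=> //.
- move=> [V W] SP /=.
  have [->|Wn] := posnP (\dim W).
    by rewrite partial_sum0 -(partial_sum0 p) partial_sum_le // => i; rewrite ltW.
  have [Vn|Vn] := posnP (\dim V).
    by rewrite Vn subn0 p1 -q1 partial_sum_le ?dim_rV_le // => i; rewrite ltW.
  set x := (n - \dim V)%N.
  (* With the slopes of the two partial sums at (V, W) as weights, some member g of the chain
     dominates (V, W). The tangent inequalities carry the comparison to g, where the two partial
     sums agree. *)
  have [_ /[!EAE] -[g gt ->] max] := @EA_maximizes R n m N A _ _ n0 (p0 x) (q0 (\dim W).-1).
  have := max _ SP; rewrite /= => mx.
  have Q := partial_sum_tangent qm (\dim W).-1 (e g).
  have P := partial_sum_tangent_anti pm x (D g).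
  rewrite (prednK Wn) in Q.
  have := pq g gt => PQ.
  have xE : x%:R = n%:R - (\dim V)%:R :> R by rewrite natrB ?dim_rV_le.
  have DE : (D g)%:R = n%:R - (\dim (X g))%:R :> R by rewrite natrB ?dim_rV_le.
  rewrite -/(e g) in mx; rewrite xE DE in P; lra.
- split=> // i j; rewrite -{1}Dt -{1}et => /(block_exists D0)[a ath ia] /(block_exists e0)[b bth jb].
  have [le gt] := blk a b i j ath bth ia jb.
  (* With i in row block a and j in column block b, a zero block covers (i, j) exactly when b <
     a. *)
  case: asboolP => [[g [gth ig jg]]|h].
    apply: gt; rewrite ltnNge; apply/negP => ab.
    have ga : (g <= a)%N.
      rewrite leqNgt; apply/negP => ag.
      by have := @block_bound_mono D theta DS a.+1 g; rewrite ag gth /D => /(_ isT); move: ia; rewrite /D; lia.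
    have := @block_bound_mono e theta eS g b; rewrite (leq_trans ga ab) (ltnW bth) => /(_ isT).
    by move: jb; rewrite /e; lia.
  apply: le; rewrite leqNgt; apply/negP => ba; apply: h; exists a.
  case/andP: ia => ia _; rewrite -/(D a) ia ltnW //; split=> //.
  have := @block_bound_mono e theta eS b.+1 a; rewrite ba ltnW // => /(_ isT).
  by move: jb; rewrite /e; lia.
Qed.

End Chain.

(** * Complex matrices and matrix exponentials *)

(* Typing complex numbers as elements of this structure, and not of [R[i]], makes the
   algebraic structures inferred on matrices syntactically equal; otherwise rewriting has to
   compare unfolded instances. *)
Definition Cx (R : realType) : numClosedFieldType := R[i].

Section ComplexNumbers.
Variable R : realType.
Local Notation C := (Cx R).
Implicit Types z w : C.

Definition rc (a : R) : C := a%:C.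
Definition re z : R := complex.Re z.
Definition im z : R := complex.Im z.

Let rc_is_zmod_morphism : zmod_morphism rc. Proof. exact: rmorphB. Qed.
Let rc_is_monoid_morphism : monoid_morphism rc.
Proof. by split; [exact: rmorph1 | exact: rmorphM]. Qed.
HB.instance Definition _ := GRing.isZmodMorphism.Build R C rc rc_is_zmod_morphism.
HB.instance Definition _ := GRing.isMonoidMorphism.Build R C rc rc_is_monoid_morphism.

Let re_is_zmod_morphism : zmod_morphism re.
Proof. by case=> a b [c d]. Qed.
HB.instance Definition _ := GRing.isZmodMorphism.Build C R re re_is_zmod_morphism.
Let im_is_zmod_morphism : zmod_morphism im.
Proof. by case=> a b [c d]. Qed.
HB.instance Definition _ := GRing.isZmodMorphism.Build C R im im_is_zmod_morphism.

Definition abs2 z : R := re z ^+ 2 + im z ^+ 2.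

Lemma abs2_normc z : abs2 z = Normc.normc z ^+ 2.
Proof. by case: z => a b; rewrite /abs2 /= sqr_sqrtr // addr_ge0 ?sqr_ge0. Qed.

Lemma Cx_eqP z w : re z = re w -> im z = im w -> z = w.
Proof. by case: z w => [a b] [c d] /= -> ->. Qed.

Lemma abs2_ge0 z : 0 <= abs2 z. Proof. by rewrite addr_ge0 ?sqr_ge0. Qed.

Lemma abs2M z w : abs2 (z * w) = abs2 z * abs2 w.
Proof. by rewrite !abs2_normc Normc.normcM exprMn. Qed.

Lemma re_rc a : re (rc a) = a. Proof. by []. Qed.
Lemma im_rc a : im (rc a) = 0. Proof. by []. Qed.

Lemma abs2_rc a : abs2 (rc a) = a ^+ 2.
Proof. by rewrite /abs2 re_rc im_rc expr0n addr0. Qed.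

Lemma abs2_0 : abs2 0 = 0. Proof. by rewrite -(rmorph0 rc) abs2_rc expr0n. Qed.

Lemma re_conj z : re (Num.conj z) = re z. Proof. by case: z. Qed.
Lemma im_conj z : im (Num.conj z) = - im z. Proof. by case: z. Qed.

Lemma reM z w : re (z * w) = re z * re w - im z * im w.
Proof. by case: z w => [a b] [c d]. Qed.

Lemma imM z w : im (z * w) = re z * im w + im z * re w.
Proof. by case: z w => [a b] [c d]. Qed.

Lemma mul_conj_abs2 z : z * Num.conj z = rc (abs2 z).
Proof.
by apply: Cx_eqP; rewrite ?reM ?imM re_conj im_conj ?re_rc ?im_rc /abs2; ring.
Qed.

Lemma abs2_eq0 z : abs2 z = 0 -> z = 0.
Proof.
rewrite abs2_normc => /eqP; rewrite expf_eq0 /= => /eqP; exact: Normc.eq0_normc.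
Qed.

Lemma normc_ge0 z : 0 <= Normc.normc z.
Proof. by case: z => a b /=; exact: sqrtr_ge0. Qed.

Lemma re_rcM a z : re (rc a * z) = a * re z.
Proof. by rewrite reM im_rc mul0r subr0. Qed.

Lemma im_rcM a z : im (rc a * z) = a * im z.
Proof. by rewrite imM im_rc mul0r addr0. Qed.

Lemma conj_rc a : Num.conj (rc a) = rc a.
Proof. by apply: Cx_eqP; rewrite ?re_conj ?im_conj ?im_rc ?oppr0. Qed.

Lemma rc_inj : injective rc. Proof. by move=> a b []. Qed.

Lemma rc_re z : z \is Num.real -> rc (re z) = z. Proof. exact: RRe_real. Qed.

Lemma rcM a b : rc (a * b) = rc a * rc b. Proof. exact: rmorphM. Qed.
Lemma rcD a b : rc (a + b) = rc a + rc b. Proof. exact: rmorphD. Qed.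
Lemma rcB a b : rc (a - b) = rc a - rc b. Proof. exact: rmorphB. Qed.
Lemma rcN a : rc (- a) = - rc a. Proof. exact: rmorphN. Qed.
Lemma rcV a : rc a^-1 = (rc a)^-1. Proof. exact: fmorphV. Qed.
Lemma rc1 : rc 1 = 1. Proof. exact: rmorph1. Qed.
Lemma rc0 : rc 0 = 0. Proof. exact: rmorph0. Qed.
Lemma rc_sum (I : Type) (r : seq I) (P : pred I) (F : I -> R) :
  rc (\sum_(i <- r | P i) F i) = \sum_(i <- r | P i) rc (F i).
Proof. exact: rmorph_sum. Qed.

Lemma rc_prod (I : Type) (r : seq I) (P : pred I) (F : I -> R) :
  rc (\prod_(i <- r | P i) F i) = \prod_(i <- r | P i) rc (F i).
Proof. exact: rmorph_prod. Qed.

Lemma reD z w : re (z + w) = re z + re w. Proof. exact: raddfD. Qed.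
Lemma reB z w : re (z - w) = re z - re w. Proof. exact: raddfB. Qed.
Lemma re_sum (I : Type) (r : seq I) (P : pred I) (F : I -> C) :
  re (\sum_(i <- r | P i) F i) = \sum_(i <- r | P i) re (F i).
Proof. exact: raddf_sum. Qed.

Lemma rc_lt a b : (rc a < rc b) = (a < b). Proof. exact: ltcR. Qed.

End ComplexNumbers.

Section Adjoint.
Variable C : numClosedFieldType.

Lemma adjM n m p (A : 'M[C]_(n, m)) (B : 'M[C]_(m, p)) : (A *m B)^t* = B^t* *m A^t*.
Proof. by rewrite trmx_mul map_mxM. Qed.

Lemma adjK n m (A : 'M[C]_(n, m)) : A^t*^t* = A. Proof. exact: trmxCK. Qed.

Lemma adjD n m (A B : 'M[C]_(n, m)) : (A + B)^t* = A^t* + B^t*.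
Proof. by apply/matrixP => i j; rewrite !mxE rmorphD. Qed.

Lemma adjE n m (A : 'M[C]_(n, m)) i j : (A^t*) i j = Num.conj (A j i).
Proof. by rewrite !mxE. Qed.

Lemma adj1 n : (1%:M : 'M[C]_n)^t* = 1%:M.
Proof. by rewrite trmx1 map_mx1. Qed.

Lemma adj_sum n m (I : finType) (F : I -> 'M[C]_(n, m)) :
  (\sum_i F i)^t* = \sum_i (F i)^t*.
Proof.
by apply/matrixP => i j; rewrite !mxE !summxE rmorph_sum; apply: eq_bigr => l _; rewrite !mxE.
Qed.

Lemma hermsymmxP n (M : 'M[C]_n) : M \is hermsymmx <-> M^t* = M.
Proof.
split=> [/is_hermitianmxP {2}->|h]; first by rewrite expr0 scale1r.
by apply/is_hermitianmxP; rewrite expr0 scale1r h.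
Qed.

Lemma unitary_adj_mul n (s : 'M[C]_n) : s \is unitarymx -> s^t* *m s = 1%:M.
Proof. by move=> su; rewrite -invmx_unitary // mulVmx // unitarymx_unit. Qed.

Lemma unitary_mul_adj n (s : 'M[C]_n) : s \is unitarymx -> s *m s^t* = 1%:M.
Proof. by move/unitarymxP. Qed.

Lemma adj_inv n (g : 'M[C]_n) : g \in unitmx -> (invmx g)^t* = invmx (g^t*).
Proof.
move=> gu; have gu' : g^t* \in unitmx.
  by have := gu; rewrite !unitmxE det_map_mx det_tr !unitfE fmorph_eq0.
by rewrite -[RHS]mul1mx -adj1 -(mulmxV gu) adjM mulmxK.
Qed.

Lemma unitmx_adj n (g : 'M[C]_n) : (g^t* \in unitmx) = (g \in unitmx).
Proof. by rewrite !unitmxE det_map_mx det_tr !unitfE fmorph_eq0. Qed.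

End Adjoint.

Section RealDiagonal.
Variable R : realType.
Local Notation C := (Cx R).

Definition rdg n (a : 'rV[R]_n) : 'M[C]_n := diag_mx (map_mx (@rc R) a).

Lemma adj_rdg n (a : 'rV[R]_n) : (rdg a)^t* = rdg a.
Proof.
apply/matrixP => i j; rewrite !mxE eq_sym; case: eqVneq => [->|_]; last by rewrite !mulr0n conjC0.
by rewrite !mulr1n conj_rc.
Qed.

Lemma rdg_mul n (a b : 'rV[R]_n) : rdg a *m rdg b = rdg (\row_i (a 0 i * b 0 i)).
Proof.
rewrite /rdg mulmx_diag; congr diag_mx; apply/rowP => i.
by rewrite !mxE rmorphM.
Qed.

Lemma rdg_const n (c : R) : rdg (const_mx c : 'rV_n) = (rc c)%:M.
Proof. by apply/matrixP => i j; rewrite !mxE. Qed.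

Lemma rdgZ n (c : R) (a : 'rV[R]_n) : rdg (c *: a) = rc c *: rdg a.
Proof.
by apply/matrixP => i j; rewrite !mxE; case: eqP => _; rewrite ?mulr0n ?mulr0 // !mulr1n rmorphM.
Qed.

Lemma rdgE n (a : 'rV[R]_n) i : rdg a i i = rc (a 0 i).
Proof. by rewrite !mxE eqxx mulr1n. Qed.

(** For unitary [s] a spectral decomposition; it is also used with an invertible [s] that is not
    unitary, where it is a congruence. *)
Definition udiag n (s : 'M[C]_n) (a : 'rV[R]_n) : 'M[C]_n := s^t* *m rdg a *m s.

Lemma adj_udiag n (s : 'M[C]_n) a : (udiag s a)^t* = udiag s a.
Proof. by rewrite /udiag !adjM adj_rdg adjK mulmxA. Qed.

Lemma udiag_mul n (s : 'M[C]_n) a b : s \is unitarymx ->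
  udiag s a *m udiag s b = udiag s (\row_i (a 0 i * b 0 i)).
Proof.
move=> su; transitivity (s^t* *m (rdg a *m (s *m s^t*) *m rdg b) *m s).
  by rewrite /udiag !mulmxA.
by rewrite (unitary_mul_adj su) mulmx1 rdg_mul.
Qed.

Lemma udiag_const n (s : 'M[C]_n) (c : R) : s \is unitarymx ->
  udiag s (const_mx c) = (rc c)%:M.
Proof.
by move=> su; rewrite /udiag rdg_const mul_mx_scalar -scalemxAl (unitary_adj_mul su) scalemx1.
Qed.

Lemma udiagZ n (s : 'M[C]_n) (c : R) a : rc c *: udiag s a = udiag s (c *: a).
Proof. by rewrite /udiag scalemxAl scalemxAr rdgZ. Qed.

Lemma udiagE n (s : 'M[C]_n) a i j :
  udiag s a i j = \sum_l rc (a 0 l) * (Num.conj (s l i) * s l j).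
Proof.
rewrite /udiag mul_mx_diag !mxE; apply: eq_bigr => l _; rewrite !mxE.
by rewrite mulrAC mulrC mulrA.
Qed.

Lemma hermitian_udiag n (M : 'M[C]_n) : M^t* = M ->
  exists s a, s \is unitarymx /\ M = udiag s a.
Proof.
move=> /hermsymmxP hM; exists (spectralmx M), (map_mx (@re R) (spectral_diag M)).
split; first exact: spectral_unitarymx.
have /hermitian_normalmx /orthomx_spectralP E := hM.
rewrite {1}E (invmx_unitary (spectral_unitarymx M)) /udiag; congr (_ *m _ *m _).
rewrite /rdg; congr diag_mx; apply/rowP => i; rewrite !mxE /=.
have /mxOverP/(_ 0 i) := hermitian_spectral_diag_real hM.
by move/rc_re => ->.
Qed.

Lemma udiagX n (s : 'M[C]_n) a k : s \is unitarymx ->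
  udiag s a ^+ k = udiag s (\row_i (a 0 i ^+ k)).
Proof.
move=> su; elim: k => [|k IH].
  rewrite expr0 (_ : \row_i _ = const_mx 1) ?(udiag_const _ su) ?rmorph1 //.
  by apply/rowP => i; rewrite !mxE expr0.
rewrite exprS IH -[LHS]/(_ *m _) (udiag_mul _ _ su); congr udiag.
by apply/rowP => i; rewrite !mxE exprS.
Qed.

(** Each entry of a partial sum of the matrix series is a fixed linear combination of partial sums
    of real exponential series, one per eigenvalue, so its real and imaginary parts converge. *)
Lemma mexp_udiag n (s : 'M[C]_n) a : s \is unitarymx ->
  mexp (udiag s a) = udiag s (map_mx expR a).
Proof.
move=> su; apply/matrixP => i j; rewrite /mexp [LHS]mxE.
have E K : (\sum_(0 <= k < K) ((k`!%:R^-1 : C) *: (udiag s a ^+ k))) i j =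
    \sum_l rc (series (exp_coeff (a 0 l)) K) * (Num.conj (s l i) * s l j).
  rewrite summxE.
  under eq_bigr => k _ do rewrite udiagX // mxE udiagE mulr_sumr.
  rewrite exchange_big /=; apply: eq_bigr => l _.
  rewrite /series /= rmorph_sum mulr_suml; apply: eq_bigr => k _.
  rewrite mxE /exp_coeff /= mulrA -[k`!%:R](rmorph_nat (@rc R)).
  by rewrite -fmorphV -rmorphM mulrC [X in rc X]mulrC mulrC.
have cvE l : series (exp_coeff (a 0 l)) n @[n --> \oo] --> expR (a 0 l).
  exact: is_cvg_series_exp_coeff.
have cv (z : 'I_n -> R) : (\sum_l series (exp_coeff (a 0 l)) K * z l) @[K --> \oo] -->
    \sum_l expR (a 0 l) * z l.
  apply: cvg_big => [|l _]; first exact: add_continuous.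
  by apply: cvgM; [exact: cvE | exact: cvg_cst].
have lim_eq (u v : nat -> R) (l : R) : v @ \oo --> l -> u =1 v -> limn u = l.
  by move=> cl uv; rewrite (funext uv); exact: (cvg_lim (@Rhausdorff R)).
rewrite udiagE; apply: Cx_eqP.
- rewrite raddf_sum /=; under eq_bigr do rewrite mxE re_rcM.
  apply: lim_eq (cv (fun l => re (Num.conj (s l i) * s l j))) _ => K.
  by rewrite -[LHS]/(re _) E raddf_sum; apply: eq_bigr => l _; exact: re_rcM.
- rewrite raddf_sum /=; under eq_bigr do rewrite mxE im_rcM.
  apply: lim_eq (cv (fun l => im (Num.conj (s l i) * s l j))) _ => K.
  by rewrite -[LHS]/(im _) E raddf_sum; apply: eq_bigr => l _; exact: im_rcM.
Qed.

End RealDiagonal.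

Section Gram.
Variable R : realType.
Local Notation C := (Cx R).

Definition fr2 n m (M : 'M[C]_(n, m)) : R := \sum_i \sum_j abs2 (M i j).

Lemma fr2_ge0 n m (M : 'M[C]_(n, m)) : 0 <= fr2 M.
Proof. by apply: sumr_ge0 => i _; apply: sumr_ge0 => j _; exact: abs2_ge0. Qed.

Lemma fr2_eq0 n m (M : 'M[C]_(n, m)) : fr2 M = 0 -> M = 0.
Proof.
have h0 i : 0 <= \sum_j abs2 (M i j) by apply: sumr_ge0 => j _; exact: abs2_ge0.
move/eqP; rewrite psumr_eq0 // => /allP h; apply/matrixP => i j; rewrite mxE.
have := h i (mem_index_enum _); rewrite psumr_eq0 => [/allP h'|k _]; last exact: abs2_ge0.
exact/abs2_eq0/eqP/h'/mem_index_enum.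
Qed.

Lemma tr_mul_adj n m (M : 'M[C]_(n, m)) : \tr (M *m M^t*) = rc (fr2 M).
Proof.
rewrite /fr2 rmorph_sum; apply: eq_bigr => i _; rewrite mxE rmorph_sum.
by apply: eq_bigr => j _; rewrite adjE mul_conj_abs2.
Qed.

Variables (n m N : nat).
Implicit Types (B : 'I_N -> 'M[C]_(n, m)).

Definition scal B (g : 'M[C]_n) (h : 'M[C]_m) : 'I_N -> 'M[C]_(n, m) :=
  fun l => g *m B l *m h^t*.

Definition nrm2 B : R := \sum_l fr2 (B l).
Definition rowgram B : 'M[C]_n := \sum_l B l *m (B l)^t*.
Definition colgram B : 'M[C]_m := \sum_l (B l)^t* *m B l.

Lemma tr_rowgram B : \tr (rowgram B) = rc (nrm2 B).
Proof.
rewrite /rowgram raddf_sum /= /nrm2 rmorph_sum.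
by apply: eq_bigr => l _; exact: tr_mul_adj.
Qed.

Lemma tr_colgram B : \tr (colgram B) = rc (nrm2 B).
Proof.
rewrite /colgram raddf_sum /= /nrm2 rmorph_sum.
by apply: eq_bigr => l _; rewrite mxtrace_mulC; exact: tr_mul_adj.
Qed.

Lemma adj_rowgram B : (rowgram B)^t* = rowgram B.
Proof. by rewrite /rowgram adj_sum; apply: eq_bigr => l _; rewrite adjM adjK. Qed.

Lemma adj_colgram B : (colgram B)^t* = colgram B.
Proof. by rewrite /colgram adj_sum; apply: eq_bigr => l _; rewrite adjM adjK. Qed.

Lemma scal_scal B g h g' h' : scal (scal B g h) g' h' = scal B (g' *m g) (h' *m h).
Proof. by apply/funext => l; rewrite /scal adjM !mulmxA. Qed.

Lemma rowgram_scal_unitary B g h : h \is unitarymx ->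
  rowgram (scal B g h) = g *m rowgram B *m g^t*.
Proof.
move=> hu; rewrite /rowgram mulmx_sumr mulmx_suml; apply: eq_bigr => l _.
rewrite /scal !adjM adjK; transitivity (g *m B l *m (h^t* *m h) *m (B l)^t* *m g^t*).
  by rewrite !mulmxA.
by rewrite (unitary_adj_mul hu) mulmx1 !mulmxA.
Qed.

Lemma colgram_scal_unitary B g h : g \is unitarymx ->
  colgram (scal B g h) = h *m colgram B *m h^t*.
Proof.
move=> gu; rewrite /colgram mulmx_sumr mulmx_suml; apply: eq_bigr => l _.
rewrite /scal !adjM adjK; transitivity (h *m (B l)^t* *m (g^t* *m g) *m (B l) *m h^t*).
  by rewrite !mulmxA.
by rewrite (unitary_adj_mul gu) mulmx1 !mulmxA.
Qed.

Lemma nrm2_scal_unitary B g h : g \is unitarymx -> h \is unitarymx -> nrm2 (scal B g h) = nrm2 B.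
Proof.
move=> gu hu; apply: (@rc_inj R); rewrite -!tr_rowgram rowgram_scal_unitary //.
by rewrite mxtrace_mulC mulmxA (unitary_adj_mul gu) mul1mx.
Qed.

(** Any factorization of x and y may be used, so each later argument can choose the factor that
    suits it: a square root, a diagonalizing frame or the exponential of half a logarithm. *)
Lemma kempf_nessE B g h :
  kempf_ness B (g^t* *m g) (h^t* *m h) = ln (nrm2 (scal B g h)).
Proof.
have E : \tr (\sum_l (g^t* *m g *m B l *m (h^t* *m h) *m (B l)^t*)) = rc (nrm2 (scal B g h)).
  rewrite -tr_rowgram /rowgram !raddf_sum; apply: eq_bigr => l _; rewrite /= /scal !adjM adjK.
  transitivity (\tr (g^t* *m (g *m B l *m h^t* *m (h *m (B l)^t*)))).
    by congr (\tr _); rewrite !mulmxA.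
  by rewrite mxtrace_mulC; congr (\tr _); rewrite !mulmxA.
exact: (congr1 (fun z : C => ln (complex.Re z)) E).
Qed.

Lemma nrm2_ge0 B : 0 <= nrm2 B.
Proof. by apply: sumr_ge0 => l _; exact: fr2_ge0. Qed.

Lemma nrm2_eq0 B : nrm2 B = 0 -> forall l, B l = 0.
Proof.
move/eqP; rewrite psumr_eq0 => [/allP h l|l _]; last exact: fr2_ge0.
exact/fr2_eq0/eqP/h/mem_index_enum.
Qed.

Lemma nrm2_scal_gt0 B g h : g \in unitmx -> h \in unitmx -> 0 < nrm2 B -> 0 < nrm2 (scal B g h).
Proof.
move=> gu hu B0; rewrite lt_neqAle nrm2_ge0 andbT eq_sym; apply/eqP => /nrm2_eq0 z.
suff : nrm2 B = 0 by move=> e; rewrite e ltxx in B0.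
rewrite /nrm2 big1 // => l _.
have -> : B l = 0.
  have hu' : h^t* \in unitmx by rewrite unitmx_adj.
  rewrite -[B l](mulKmx gu) -[g *m B l](mulmxK hu') -/(scal B g h l) z mul0mx mulmx0 //.
by rewrite /fr2 big1 // => i _; rewrite big1 // => j _; rewrite mxE abs2_0.
Qed.

End Gram.

Section PositiveDefinite.
Variable R : realType.
Local Notation C := (Cx R).

Lemma expR_rdg_mul n (a b : 'rV[R]_n) :
  rdg (map_mx expR a) *m rdg (map_mx expR b) = rdg (map_mx expR (a + b)).
Proof. by rewrite rdg_mul; congr rdg; apply/rowP => i; rewrite !mxE expRD. Qed.

Lemma expR_rdg0 n : rdg (map_mx expR 0) = 1%:M :> 'M[C]_n.
Proof.
by apply/matrixP => i j; rewrite !mxE expR0.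
Qed.

Lemma udiag_exp_mul n (s : 'M[C]_n) a b : s \is unitarymx ->
  udiag s (map_mx expR a) *m udiag s (map_mx expR b) = udiag s (map_mx expR (a + b)).
Proof. by move=> su; rewrite (udiag_mul _ _ su); congr udiag; apply/rowP => i; rewrite !mxE expRD. Qed.

Lemma udiag_exp0 n (s : 'M[C]_n) : s \is unitarymx -> udiag s (map_mx expR 0) = 1%:M.
Proof. by move=> su; rewrite /udiag expR_rdg0 mulmx1 (unitary_adj_mul su). Qed.

Lemma udiag_exp_unit n (s : 'M[C]_n) a : s \is unitarymx -> udiag s (map_mx expR a) \in unitmx.
Proof.
move=> su; have := udiag_exp_mul a (- a) su; rewrite subrr (udiag_exp0 su) => E.
exact: (mulmx1_unit E).1.
Qed.

Lemma posdef_udiag_exp n (s : 'M[C]_n) a : s \is unitarymx ->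
  posdefmx (udiag s (map_mx expR a)).
Proof.
move=> su; split; first exact/hermsymmxP/adj_udiag.
move=> u u0; pose w : 'cV[C]_n := s *m u.
have w0 : w != 0.
  apply: contra u0 => /eqP e; rewrite -[u]mul1mx -(unitary_adj_mul su) -mulmxA -/w e mulmx0.
  exact: eqxx.
have -> : u^t* *m udiag s (map_mx expR a) *m u = w^t* *m rdg (map_mx expR a) *m w.
  by rewrite /w adjM /udiag !mulmxA.
have -> : (w^t* *m rdg (map_mx expR a) *m w) 0 0 =
    rc (\sum_i expR (a 0 i) * abs2 (w i 0)).
  rewrite mul_mx_diag mxE rc_sum; apply: eq_bigr => i _.
  rewrite rcM -mul_conj_abs2 !mxE; ring.
rewrite -rc0 rc_lt.
have [i wi] : exists i, w i 0 != 0.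
  apply/existsP; apply: contraNT w0 => /existsPn h; apply/eqP/matrixP => i j.
  by rewrite (ord1 j) [RHS]mxE; apply/eqP; have := h i; rewrite negbK.
rewrite (bigD1 i) //= ltr_pwDl //.
  rewrite mulr_gt0 ?expR_gt0 // lt_neqAle abs2_ge0 andbT eq_sym.
  by apply/eqP => /abs2_eq0 e; rewrite e eqxx in wi.
by apply: sumr_ge0 => j _; rewrite mulr_ge0 ?expR_ge0 ?abs2_ge0.
Qed.

Lemma sqrtmx_spec n (s : 'M[C]_n) a : s \is unitarymx ->
  let x := udiag s (map_mx expR a) in let r : 'M[C]_n := sqrtmx x in
  [/\ r^t* = r, r \in unitmx & r *m r = x].
Proof.
move=> su x r.
have [pr rr] : posdefmx r /\ r *m r = x.
  rewrite /r /sqrtmx; case: xgetP => [y -> //|h]; exfalso.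
  (* Halving the exponents exhibits a root, so [xget] does not fall back to 0. *)
  apply: (h (udiag s (map_mx expR (2^-1 *: a)))); split; first exact: posdef_udiag_exp.
  rewrite -[LHS]/(udiag s _ *m udiag s _) (udiag_exp_mul _ _ su) /x; congr (udiag s (map_mx _ _)).
  by apply/rowP => i; rewrite !mxE; field.
split=> //; first by apply/hermsymmxP; case: pr.
have := udiag_exp_unit a su; rewrite -/x -rr => h.
by move: h; rewrite unitmx_mul => /andP[].
Qed.

End PositiveDefinite.

(** * Derivatives along geodesics and the Riemannian gradient *)

Section Derivatives.
Variable R : realType.

Lemma is_derive_bigsum (I : Type) (r : seq I) (f : I -> R -> R) (df : I -> R) (t : R) :
  (forall i, is_derive t (1 : R) (f i) (df i)) ->
  is_derive t (1 : R) (fun u => \sum_(i <- r) f i u) (\sum_(i <- r) df i).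
Proof.
move=> h; elim: r => [|i r IH].
  rewrite big_nil (_ : (fun u => _) = cst 0); first exact: is_derive_cst.
  by apply/funext => u; rewrite big_nil.
rewrite big_cons (_ : (fun u => _) = f i + (fun u => \sum_(j <- r) f j u)).
  exact: is_deriveD.
by apply/funext => u; rewrite big_cons.
Qed.

Lemma is_derive_sum_expR (I : finType) (w c : I -> R) (t : R) :
  is_derive t (1 : R) (fun u => \sum_i w i * expR (u * c i))
    (\sum_i w i * (c i * expR (t * c i))).
Proof.
apply: is_derive_bigsum => i.
have d1 : is_derive t (1 : R) (fun u : R => u * c i) (c i).
  have := @is_deriveM R R (fun u => u) (cst (c i)) t 1 1 0 (is_derive_id _ _) (is_derive_cst _ _ _).
  by rewrite scaler0 add0r /GRing.scale /= mulr1.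
have d2 := @is_derive1_comp R expR (fun u => u * c i) t _ _ (is_derive_expR _) d1.
have := @is_deriveZ R R R (expR \o (fun u => u * c i)) (w i) t 1 _ d2.
rewrite /GRing.scale /= => d3; apply: is_derive_eq.
by congr (_ * _); rewrite mulrC.
Qed.

(** In frames that diagonalize the direction, f_A along a geodesic is a log-sum-exp of this
    shape. *)
Lemma is_derive_ln_sum_expR (I : finType) (w c : I -> R) (t : R) :
  0 < \sum_i w i * expR (t * c i) ->
  is_derive t (1 : R) (fun u => ln (\sum_i w i * expR (u * c i)))
    ((\sum_i w i * (c i * expR (t * c i))) / (\sum_i w i * expR (t * c i))).
Proof.
move=> h; have d := @is_derive1_comp R (@ln R) (fun u => \sum_i w i * expR (u * c i)) t _ _
  (is_derive1_ln h) (is_derive_sum_expR w c t).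
by apply: (is_derive_eq d); rewrite mulrC.
Qed.

End Derivatives.

Lemma adj_mul3 (C : numClosedFieldType) n (d s g : 'M[C]_n) : d^t* = d ->
  (d *m s *m g)^t* *m (d *m s *m g) = g^t* *m (s^t* *m (d *m d) *m s) *m g.
Proof. by move=> dd; rewrite !adjM dd !mulmxA. Qed.

Section Sandwich.
Variable R : realType.
Local Notation C := (Cx R).
Variables (n m N : nat).
Implicit Types (E : 'I_N -> 'M[C]_(n, m)).

Lemma scal_rdgE E (a : 'rV[R]_n) (b : 'rV[R]_m) l i j :
  scal E (rdg a) (rdg b) l i j = rc (a 0 i * b 0 j) * E l i j.
Proof.
rewrite /scal adj_rdg mul_mx_diag mxE mul_diag_mx !mxE rcM; ring.
Qed.

Lemma nrm2E E : nrm2 E = \sum_(d : 'I_N * ('I_n * 'I_m)) abs2 (E d.1 d.2.1 d.2.2).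
Proof.
rewrite /nrm2 -(pair_bigA _ (fun l d => abs2 (E l d.1 d.2))) /=.
by apply: eq_bigr => l _; rewrite /fr2 -(pair_bigA _ (fun i j => abs2 (E l i j))).
Qed.

Lemma nrm2_scal_exp E (a : 'rV[R]_n) (b : 'rV[R]_m) (t : R) :
  nrm2 (scal E (rdg (map_mx expR ((t / 2) *: a))) (rdg (map_mx expR ((t / 2) *: b)))) =
  \sum_(d : 'I_N * ('I_n * 'I_m))
    abs2 (E d.1 d.2.1 d.2.2) * expR (t * (a 0 d.2.1 + b 0 d.2.2)).
Proof.
rewrite nrm2E; apply: eq_bigr => -[l [i j]] _ /=.
rewrite scal_rdgE abs2M abs2_rc mulrC; congr (_ * _).
rewrite !mxE -expRD -expRM_natl; congr expR; by field.
Qed.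

Lemma adj_exp_mul k (s g : 'M[C]_k) (a : 'rV[R]_k) :
  (rdg (map_mx expR ((1 / 2) *: a)) *m s *m g)^t* *m (rdg (map_mx expR ((1 / 2) *: a)) *m s *m g) =
  g^t* *m udiag s (map_mx expR a) *m g.
Proof.
rewrite (adj_mul3 _ _ (adj_rdg _)) expR_rdg_mul /udiag.
suff -> : (1 / 2) *: a + (1 / 2) *: a = a by [].
by apply/rowP => i; rewrite !mxE; field.
Qed.

End Sandwich.

Section Gradient.
Variable R : realType.
Local Notation C := (Cx R).

Lemma riem_expE n (x U s : 'M[C]_n) (k : 'rV[R]_n) :
  let r : 'M[C]_n := sqrtmx x in
  s \is unitarymx -> invmx r *m U *m invmx r = udiag s k ->
  riem_exp x U = r *m udiag s (map_mx expR k) *m r.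
Proof. by move=> r su E; rewrite -(mexp_udiag _ su) -E. Qed.

Lemma invmxM n (g h : 'M[C]_n) : g \in unitmx -> h \in unitmx ->
  invmx (g *m h) = invmx h *m invmx g.
Proof.
move=> gu hu; have ghu : g *m h \in unitmx by rewrite unitmx_mul gu.
apply: (can_inj (mulKmx ghu)); rewrite (mulmxV ghu) -mulmxA (mulmxA h) (mulmxV hu) mul1mx.
by rewrite (mulmxV gu).
Qed.

Lemma tr_udiag_mul n (M s : 'M[C]_n) (k : 'rV[R]_n) :
  \tr (M *m udiag s k) = \sum_i rc (k 0 i) * (s *m M *m s^t*) i i.
Proof.
rewrite /udiag !mulmxA mxtrace_mulC !mulmxA mul_mx_diag.
by apply: eq_bigr => i _; rewrite mxE mulrC mxE.
Qed.

Section MomentMap.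
Variables (n m N : nat) (B : 'I_N -> 'M[C]_(n, m)).

(** [mu1] and [mu2] are the two components of the moment map. At the tuple scaled by the square
    roots s and t of x and y they are the gradient transported to the identity, and subtracting the
    scalar part makes them traceless, that is, tangent to determinant one. *)
Definition mu1 : 'M[C]_n := rc (nrm2 B)^-1 *: rowgram B - (rc n%:R^-1)%:M.
Definition mu2 : 'M[C]_m := rc (nrm2 B)^-1 *: colgram B - (rc m%:R^-1)%:M.

Lemma adj_real_scalar k (c : R) : ((rc c)%:M : 'M[C]_k)^t* = (rc c)%:M.
Proof. by rewrite -rdg_const adj_rdg. Qed.

Lemma adj_real_scale k l (c : R) (M : 'M[C]_(k, l)) : (rc c *: M)^t* = rc c *: M^t*.
Proof. by apply/matrixP => i j; rewrite !mxE rmorphM; congr (_ * _); exact: conj_rc. Qed.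

Lemma adj_mu1 : mu1^t* = mu1.
Proof.
rewrite /mu1 -scaleN1r -(rc1 R) -rcN adjD !adj_real_scale adj_real_scalar.
by rewrite adj_rowgram.
Qed.

Lemma adj_mu2 : mu2^t* = mu2.
Proof.
rewrite /mu2 -scaleN1r -(rc1 R) -rcN adjD !adj_real_scale adj_real_scalar.
by rewrite adj_colgram.
Qed.

Lemma tr_mu1 : (0 < n)%N -> 0 < nrm2 B -> \tr mu1 = 0.
Proof.
move=> n0 B0; rewrite /mu1 raddfB /= mxtraceZ tr_rowgram mxtrace_scalar -rcM mulVf ?gt_eqF //.
by rewrite -[rc _ *+ n]mulr_natr -(rmorph_nat (@rc R)) -rmorphM mulVf ?pnatr_eq0 -?lt0n // rc1 rmorph1 subrr.
Qed.

Lemma tr_mu2 : (0 < m)%N -> 0 < nrm2 B -> \tr mu2 = 0.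
Proof.
move=> n0 B0; rewrite /mu2 raddfB /= mxtraceZ tr_colgram mxtrace_scalar -rcM mulVf ?gt_eqF //.
by rewrite -[rc _ *+ m]mulr_natr -(rmorph_nat (@rc R)) -rmorphM mulVf ?pnatr_eq0 -?lt0n // rc1 rmorph1 subrr.
Qed.

End MomentMap.
End Gradient.

Section GradientFormula.
Variable R : realType.
Local Notation C := (Cx R).
Variables (n m N : nat).
Implicit Types (B : 'I_N -> 'M[C]_(n, m)).

Lemma rowgram_diag B i : rowgram B i i = rc (\sum_l \sum_j abs2 (B l i j)).
Proof.
rewrite /rowgram summxE rc_sum; apply: eq_bigr => l _; rewrite mxE rc_sum.
by apply: eq_bigr => j _; rewrite adjE mul_conj_abs2.
Qed.

Lemma colgram_diag B j : colgram B j j = rc (\sum_l \sum_i abs2 (B l i j)).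
Proof.
rewrite /colgram summxE rc_sum; apply: eq_bigr => l _; rewrite mxE rc_sum.
by apply: eq_bigr => i _; rewrite adjE mulrC mul_conj_abs2.
Qed.

Lemma sum_triple (f : 'I_N -> 'I_n -> 'I_m -> R) :
  \sum_(d : 'I_N * ('I_n * 'I_m)) f d.1 d.2.1 d.2.2 = \sum_l \sum_i \sum_j f l i j.
Proof.
rewrite -(pair_bigA _ (fun l d => f l d.1 d.2)) /=.
by apply: eq_bigr => l _; rewrite -(pair_bigA _ (fun i j => f l i j)).
Qed.

Lemma mu1_conj B s t : s \is unitarymx -> t \is unitarymx ->
  s *m mu1 B *m s^t* = mu1 (scal B s t).
Proof.
move=> su tu; rewrite /mu1 (nrm2_scal_unitary B su tu) (rowgram_scal_unitary B s tu).
rewrite mulmxBr mulmxBl -scalemxAr -scalemxAl; congr (_ - _).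
by rewrite mul_mx_scalar -scalemxAl (unitary_mul_adj su) scalemx1.
Qed.

Lemma mu2_conj B s t : s \is unitarymx -> t \is unitarymx ->
  t *m mu2 B *m t^t* = mu2 (scal B s t).
Proof.
move=> su tu; rewrite /mu2 (nrm2_scal_unitary B su tu) (colgram_scal_unitary B t su).
rewrite mulmxBr mulmxBl -scalemxAr -scalemxAl; congr (_ - _).
by rewrite mul_mx_scalar -scalemxAl (unitary_mul_adj tu) scalemx1.
Qed.

Lemma mu1_diag B i :
  mu1 B i i = rc ((\sum_l \sum_j abs2 (B l i j)) / nrm2 B - n%:R^-1).
Proof. by rewrite /mu1 3!mxE rowgram_diag [_%:M i i]mxE eqxx mulr1n rcB rcM mulrC. Qed.

Lemma mu2_diag B j :
  mu2 B j j = rc ((\sum_l \sum_i abs2 (B l i j)) / nrm2 B - m%:R^-1).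
Proof. by rewrite /mu2 3!mxE colgram_diag [_%:M j j]mxE eqxx mulr1n rcB rcM mulrC. Qed.

(** The pairing of the moment map with a Hermitian matrix is the mean of its eigenvalues for the
    weights |E_ij|^2, minus their plain average. Both the derivative of f_A and weak duality are
    read off from it. *)
Lemma re_tr_mu1 B s t (k : 'rV[R]_n) : s \is unitarymx -> t \is unitarymx ->
  re (\tr (mu1 B *m udiag s k)) =
  (\sum_(d : 'I_N * ('I_n * 'I_m)) abs2 (scal B s t d.1 d.2.1 d.2.2) * k 0 d.2.1) / nrm2 B
   - (\sum_i k 0 i) / n%:R.
Proof.
move=> su tu; rewrite tr_udiag_mul (mu1_conj B su tu).
set E := scal B s t.
rewrite (sum_triple (fun l i j => abs2 (E l i j) * k 0 i)).
rewrite exchange_big /= re_sum !mulr_suml -sumrB; apply: eq_bigr => i _.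
rewrite re_rcM mu1_diag re_rc (nrm2_scal_unitary B su tu) -/E mulrBr; congr (_ - _).
rewrite mulrA mulr_sumr; congr (_ / _); apply: eq_bigr => l _.
by rewrite mulr_sumr; apply: eq_bigr => j _; rewrite mulrC.
Qed.

Lemma re_tr_mu2 B s t (k : 'rV[R]_m) : s \is unitarymx -> t \is unitarymx ->
  re (\tr (mu2 B *m udiag t k)) =
  (\sum_(d : 'I_N * ('I_n * 'I_m)) abs2 (scal B s t d.1 d.2.1 d.2.2) * k 0 d.2.2) / nrm2 B
   - (\sum_j k 0 j) / m%:R.
Proof.
move=> su tu; rewrite tr_udiag_mul (mu2_conj B su tu).
set E := scal B s t.
rewrite (sum_triple (fun l i j => abs2 (E l i j) * k 0 j)).
rewrite (eq_bigr (fun l => \sum_j \sum_i abs2 (E l i j) * k 0 j)) => [|l _]; last exact: exchange_big.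
rewrite exchange_big /= re_sum !mulr_suml -sumrB; apply: eq_bigr => j _.
rewrite re_rcM mu2_diag re_rc (nrm2_scal_unitary B su tu) -/E mulrBr; congr (_ - _).
rewrite mulrA mulr_sumr; congr (_ / _); apply: eq_bigr => l _.
by rewrite mulr_sumr; apply: eq_bigr => i _; rewrite mulrC.
Qed.

Lemma mul3K k (s M : 'M[C]_k) : s \in unitmx -> invmx s *m (s *m M *m s) *m invmx s = M.
Proof. by move=> su; rewrite -!mulmxA (mulmxV su) mulmx1 (mulKmx su). Qed.

Lemma mul3KV k (s M : 'M[C]_k) : s \in unitmx -> s *m (invmx s *m M *m invmx s) *m s = M.
Proof. by move=> su; rewrite -!mulmxA (mulVmx su) mulmx1 (mulKVmx su). Qed.

Lemma tangent_tr k (s M : 'M[C]_k) : s \in unitmx ->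
  \tr (invmx (s *m s) *m (s *m M *m s)) = \tr M.
Proof.
move=> su; rewrite (invmxM su su) mxtrace_mulC -!mulmxA (mulKVmx su) mxtrace_mulC.
by rewrite -mulmxA (mulVmx su) mulmx1.
Qed.

Lemma riem_metricE k (s M K : 'M[C]_k) : s \in unitmx ->
  riem_metric (s *m s) (s *m M *m s) (s *m K *m s) = re (\tr (M *m K)).
Proof.
move=> su; have E (L : 'M[C]_k) : invmx (s *m s) *m (s *m L *m s) = invmx s *m L *m s.
  by rewrite (invmxM su su) -!mulmxA (mulKmx su).
have F : \tr (invmx (s *m s) *m (s *m M *m s) *m invmx (s *m s) *m (s *m K *m s)) = \tr (M *m K).
  rewrite -mulmxA !E -!mulmxA (mulKVmx su) mxtrace_mulC -!mulmxA.
  by rewrite (mulmxV su) mulmx1.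
exact: (congr1 (@re R) F).
Qed.

Variables (A : 'I_N -> 'M[C]_(n, m)) (s0 : 'M[C]_n) (t0 : 'M[C]_m) (a : 'rV[R]_n) (b : 'rV[R]_m).
Hypotheses (n0 : (0 < n)%N) (m0 : (0 < m)%N) (A0 : 0 < nrm2 A).
Hypotheses (s0u : s0 \is unitarymx) (t0u : t0 \is unitarymx).
Let x := udiag s0 (map_mx expR a).
Let y := udiag t0 (map_mx expR b).
Let s : 'M[C]_n := sqrtmx x.
Let t : 'M[C]_m := sqrtmx y.
Let B := scal A s t.

Let s_adj : s^t* = s. Proof. by case: (sqrtmx_spec a s0u). Qed.
Let s_unit : s \in unitmx. Proof. by case: (sqrtmx_spec a s0u). Qed.
Let s_sqr : s *m s = x. Proof. by case: (sqrtmx_spec a s0u). Qed.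
Let t_adj : t^t* = t. Proof. by case: (sqrtmx_spec b t0u). Qed.
Let t_unit : t \in unitmx. Proof. by case: (sqrtmx_spec b t0u). Qed.
Let t_sqr : t *m t = y. Proof. by case: (sqrtmx_spec b t0u). Qed.
Let B0 : 0 < nrm2 B. Proof. exact: nrm2_scal_gt0. Qed.

Let tangent_decomp k (z r U : 'M[C]_k) : r^t* = r -> r \in unitmx -> r *m r = z ->
  tangent_vec z U -> exists K, [/\ U = r *m K *m r, K^t* = K & \tr K = 0].
Proof.
move=> ra ru rz [/hermsymmxP Ua tU]; exists (invmx r *m U *m invmx r); split.
- by rewrite (mul3KV _ ru).
- by rewrite !adjM (adj_inv ru) ra Ua mulmxA.
- by rewrite -(tangent_tr _ ru) (mul3KV _ ru) rz; exact: tU.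
Qed.

(** Conjugation by s and t moves the base point to the identity. After diagonalizing the transported
    direction f_A becomes a log-sum-exp, whose derivative at 0 is a weighted mean of eigenvalues,
    hence a pairing with the moment map. *)
Let is_grad : is_riem_grad A x y (s *m mu1 B *m s, t *m mu2 B *m t).
Proof.
split=> /=.
- split; first by apply/hermsymmxP; rewrite !adjM s_adj adj_mu1 mulmxA.
  by rewrite -[x]s_sqr [LHS](tangent_tr _ s_unit) tr_mu1.
- split; first by apply/hermsymmxP; rewrite !adjM t_adj adj_mu2 mulmxA.
  by rewrite -[y]t_sqr [LHS](tangent_tr _ t_unit) tr_mu2.
move=> U V /(tangent_decomp s_adj s_unit s_sqr)[K [UE Ka tK]].
move=> /(tangent_decomp t_adj t_unit t_sqr)[L [VE La tL]].
have [sg [k [sgu KE]]] := hermitian_udiag Ka.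
have [ta [l [tau LE]]] := hermitian_udiag La.
have sk : \sum_i k 0 i = 0.
  apply: (@rc_inj R); rewrite rc0 -tK KE rc_sum /udiag mxtrace_mulC mulmxA (unitary_mul_adj sgu) mul1mx.
  by apply: eq_bigr => i _; rewrite rdgE.
have sl : \sum_i l 0 i = 0.
  apply: (@rc_inj R); rewrite rc0 -tL LE rc_sum /udiag mxtrace_mulC mulmxA (unitary_mul_adj tau) mul1mx.
  by apply: eq_bigr => i _; rewrite rdgE.
pose E := scal B sg ta.
pose w (d : 'I_N * ('I_n * 'I_m)) := abs2 (E d.1 d.2.1 d.2.2).
pose c (d : 'I_N * ('I_n * 'I_m)) := k 0 d.2.1 + l 0 d.2.2.
have path u : kempf_ness A (riem_exp x (rc u *: U)) (riem_exp y (rc u *: V)) =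
    ln (\sum_d w d * expR (u * c d)).
  have EU : invmx s *m (rc u *: U) *m invmx s = udiag sg (u *: k).
    by rewrite -scalemxAr -scalemxAl UE (mul3K _ s_unit) KE udiagZ.
  have EV : invmx t *m (rc u *: V) *m invmx t = udiag ta (u *: l).
    by rewrite -scalemxAr -scalemxAl VE (mul3K _ t_unit) LE udiagZ.
  rewrite (riem_expE sgu EU) (riem_expE tau EV).
  rewrite -/s -/t -{1}s_adj -{1}t_adj -!adj_exp_mul kempf_nessE.
  rewrite -!mulmxA -!scal_scal -/B -/E !scalerA.
  by rewrite -nrm2_scal_exp ![1 / 2 * u]mulrC !mul1r.
have wE : \sum_d w d * expR (0 * c d) = nrm2 B.
  rewrite -(nrm2_scal_unitary B sgu tau) nrm2E; apply: eq_bigr => d _.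
  by rewrite mul0r expR0 mulr1.
have D := @is_derive_ln_sum_expR R _ w c 0.
rewrite wE in D; have {}D := D B0.
rewrite -s_sqr -t_sqr.
have -> : riem_metric (s *m s) (s *m mu1 B *m s) U + riem_metric (t *m t) (t *m mu2 B *m t) V =
    (\sum_i w i * (c i * expR (0 * c i))) / nrm2 B.
  rewrite UE VE (riem_metricE _ _ s_unit) (riem_metricE _ _ t_unit) KE LE.
  rewrite (re_tr_mu1 _ _ sgu tau) (re_tr_mu2 _ _ sgu tau) sk sl !mul0r !subr0 -mulrDl -big_split /=.
  by congr (_ / _); apply: eq_bigr => d _; rewrite mul0r expR0 mulr1 mulrDr.
by rewrite s_sqr t_sqr; apply: (is_derive_eq _ erefl); move: D; congr (is_derive _ _ _ _); apply/funext => u; rewrite -path.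
Qed.

(** Two representatives of the differential differ by a tangent vector orthogonal to itself, hence
    zero; so [xget] can only return this one. *)
Lemma riem_gradE : riem_grad A x y = (s *m mu1 B *m s, t *m mu2 B *m t).
Proof.
have [gx gy gd] := is_grad.
rewrite /riem_grad; case: xgetP => [g _ [hx hy hd]|/(_ _ is_grad) //].
have tan_sub k (z U V : 'M[C]_k) : tangent_vec z U -> tangent_vec z V -> tangent_vec z (U - V).
  move=> [/hermsymmxP Ua Ut] [/hermsymmxP Va Vt]; split.
    by apply/hermsymmxP; apply/matrixP => i j; rewrite -{2}Ua -{2}Va !mxE rmorphB.
  have E : \tr (invmx z *m (U - V)) = \tr (invmx z *m U) - \tr (invmx z *m V).
    by rewrite mulmxBr raddfB.
  by apply: etrans E _; rewrite Ut Vt subrr.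
have tx := tan_sub _ _ _ _ hx gx; have ty := tan_sub _ _ _ _ hy gy.
have D1 := hd _ _ tx ty; have D2 := gd _ _ tx ty.
have E := etrans (esym (@derive_val _ _ _ _ _ _ _ D1)) (@derive_val _ _ _ _ _ _ _ D2).
have [K [KE Ka _]] := tangent_decomp s_adj s_unit s_sqr tx.
have [L [LE La _]] := tangent_decomp t_adj t_unit t_sqr ty.
have [K1 [K1E _ _]] := tangent_decomp s_adj s_unit s_sqr hx.
have [L1 [L1E _ _]] := tangent_decomp t_adj t_unit t_sqr hy.
have sub3 k (r P Q : 'M[C]_k) : r *m P *m r - r *m Q *m r = r *m (P - Q) *m r.
  by rewrite mulmxBr mulmxBl.
have inj3 k (r P Q : 'M[C]_k) : r \in unitmx -> r *m P *m r = r *m Q *m r -> P = Q.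
  by move=> ru PQ; rewrite -(mul3K P ru) PQ (mul3K Q ru).
have KE' : K = K1 - mu1 B by apply: (inj3 _ _ _ _ s_unit); rewrite -sub3 -K1E -KE.
have LE' : L = L1 - mu2 B by apply: (inj3 _ _ _ _ t_unit); rewrite -sub3 -L1E -LE.
have frE k (M : 'M[C]_k) : M^t* = M -> re (\tr (M *m M)) = fr2 M.
  by move=> Ma; rewrite -{2}Ma tr_mul_adj.
have trsub k (P Q M : 'M[C]_k) : re (\tr (P *m M)) - re (\tr (Q *m M)) = re (\tr ((P - Q) *m M)).
  by rewrite mulmxBl [\tr (_ - _)]raddfB reB.
rewrite KE LE K1E L1E -!s_sqr -!t_sqr in E.
rewrite !(riem_metricE _ _ s_unit) !(riem_metricE _ _ t_unit) in E.
have {}E : fr2 K + fr2 L = 0.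
  rewrite -(frE _ _ Ka) -(frE _ _ La) {1}KE' {1}LE' -(trsub _ K1) -(trsub _ L1).
  by move: E; lra.
have [K0 L0] : fr2 K = 0 /\ fr2 L = 0.
  by have := fr2_ge0 K; have := fr2_ge0 L; split; lra.
move: KE' LE'; rewrite (fr2_eq0 K0) (fr2_eq0 L0) => /esym/subr0_eq e1 /esym/subr0_eq e2.
by rewrite [LHS]surjective_pairing K1E L1E e1 e2.
Qed.

End GradientFormula.

(** * One gradient step in a diagonalizing frame *)

Section Step.
Variable R : realType.
Local Notation C := (Cx R).

Definition nondecreasing_row n (a : 'rV[R]_n) := forall i j : 'I_n, (i <= j)%N -> a 0 i <= a 0 j.

Lemma sorting_perm n (a : 'rV[R]_n) :
  exists p : 'S_n, nondecreasing_row (\row_i a 0 (p i)).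
Proof.
pose t := [tuple a 0 i | i < n].
have /tuple_permP[p E] : perm_eq (sort_tuple <=%R t) t by rewrite perm_sort.
exists p => i j ij; rewrite !mxE.
have nthE k : nth 0 (sort_tuple <=%R t) (nat_of_ord k) = a 0 (p k).
  by rewrite E -tnth_nth !tnth_mktuple.
rewrite -!nthE; apply: sorted_leq_nth => //.
- exact: le_trans.
- by apply: sort_sorted; exact: le_total.
- by rewrite inE size_sort size_tuple.
- by rewrite inE size_sort size_tuple.
Qed.

Lemma unitary_row_perm n (p : 'S_n) (s : 'M[C]_n) : s \is unitarymx -> row_perm p s \is unitarymx.
Proof.
move=> su; apply/unitarymxP/matrixP => i j.
transitivity ((s *m s^t*) (p i) (p j)).
  by rewrite !mxE; apply: eq_bigr => k _; rewrite !mxE.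
by rewrite (unitary_mul_adj su) !mxE (inj_eq perm_inj).
Qed.

Lemma hermitian_udiag_sorted n (M : 'M[C]_n) : M^t* = M ->
  exists s a, [/\ s \is unitarymx, M = udiag s a & nondecreasing_row a].
Proof.
move=> /hermitian_udiag[s [a [su ->]]]; have [p ap] := sorting_perm a.
exists (row_perm p s), (\row_i a 0 (p i)); split; [exact: unitary_row_perm | | exact: ap].
apply/matrixP => i j; rewrite !udiagE (reindex_inj (@perm_inj _ p)) /=.
by apply: eq_bigr => l _; rewrite !mxE.
Qed.

Variables (n m N : nat) (A : 'I_N -> 'M[C]_(n, m)).
Hypotheses (n0 : (0 < n)%N) (m0 : (0 < m)%N) (A0 : 0 < nrm2 A).

(** The frame that diagonalizes the moment map is a factor of both the old and the new point: x =
    g^* g becomes g^* exp(u/2) g, where u lists the negated eigenvalues of [mu1] and 1/2 is 1/L. The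
    orders of u and v are those of the logarithmic spectra on the two sides. *)
Lemma gradient_step (s0 : 'M[C]_n) (t0 : 'M[C]_m) (a : 'rV[R]_n) (b : 'rV[R]_m) :
  let x := udiag s0 (map_mx expR a) in let y := udiag t0 (map_mx expR b) in
  s0 \is unitarymx -> t0 \is unitarymx ->
  exists (g : 'M[C]_n) (h : 'M[C]_m) (u : 'rV[R]_n) (v : 'rV[R]_m),
  [/\ [/\ g \in unitmx, h \in unitmx, x = g^t* *m g & y = h^t* *m h],
      mu1 (scal A g h) = rdg (- u), mu2 (scal A g h) = rdg (- v),
      riem_exp x (- 2^-1 *: (riem_grad A x y).1) = g^t* *m rdg (map_mx expR (2^-1 *: u)) *m g /\
      riem_exp y (- 2^-1 *: (riem_grad A x y).2) = h^t* *m rdg (map_mx expR (2^-1 *: v)) *m h &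
      nondecreasing_row u /\ nondecreasing_row (- v)].
Proof.
move=> x y s0u t0u.
have [sa si ss] := sqrtmx_spec a s0u; have [ta ti tt] := sqrtmx_spec b t0u.
rewrite /x /y (riem_gradE a b n0 m0 A0 s0u t0u) -/x -/y; move: sa si ss ta ti tt.
set s : 'M[C]_n := sqrtmx _; set t : 'M[C]_m := sqrtmx _; rewrite -/x -/y => sa si ss ta ti tt.
set B := scal A s t.
have negh k (M : 'M[C]_k) : M^t* = M -> (- M)^t* = - M.
  by move=> Ma; apply/matrixP => i j; rewrite -{2}Ma !mxE rmorphN.
have rdgN k (w : 'rV[R]_k) : rdg (- w) = - rdg w.
  by rewrite -scaleN1r rdgZ rcN rc1 scaleN1r.
have [sg [u [sgu uE us]]] := hermitian_udiag_sorted (negh _ _ (adj_mu1 B)).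
have [tau [v [tauu vE vs]]] := hermitian_udiag_sorted (adj_mu2 B).
have half : (- 2^-1 : C) = rc (- 2^-1) by rewrite rcN rcV; congr (- _^-1); rewrite -(rmorph_nat (@rc R)).
exists (sg *m s), (tau *m t), u, (- v); split.
- split; rewrite ?unitmx_mul ?si ?ti ?unitarymx_unit //.
    by rewrite adjM sa -mulmxA (mulmxA _ sg) (unitary_adj_mul sgu) mul1mx ss.
  by rewrite adjM ta -mulmxA (mulmxA _ tau) (unitary_adj_mul tauu) mul1mx tt.
- rewrite -scal_scal -/B -(mu1_conj B sgu tauu) rdgN -[mu1 B]opprK uE mulmxN mulNmx /udiag.
  by rewrite !mulmxA (unitary_mul_adj sgu) mul1mx -mulmxA (unitary_mul_adj sgu) mulmx1.
- rewrite -scal_scal -/B -(mu2_conj B sgu tauu) vE opprK /udiag.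
  by rewrite !mulmxA (unitary_mul_adj tauu) mul1mx -mulmxA (unitary_mul_adj tauu) mulmx1.
- split.
  + have E : invmx s *m (- 2^-1 *: (s *m mu1 B *m s)) *m invmx s = udiag sg (2^-1 *: u).
      by rewrite -scalemxAr -scalemxAl (mul3K _ si) half rcN scaleNr -scalerN uE udiagZ.
    by rewrite [LHS](riem_expE sgu E) -/s adjM sa /udiag !mulmxA.
  + have E : invmx t *m (- 2^-1 *: (t *m mu2 B *m t)) *m invmx t = udiag tau (2^-1 *: - v).
      by rewrite -scalemxAr -scalemxAl (mul3K _ ti) half vE udiagZ scalerN scaleNr.
    by rewrite [LHS](riem_expE tauu E) -/t adjM ta /udiag !mulmxA.
- by split=> //; rewrite opprK.
Qed.

End Step.

(** * Damped vectors and the descent estimate *)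

Section Descent.
Variable R : realType.

Lemma mean_value_le (f df : R -> R) (a b k : R) : a <= b ->
  (forall t, is_derive t (1 : R) f (df t)) -> (forall t, a <= t <= b -> df t <= k) ->
  f b - f a <= k * (b - a).
Proof.
rewrite le_eqVlt => /predU1P[->|ab] fd dfk; first by rewrite !subrr mulr0.
have [|c cab ->] := @MVT R f df a b ab (fun x _ => fd x).
  by apply: derivable_within_continuous => x _; case: (fd x).
rewrite ler_wpM2r // ?subr_ge0 ?(ltW ab) //; apply: dfk.
by move: cab; rewrite in_itv /= => /andP[/ltW -> /ltW ->].
Qed.

Lemma is_derive_quotient (f g : R -> R) (df dg t : R) : g t != 0 ->
  is_derive t (1 : R) f df -> is_derive t (1 : R) g dg ->
  is_derive t (1 : R) (fun u => f u / g u) ((df * g t - f t * dg) / g t ^+ 2).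
Proof.
move=> g0 fd gd; have vd := is_deriveV g0 gd.
have := @is_deriveM R R f (fun u => (g u)^-1) t 1 _ _ fd vd.
rewrite /GRing.scale /= => d; apply: (is_derive_eq d).
by field.
Qed.

Variables (T : finType) (lam : T -> R).

(** With lam = -(u_i + v_j) this is the vector of entries of the scaled tuple along the geodesic of
    one step, 0 <= t <= 1; the exponent u/2 of x is u/4 in its factor. *)
Definition damped (x : T -> R) t d := x d * expR (- (t * lam d) / 4).
Definition energy (x : T -> R) : R := \sum_d x d ^+ 2.
Definition mean_lam (x : T -> R) : R := (\sum_d lam d * x d ^+ 2) / energy x.
Definition mean_form (S : T -> T -> R) (x : T -> R) : R :=
  (\sum_d x d * \sum_e S d e * x e) / energy x.

Lemma damped_energyE x t :
  energy (damped x t) = \sum_d x d ^+ 2 * expR (t * (- lam d / 2)).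
Proof.
apply: eq_bigr => d _; rewrite /damped exprMn -expRM_natl; congr (_ * expR _).
by field.
Qed.

Lemma damped_lamE x t :
  \sum_d lam d * damped x t d ^+ 2 = \sum_d (lam d * x d ^+ 2) * expR (t * (- lam d / 2)).
Proof.
apply: eq_bigr => d _; rewrite /damped exprMn -expRM_natl mulrA; congr (_ * expR _).
by field.
Qed.

Lemma damped_formE S x t :
  \sum_d damped x t d * (\sum_e S d e * damped x t e) =
  \sum_(p : T * T) (x p.1 * S p.1 p.2 * x p.2) * expR (t * (- (lam p.1 + lam p.2) / 4)).
Proof.
rewrite -(pair_bigA _ (fun d e => x d * S d e * x e * expR (t * (- (lam d + lam e) / 4)))) /=.
apply: eq_bigr => d _; rewrite mulr_sumr; apply: eq_bigr => e _; rewrite /damped.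
have -> : t * (- (lam d + lam e) / 4) = - (t * lam d) / 4 + - (t * lam e) / 4 by field.
by rewrite expRD; ring.
Qed.

Variable x : T -> R.
Hypothesis x0 : 0 < energy x.

Lemma damped_energy_gt0 t : 0 < energy (damped x t).
Proof.
have [d xd] : exists d, x d != 0.
  apply/existsP; apply: contraTT x0 => /existsPn h; rewrite -leNgt.
  by rewrite /energy big1 // => d _; have := h d; rewrite negbK => /eqP ->; rewrite expr0n.
rewrite /energy (bigD1 d) //= ltr_pwDl //.
  by rewrite exprn_even_gt0 //= /damped mulf_neq0 // gt_eqF // expR_gt0.
by apply: sumr_ge0 => e _; exact: sqr_ge0.
Qed.

Let Z t := energy (damped x t).
Let L t := \sum_d lam d * damped x t d ^+ 2.
Let Q t := \sum_d lam d ^+ 2 * damped x t d ^+ 2.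

Let dZ t : is_derive t (1 : R) Z (- L t / 2).
Proof.
have -> : Z = fun t => \sum_d x d ^+ 2 * expR (t * (- lam d / 2)) by apply/funext => u; exact: damped_energyE.
apply: (is_derive_eq (is_derive_sum_expR _ _ _)).
rewrite /L damped_lamE -sumrN mulr_suml; apply: eq_bigr => d _; by field.
Qed.

Let dL t : is_derive t (1 : R) L (- Q t / 2).
Proof.
have -> : L = fun t => \sum_d (lam d * x d ^+ 2) * expR (t * (- lam d / 2)) by apply/funext => u; exact: damped_lamE.
apply: (is_derive_eq (is_derive_sum_expR _ _ _)).
rewrite /Q -sumrN mulr_suml; apply: eq_bigr => d _; rewrite /damped exprMn -expRM_natl.
have -> : 2%:R * (- (t * lam d) / 4) = t * (- lam d / 2) by field.
by field.
Qed.

Let Zn t : Z t != 0. Proof. by rewrite gt_eqF // damped_energy_gt0. Qed.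

(** Cauchy-Schwarz for y = [damped x t] and the vector lam y - eta. With eta = 0 it says that the
    variance of lam is nonnegative; with eta = S y it controls the covariance of lam and S. *)
Lemma variance_bound (eta : T -> R) t (E G H : R) :
  E = \sum_d damped x t d * eta d -> G = \sum_d lam d * damped x t d * eta d ->
  H = \sum_d eta d ^+ 2 ->
  (L t - E) ^+ 2 <= Z t * (Q t - 2 * G + H).
Proof.
move=> EE GE HE; have Z0 : 0 < Z t := damped_energy_gt0 t.
have key c : 0 <= Q t - 2 * c * L t + c ^+ 2 * Z t - 2 * G + 2 * c * E + H.
  have -> : Q t - 2 * c * L t + c ^+ 2 * Z t - 2 * G + 2 * c * E + H =
    \sum_d ((lam d - c) * damped x t d - eta d) ^+ 2.
    rewrite EE GE HE /Q /L /Z /energy !mulr_sumr -!sumrN -!big_split /=.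
    by apply: eq_bigr => d _; ring.
  by apply: sumr_ge0 => d _; exact: sqr_ge0.
(* The minimizer in c of the quadratic polynomial [key]. *)
have := key ((L t - E) / Z t); rewrite -(pmulr_rge0 _ Z0) => h.
rewrite -subr_ge0; apply: le_trans h _; rewrite le_eqVlt; apply/orP; left; apply/eqP.
move: (Zn t); move: (Z t) (L t) (Q t) => z l q z0; by field.
Qed.

Lemma mean_lam_decreasing t : 0 <= t <= 1 -> mean_lam (damped x 1) <= mean_lam (damped x t).
Proof.
move=> /andP[_ t1].
have d u : is_derive u (1 : R) (fun u => L u / Z u) ((- Q u / 2 * Z u - L u * (- L u / 2)) / Z u ^+ 2).
  exact: is_derive_quotient.
have := mean_value_le (k := 0) t1 d; rewrite mul0r subr_le0; apply => u _.
rewrite pmulr_lle0; last by rewrite invr_gt0 exprn_gt0 // damped_energy_gt0.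
have := @variance_bound (fun=> 0) u 0 0 0.
rewrite !big1 => [/(_ erefl erefl erefl)||e _|e _]; rewrite ?mulr0 ?expr0n //; nra.
Qed.

(** The logarithm of the energy has derivative -mean(lam)/2, and mean(lam) is smallest at t = 1.
    This is where the estimate passes to the new point. *)
Lemma ln_energy_decrease :
  ln (energy (damped x 1)) - ln (energy (damped x 0)) <= - mean_lam (damped x 1) / 2.
Proof.
have d u : is_derive u (1 : R) (fun u => ln (Z u)) ((Z u)^-1 * (- L u / 2)).
  exact: (@is_derive1_comp R (@ln R) Z u _ _ (is_derive1_ln (damped_energy_gt0 u)) (dZ u)).
have := mean_value_le ler01 d; rewrite subr0 => h.
rewrite -[leRHS]mulr1; apply: h => u u01.
have := mean_lam_decreasing u01; rewrite {2}/mean_lam -/(L u) -/(Z u) => h.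
have -> : (Z u)^-1 * (- L u / 2) = - (L u / Z u) / 2 by field; exact: Zn.
lra.
Qed.

(* The derivative of the difference below is half of Cov(lam, S) - Var(lam)/2, which is at
   most Var(S)/2. *)
Lemma mean_form_decrease (S : T -> T -> R) (K : R) :
  (forall d e, S d e = S e d) ->
  (forall y : T -> R, \sum_d (\sum_e S d e * y e) ^+ 2 <= 2 * K * energy y) ->
  (mean_form S (damped x 0) - mean_form S (damped x 1))
    - 2^-1 * (mean_lam (damped x 0) - mean_lam (damped x 1)) <= K / 2.
Proof.
move=> Ssym SK.
pose E t := \sum_d damped x t d * (\sum_e S d e * damped x t e).
pose G t := \sum_d lam d * damped x t d * (\sum_e S d e * damped x t e).
have dE t : is_derive t (1 : R) E (- G t / 2).
  have -> : E = fun t => \sum_(p : T * T) (x p.1 * S p.1 p.2 * x p.2) *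
      expR (t * (- (lam p.1 + lam p.2) / 4)) by apply/funext => u; exact: damped_formE.
  apply: (is_derive_eq (is_derive_sum_expR _ _ _)).
  pose r d e := damped x t d * S d e * damped x t e.
  have -> : \sum_p x p.1 * S p.1 p.2 * x p.2 *
      (- (lam p.1 + lam p.2) / 4 * expR (t * (- (lam p.1 + lam p.2) / 4))) =
      \sum_p - (lam p.1 + lam p.2) / 4 * r p.1 p.2.
    apply: eq_bigr => -[d e] _ /=; rewrite /r /damped.
    have -> : t * (- (lam d + lam e) / 4) = - (t * lam d) / 4 + - (t * lam e) / 4 by field.
    by rewrite expRD; ring.
  rewrite -(pair_bigA _ (fun d e => - (lam d + lam e) / 4 * r d e)) /=.
  have G1 : G t = \sum_d \sum_e lam d * r d e.
    by apply: eq_bigr => d _; rewrite mulr_sumr; apply: eq_bigr => e _; rewrite /r; ring.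
  have G2 : G t = \sum_d \sum_e lam e * r d e.
    rewrite G1 exchange_big; apply: eq_bigr => d _; apply: eq_bigr => e _.
    by rewrite /r Ssym; ring.
  (* By symmetry of S the weights lam d and lam e give the same sum G; averaging the two matches the
     exponent (lam d + lam e) / 4. *)
  have -> : - G t / 2 = - (G t + G t) / 4 by field.
  rewrite {1}G1 G2 -big_split /= -sumrN mulr_suml; apply: eq_bigr => d _.
  by rewrite -big_split /= -sumrN mulr_suml; apply: eq_bigr => e _; ring.
have d u : is_derive u (1 : R) (fun u => (2^-1 * L u - E u) / Z u)
   (((2^-1 * (- Q u / 2) - (- G u / 2)) * Z u - (2^-1 * L u - E u) * (- L u / 2)) / Z u ^+ 2).
  apply: is_derive_quotient; [exact: Zn | | exact: dZ].
  have d1 := @is_deriveZ R R R L 2^-1 u 1 _ (dL u).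
  exact: (@is_deriveB R R R _ _ u 1 _ _ d1 (dE u)).
have h := mean_value_le (k := K / 2) ler01 d; rewrite subr0 mulr1 in h.
have -> : mean_form S (damped x 0) - mean_form S (damped x 1)
    - 2^-1 * (mean_lam (damped x 0) - mean_lam (damped x 1)) =
    (2^-1 * L 1 - E 1) / Z 1 - (2^-1 * L 0 - E 0) / Z 0.
  rewrite /mean_form /mean_lam -!/(Z _) -!/(L _) -!/(E _).
  by field; rewrite !Zn.
apply: h => u _.
have Z0 := damped_energy_gt0 u; rewrite -/(Z u) in Z0.
(* For eta = S y the three sums are the quadratic form, its covariance term with lam, and |S y|^2,
   which [SK] bounds by 2 K Z. *)
have V := @variance_bound (fun d => \sum_e S d e * damped x u e) u _ _ _ erefl erefl erefl.
rewrite -/(E u) -/(G u) in V.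
have := SK (damped x u); rewrite -/(Z u).
move: (\sum_d _ ^+ 2) V => H V HK.
rewrite ler_pdivrMr ?exprn_gt0 //.
have h1 : Z u * H <= Z u * (2 * K * Z u) by rewrite ler_pM2l.
have h2 := sqr_ge0 (E u).
nra.
Qed.

End Descent.

Lemma cauchy_schwarz_sum (R : realFieldType) (I : finType) (x y : I -> R) :
  (\sum_i x i * y i) ^+ 2 <= (\sum_i x i ^+ 2) * (\sum_i y i ^+ 2).
Proof.
set P := \sum_i x i * y i; set X := \sum_i _; set Y := \sum_i _.
have Y0 : 0 <= Y by apply: sumr_ge0 => i _; exact: sqr_ge0.
have [Y1|Y1] := eqVneq Y 0.
  rewrite Y1 mulr0 /P big1 ?expr0n // => i _.
  have /eqP := Y1; rewrite psumr_eq0 => [/allP/(_ i (mem_index_enum _))|j _]; last exact: sqr_ge0.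
  by rewrite /= sqrf_eq0 => /eqP ->; rewrite mulr0.
have {}Y0 : 0 < Y by rewrite lt_neqAle eq_sym Y1.
have : 0 <= \sum_i (x i * Y - y i * P) ^+ 2 by apply: sumr_ge0 => i _; exact: sqr_ge0.
have -> : \sum_i (x i * Y - y i * P) ^+ 2 = Y * (X * Y - P ^+ 2).
  transitivity (\sum_i (Y ^+ 2 * x i ^+ 2 - 2 * Y * P * (x i * y i) + P ^+ 2 * y i ^+ 2)).
    by apply: eq_bigr => i _; ring.
  rewrite !big_split /= sumrN -!mulr_sumr -/X -/Y -/P; ring.
by rewrite pmulr_rge0 // subr_ge0.
Qed.

Lemma sum_pair (V : nmodType) (I J : finType) (F : I * J -> V) :
  \sum_p F p = \sum_i \sum_j F (i, j).
Proof.
rewrite (eq_bigr (fun p => F (p.1, p.2))) => [|[] //].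
by rewrite -(pair_bigA _ (fun i j => F (i, j))).
Qed.

(** * Descent for tuples of complex matrices *)

Section MatrixDescent.
Variable R : realType.
Local Notation C := (Cx R).

Lemma normc_sum_le (I : Type) (r : seq I) (F : I -> C) :
  Normc.normc (\sum_(i <- r) F i) <= \sum_(i <- r) Normc.normc (F i).
Proof.
elim: r => [|i r IH]; first by rewrite !big_nil (@Normc.normc0 R).
rewrite !big_cons; apply: le_trans (@le_normcD R _ _) _.
by rewrite lerD2l.
Qed.

Lemma abs2_sum_le (I : finType) (a b : I -> C) :
  abs2 (\sum_i a i * b i) <= (\sum_i abs2 (a i)) * (\sum_i abs2 (b i)).
Proof.
rewrite abs2_normc; apply: (@le_trans _ _ ((\sum_i Normc.normc (a i) * Normc.normc (b i)) ^+ 2)).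
  rewrite ler_sqr ?nnegrE ?normc_ge0 //.
    by apply: le_trans (normc_sum_le _ _) _; apply: ler_sum => i _; rewrite (@Normc.normcM R).
  by apply: sumr_ge0 => i _; rewrite mulr_ge0 ?normc_ge0.
apply: le_trans (cauchy_schwarz_sum _ _) _.
by rewrite (eq_bigr _ (fun i _ => esym (abs2_normc (a i)))) (eq_bigr _ (fun i _ => esym (abs2_normc (b i)))).
Qed.

Lemma fr2_mul_le n m p (A : 'M[C]_(n, m)) (B : 'M[C]_(m, p)) : fr2 (A *m B) <= fr2 A * fr2 B.
Proof.
rewrite /fr2 mulr_suml; apply: ler_sum => i _.
rewrite [X in _ * X]exchange_big mulr_sumr; apply: ler_sum => j _.
by rewrite mxE abs2_sum_le.
Qed.

Lemma abs2D_le (z w : C) : abs2 (z + w) <= 2 * (abs2 z + abs2 w).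
Proof.
rewrite /abs2 !raddfD /=; have := sqr_ge0 (re z - re w); have := sqr_ge0 (im z - im w).
nra.
Qed.

Lemma fr2D_le n m (A B : 'M[C]_(n, m)) : fr2 (A + B) <= 2 * (fr2 A + fr2 B).
Proof.
rewrite /fr2 -big_split /= mulr_sumr; apply: ler_sum => i _.
rewrite -big_split /= mulr_sumr; apply: ler_sum => j _.
by rewrite mxE abs2D_le.
Qed.

Variables (n m N : nat).
Local Notation tuple := ('I_N -> 'M[C]_(n, m)).
Local Notation D := ('I_N * ('I_n * 'I_m))%type.
Local Notation T := (D * bool)%type.

(** Separating real and imaginary parts turns a complex tuple into a real vector with the same
    squared norm, to which the real estimates apply. *)
Definition real_part (B : tuple) (p : T) : R :=
  if p.2 then re (B p.1.1 p.1.2.1 p.1.2.2) else im (B p.1.1 p.1.2.1 p.1.2.2).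

Lemma real_partK (y : T -> R) : exists B : tuple, real_part B = y.
Proof.
exists (fun l => \matrix_(i, j) (y ((l, (i, j)), true) +i* y ((l, (i, j)), false))).
by apply/funext => -[[l [i j]] []]; rewrite /real_part /= mxE.
Qed.

Lemma sum_realpart (F : T -> R) : \sum_p F p = \sum_l \sum_i \sum_j (F ((l, (i, j)), true) + F ((l, (i, j)), false)).
Proof.
rewrite sum_pair -(sum_triple (fun l i j => F (l, (i, j), true) + F (l, (i, j), false))).
by apply: eq_bigr => -[l [i j]] _; rewrite big_bool.
Qed.

Lemma energy_real_part B : energy (real_part B) = nrm2 B.
Proof.
by rewrite /energy sum_realpart.
Qed.

Section Form.
Variables (W1 : 'M[C]_n) (W2 : 'M[C]_m).

Definition form_op (B : tuple) : tuple := fun l => W1 *m B l + B l *m W2.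

Definition form_entry (d e : D) : C :=
  if d.1 == e.1 then
    (W1 d.2.1 e.2.1 *+ (d.2.2 == e.2.2)) + (W2 e.2.2 d.2.2 *+ (d.2.1 == e.2.1))
  else 0.

(** Real matrix of the complex linear operator [form_op]: each complex entry acts as a real 2 x 2
    block. *)
Definition form_kernel (p q : T) : R :=
  let z := form_entry p.1 q.1 in
  if p.2 then (if q.2 then re z else - im z) else (if q.2 then im z else re z).

Lemma form_opE (B : tuple) d : \sum_e form_entry d e * B e.1 e.2.1 e.2.2 = form_op B d.1 d.2.1 d.2.2.
Proof.
case: d => l [i j] /=.
rewrite sum_pair /=.
rewrite (bigD1 l) //= [X in _ + X]big1 ?addr0; last first.
  move=> l' ll'; rewrite big1 // => e _.
  by rewrite /form_entry /= eq_sym (negbTE ll') mul0r.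
rewrite sum_pair /=.
rewrite /form_entry /= eqxx.
under eq_bigr => i' _ do (under eq_bigr => j' _ do rewrite mulrDl; rewrite big_split).
rewrite big_split /form_op mxE; congr (_ + _).
  rewrite mxE; apply: eq_bigr => i' _; rewrite (bigD1 j) //= eqxx mulr1n big1 ?addr0 // => j' jj'.
  by rewrite eq_sym (negbTE jj') mulr0n mul0r.
rewrite mxE (bigD1 i) //= [X in _ + X]big1 ?addr0.
  by apply: eq_bigr => j' _; rewrite eqxx mulr1n mulrC.
move=> i' ii'; rewrite big1 // => j' _.
by rewrite eq_sym (negbTE ii') mulr0n mul0r.
Qed.

Lemma form_kernelE B p : \sum_q form_kernel p q * real_part B q = real_part (form_op B) p.
Proof.
rewrite sum_pair /=.
rewrite {2}/real_part -form_opE re_sum raddf_sum /=.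
case: p => d [] /=; apply: eq_bigr => e _; rewrite big_bool /form_kernel /real_part /=.
  by rewrite reM; ring.
by rewrite imM; ring.
Qed.

Hypotheses (W1a : W1^t* = W1) (W2a : W2^t* = W2).

Lemma form_kernel_sym p q : form_kernel p q = form_kernel q p.
Proof.
have E d e : form_entry e d = Num.conj (form_entry d e).
  rewrite /form_entry eq_sym; case: ifP => _; last by rewrite conjC0.
  rewrite -{1}W1a -{1}W2a !mxE rmorphD !rmorphMn.
  by rewrite [d.2.2 == _]eq_sym [d.2.1 == _]eq_sym.
by rewrite /form_kernel E re_conj im_conj; case: p q => d [] [e []] //=; rewrite opprK.
Qed.

(** The factor 2, from |a + b|^2 <= 2 (|a|^2 + |b|^2), is the smoothness constant L = 2; it is
    absorbed in the 2 K of [mean_form_decrease]. *)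
Lemma form_kernel_bound (y : T -> R) :
  \sum_p (\sum_q form_kernel p q * y q) ^+ 2 <= 2 * (fr2 W1 + fr2 W2) * energy y.
Proof.
have [B <-] := real_partK y.
under eq_bigr do rewrite form_kernelE.
rewrite -/(energy _) !energy_real_part /nrm2 mulr_sumr; apply: ler_sum => l _.
apply: le_trans (fr2D_le _ _) _; rewrite -mulrA ler_pM2l // mulrDl.
by rewrite lerD ?fr2_mul_le // mulrC fr2_mul_le.
Qed.

Lemma mean_form_real_part B :
  mean_form form_kernel (real_part B) =
  (re (\tr (W1 *m rowgram B)) + re (\tr (W2 *m colgram B))) / nrm2 B.
Proof.
rewrite /mean_form energy_real_part; congr (_ / _).
under eq_bigr do rewrite form_kernelE.
rewrite sum_realpart -reD.
have -> : \tr (W1 *m rowgram B) + \tr (W2 *m colgram B) = \sum_l \tr (form_op B l *m (B l)^t*).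
  rewrite /rowgram /colgram !mulmx_sumr !raddf_sum -big_split /=; apply: eq_bigr => l _.
  rewrite /form_op mulmxDl raddfD /= mulmxA; congr (_ + _).
  by rewrite mulmxA mxtrace_mulC mulmxA.
rewrite re_sum; apply: eq_bigr => l _; rewrite re_sum; apply: eq_bigr => i _.
rewrite mxE re_sum; apply: eq_bigr => j _.
by rewrite adjE reM re_conj im_conj /real_part /=; ring.
Qed.

End Form.
End MatrixDescent.

Lemma hermitianB (C : numClosedFieldType) n (A B : 'M[C]_n) :
  A^t* = A -> B^t* = B -> (A - B)^t* = A - B.
Proof. by move=> Aa Ba; apply/matrixP => i j; rewrite -{2}Aa -{2}Ba !mxE rmorphB. Qed.

Section OneStep.
Variable R : realType.
Local Notation C := (Cx R).
Variables (n m N : nat).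
Local Notation tuple := ('I_N -> 'M[C]_(n, m)).
Hypotheses (n0 : (0 < n)%N) (m0 : (0 < m)%N).

Lemma mean_form_mu (W1 : 'M[C]_n) (W2 : 'M[C]_m) (X : tuple) : 0 < nrm2 X ->
  mean_form (form_kernel W1 W2) (real_part X) =
  re (\tr (W1 *m mu1 X)) + re (\tr (W2 *m mu2 X)) + re (\tr W1) / n%:R + re (\tr W2) / m%:R.
Proof.
move=> X0; rewrite mean_form_real_part.
have E k (W M : 'M[C]_k) (c d : R) :
    re (\tr (W *m (rc c *: M - (rc d)%:M))) = c * re (\tr (W *m M)) - d * re (\tr W).
  rewrite mulmxBr [\tr _]raddfB reB /= -scalemxAr mxtraceZ re_rcM mul_mx_scalar mxtraceZ.
  by rewrite re_rcM.
by rewrite /mu1 /mu2 !E mulrDl; ring.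
Qed.

Definition lam_of (u : 'rV[R]_n) (v : 'rV[R]_m) (p : 'I_N * ('I_n * 'I_m) * bool) : R :=
  - (u 0 p.1.2.1 + v 0 p.1.2.2).

Lemma mean_lamE u v (X : tuple) :
  mean_lam (lam_of u v) (real_part X) =
  mean_form (form_kernel (rdg (- u)) (rdg (- v))) (real_part X).
Proof.
rewrite /mean_lam /mean_form; congr (_ / _); apply: eq_bigr => -[[l [i j]] b] _.
rewrite form_kernelE expr2 mulrCA; congr (_ * _).
have -> : real_part (form_op (rdg (- u)) (rdg (- v)) X) (l, (i, j), b) =
   (if b then @re R else @im R) (rc (- (u 0 i + v 0 j)) * X l i j).
  rewrite /real_part /=; case: b; congr (_ _);
  rewrite /form_op mul_diag_mx mul_mx_diag !mxE opprD rcD !rcN; ring.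
by case: b; rewrite /real_part /lam_of /= ?re_rcM ?im_rcM.
Qed.

Lemma damped_real_part u v (X : tuple) :
  damped (lam_of u v) (real_part X) 1 =
  real_part (scal X (rdg (map_mx expR (4^-1 *: u))) (rdg (map_mx expR (4^-1 *: v)))).
Proof.
apply/funext => -[[l [i j]] b]; rewrite /damped /real_part /= scal_rdgE.
have -> : expR (- (1 * lam_of u v (l, (i, j), b)) / 4) =
    (map_mx expR (4^-1 *: u)) 0 i * (map_mx expR (4^-1 *: v)) 0 j.
  by rewrite !mxE -expRD /lam_of /=; congr expR; field.
by case: b; rewrite ?re_rcM ?im_rcM mulrC.
Qed.

Lemma damped0 u v (X : tuple) : damped (lam_of u v) (real_part X) 0 = real_part X.
Proof.
apply/funext => p; rewrite /damped mul0r oppr0 mul0r expR0 mulr1 //.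
Qed.

(** Let P and P' be the moment maps of B and B', and W = P - P'. As P is diagonal with entries -u
    and -v, the mean of lam at a tuple is the pairing of P with its moment map. So
    [ln_energy_decrease] bounds the drop below by <P, P'>/2, and [mean_form_decrease] for the form
    given by W reads |W|^2 - <P, W>/2 <= |W|^2/2. The latter is |P'|^2 <= <P, P'>. *)
Lemma descent (B B' : tuple) (u : 'rV[R]_n) (v : 'rV[R]_m) : 0 < nrm2 B ->
  mu1 B = rdg (- u) -> mu2 B = rdg (- v) ->
  B' = scal B (rdg (map_mx expR (4^-1 *: u))) (rdg (map_mx expR (4^-1 *: v))) ->
  ln (nrm2 B') <= ln (nrm2 B) - (fr2 (mu1 B') + fr2 (mu2 B')) / 2.
Proof.
move=> B0 uE vE B'E.
have eB : 0 < energy (real_part B) by rewrite energy_real_part.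
have B'0 : 0 < nrm2 B'.
  rewrite B'E -energy_real_part -damped_real_part; exact: damped_energy_gt0.
have := @ln_energy_decrease R _ (lam_of u v) _ eB.
rewrite damped_real_part damped0 -B'E !energy_real_part mean_lamE mean_form_mu // -uE -vE.
rewrite (tr_mu1 n0 B0) (tr_mu2 m0 B0) raddf0 !mul0r !addr0.
have W1a : (mu1 B - mu1 B')^t* = mu1 B - mu1 B'.
  exact: hermitianB (adj_mu1 _) (adj_mu1 _).
have W2a : (mu2 B - mu2 B')^t* = mu2 B - mu2 B'.
  exact: hermitianB (adj_mu2 _) (adj_mu2 _).
have := @mean_form_decrease R _ (lam_of u v) _ eB _ _ (form_kernel_sym W1a W2a)
  (@form_kernel_bound R n m N _ _).
rewrite damped_real_part damped0 -B'E !mean_lamE !mean_form_mu // -uE -vE.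
have frE k (M : 'M[C]_k) : M^t* = M -> fr2 M = re (\tr (M *m M)).
  by move=> Ma; rewrite -{3}Ma tr_mul_adj.
rewrite (frE _ _ W1a) (frE _ _ W2a) (frE _ _ (adj_mu1 B')) (frE _ _ (adj_mu2 B')).
have trBr k (P Q S : 'M[C]_k) : re (\tr (P *m (Q - S))) = re (\tr (P *m Q)) - re (\tr (P *m S)).
  by rewrite mulmxBr [\tr (_ - _)]raddfB reB.
have trBl k (P Q S : 'M[C]_k) : re (\tr ((Q - S) *m P)) = re (\tr (Q *m P)) - re (\tr (S *m P)).
  by rewrite mulmxBl [\tr (_ - _)]raddfB reB.
move: (mu1 B) (mu1 B') (mu2 B) (mu2 B') (ln (nrm2 B')) (ln (nrm2 B)) => P P' Q Q' z' z.
rewrite !trBr !trBl (mxtrace_mulC P' P) (mxtrace_mulC Q' Q).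
lra.
Qed.

End OneStep.

(** * Cauchy-Binet and Abel summation *)

(** The sum runs over all maps and not over subsets: maps that are not injective contribute zero and
    each r-subset is met r! times, hence the factor on the left. *)
Lemma cauchy_binet (F : comNzRingType) r n (A : 'M[F]_(r, n)) (B : 'M[F]_(n, r)) :
  (\det (A *m B)) *+ r`! =
  \sum_(f : {ffun 'I_r -> 'I_n}) \det (colsub f A) * \det (rowsub f B).
Proof.
have expand : \det (A *m B) =
    \sum_(f : {ffun 'I_r -> 'I_n}) (\prod_i A i (f i)) * \det (rowsub f B).
  rewrite /determinant.
  under eq_bigr => s _ do (under eq_bigr => i _ do rewrite mxE; rewrite bigA_distr_bigA mulr_sumr).
  rewrite exchange_big; apply: eq_bigr => f _ /=; rewrite mulr_sumr; apply: eq_bigr => s _.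
  rewrite big_split /= mulrCA; congr (_ * (_ * _)).
  by apply: eq_bigr => i _; rewrite mxE.
(* Relabelling the maps by t costs the sign of t; the sum over all t then assembles the products
   into a minor of A. *)
have perm_expand (t : 'S_r) : \det (A *m B) =
    \sum_(f : {ffun 'I_r -> 'I_n}) (-1) ^+ t * (\prod_i A i (f (t i))) * \det (rowsub f B).
  rewrite expand (reindex_onto (fun f : {ffun 'I_r -> 'I_n} => [ffun i => f (t i)])
    (fun f : {ffun 'I_r -> 'I_n} => [ffun i => f ((t^-1)%g i)])) /=; last first.
    by move=> f _; apply/ffunP => i; rewrite !ffunE permK.
  apply: eq_big => [f|f _].
    by apply/eqP/ffunP => i; rewrite !ffunE permKV.
  have -> : rowsub [ffun i => f (t i)] B = row_perm t (rowsub f B).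
    by apply/matrixP => i j; rewrite !mxE ffunE.
  rewrite row_permE det_mulmx det_perm mulrA; congr (_ * _); rewrite mulrC; congr (_ * _).
  by apply: eq_bigr => i _; rewrite ffunE.
have -> : (\det (A *m B)) *+ r`! = \sum_(t : 'S_r) \det (A *m B) by rewrite sumr_const card_Sn.
rewrite (eq_bigr _ (fun t _ => perm_expand t)) exchange_big /=; apply: eq_bigr => f _.
rewrite -mulr_suml; congr (_ * _); rewrite /determinant; apply: eq_bigr => t _.
by congr (_ * _); apply: eq_bigr => i _; rewrite mxE.
Qed.

Lemma sum_injective_le (R : numDomainType) (I J : finType) (f : I -> J) (F : J -> R) :
  injective f -> (forall j, 0 <= F j) -> \sum_i F (f i) <= \sum_j F j.
Proof.
move=> finj F0; rewrite [leRHS](bigID (mem (codom f))) /= -big_uniq /=; last first.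
  by rewrite map_inj_uniq // enum_uniq.
by rewrite big_map big_enum lerDl sumr_ge0.
Qed.

Lemma sum_largest (R : realDomainType) n r (rn : (r <= n)%N) (a : 'I_n -> R) (f : 'I_r -> 'I_n) :
  (forall i j : 'I_n, (i <= j)%N -> a j <= a i) -> injective f ->
  \sum_i a (f i) <= \sum_(i < n | (i < r)%N) a i.
Proof.
move=> am finj; rewrite (big_ord_narrow rn); case: r rn f finj => [|r] rn f finj.
  by rewrite !big_ord0.
(* The threshold t is the smallest of the r largest values: a - t is at most its positive part,
   which equals a - t on the first r indices and vanishes beyond. *)
pose t := a (widen_ord rn ord_max).
pose F k := Num.max 0 (a k - t).
have F0 k : 0 <= F k by rewrite /F le_max lexx.
suff : \sum_i (a (f i) - t) <= \sum_(i < r.+1) (a (widen_ord rn i) - t).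
  by rewrite !sumrB lerD2r.
apply: (@le_trans _ _ (\sum_i F (f i))).
  by apply: ler_sum => i _; rewrite /F le_max lexx orbT.
apply: le_trans (sum_injective_le finj F0) _.
rewrite (bigID (fun k : 'I_n => (k < r.+1)%N)) /= [X in _ + X]big1 ?addr0; last first.
  move=> k; rewrite -leqNgt => rk; apply/max_idPl; rewrite subr_le0 am //=.
  exact: ltnW.
rewrite (big_ord_narrow rn); apply: ler_sum => i _; rewrite /F ge_max lexx andbT subr_ge0 am //=.
by rewrite -ltnS ltn_ord.
Qed.

Lemma abel_sum_ge0 (R : realDomainType) n (c b : 'I_n -> R) :
  (forall i j : 'I_n, (i <= j)%N -> c j <= c i) ->
  (forall r, (r <= n)%N -> 0 <= \sum_(i < n | (i < r)%N) b i) ->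
  \sum_i b i = 0 -> 0 <= \sum_i c i * b i.
Proof.
case: n c b => [|n] c b cm bp b0; first by rewrite big_ord0.
(* Strengthened to an arbitrary total of b, so that the induction can drop the last index. *)
suff : c ord_max * \sum_i b i <= \sum_i c i * b i by rewrite b0 mulr0.
elim: n c b cm bp {b0} => [|n IH] c b cm bp; first by rewrite !big_ord1 (ord1 ord_max).
rewrite [X in _ * X <= _]big_ord_recr [X in _ <= X]big_ord_recr /= mulrDr lerD2r.
have le_n := leqnSn n.+1.
have B0 : 0 <= \sum_(i < n.+1) b (widen_ord le_n i).
  by have := bp n.+1 le_n; rewrite (big_ord_narrow le_n).
have := IH (fun i => c (widen_ord le_n i)) (fun i => b (widen_ord le_n i)).
move=> h; rewrite [X in _ * X <= _](eq_bigr (fun i => b (widen_ord le_n i))); last first.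
  by move=> i _; congr b; exact: val_inj.
rewrite [X in _ <= X](eq_bigr (fun i => c (widen_ord le_n i) * b (widen_ord le_n i))); last first.
  by move=> i _; congr (c _ * b _); exact: val_inj.
apply: le_trans (h _ _).
- by rewrite ler_wpM2r // cm //= ltnW.
- by move=> i j ij; exact: cm.
move=> r rn; have := bp r (leq_trans rn le_n).
rewrite (big_ord_narrow (leq_trans rn le_n)) (big_ord_narrow rn).
by rewrite (eq_bigr (fun i => b (widen_ord le_n (widen_ord rn i)))) // => i _; congr b; exact: val_inj.
Qed.

(** * Majorization of logarithmic spectra *)

Section Majorization.
Variable R : realType.
Local Notation C := (Cx R).

Definition nonincreasing_row n (a : 'rV[R]_n) := forall i j : 'I_n, (i <= j)%N -> a 0 j <= a 0 i.

Lemma det_adj n (M : 'M[C]_n) : \det (M^t*) = Num.conj (\det M).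
Proof. by rewrite det_map_mx det_tr. Qed.

Lemma det_rdg n (d : 'rV[R]_n) : \det (rdg d) = rc (\prod_i d 0 i).
Proof. by rewrite det_diag rc_prod; apply: eq_bigr => i _; rewrite !mxE. Qed.

Lemma det_weighted r n (u : 'M[C]_(r, n)) (d : 'rV[R]_n) :
  \det (u *m rdg d *m u^t*) =
  rc ((\sum_(f : {ffun 'I_r -> 'I_n}) (\prod_i d 0 (f i)) * abs2 (\det (colsub f u))) / r`!%:R).
Proof.
have nz : r`!%:R != 0 :> C by rewrite pnatr_eq0 -lt0n fact_gt0.
apply: (mulIf nz); rewrite mulr_natr -mulmxA cauchy_binet -(rmorph_nat (@rc R)) -rcM.
rewrite divfK ?pnatr_eq0 -?lt0n ?fact_gt0 // rc_sum; apply: eq_bigr => f _.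
have -> : rowsub f (rdg d *m u^t*) = rdg (\row_i d 0 (f i)) *m (colsub f u)^t*.
  by apply/matrixP => i j; rewrite !mul_diag_mx !mxE.
rewrite det_mulmx det_rdg det_adj rcM -mul_conj_abs2 mulrCA; congr (_ * _).
by congr rc; apply: eq_bigr => i _; rewrite mxE.
Qed.

(** In the Cauchy-Binet expansion every surviving term carries a product of r distinct weights, at
    most the product of the r largest. *)
Lemma det_weighted_le r n (rn : (r <= n)%N) (u : 'M[C]_(r, n)) (a : 'rV[R]_n) :
  nonincreasing_row a ->
  re (\det (u *m rdg (map_mx expR a) *m u^t*)) <=
  expR (\sum_(i < n | (i < r)%N) a 0 i) * re (\det (u *m u^t*)).
Proof.
have E : u *m u^t* = u *m rdg (map_mx expR 0) *m u^t* by rewrite expR_rdg0 mulmx1.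
move=> am; rewrite E !det_weighted !re_rc.
rewrite mulrA ler_wpM2r ?invr_ge0 ?ler0n // mulr_sumr; apply: ler_sum => f _.
under eq_bigr do rewrite mxE.
rewrite [X in _ <= _ * (X * _)]big1 => [|i _]; last by rewrite !mxE expR0.
rewrite mul1r; case: (boolP (injectiveb f)) => [/injectiveP finj|/injectivePn[i [j ij fij]]].
  rewrite ler_wpM2r ?abs2_ge0 // -expR_sum ler_expR.
  exact: sum_largest.
have -> : \det (colsub f u) = 0.
  by rewrite -det_tr (determinant_alternate ij) // => k; rewrite !mxE fij.
by rewrite abs2_0 !mulr0.
Qed.

Lemma udiag_perm n (p : 'S_n) (s : 'M[C]_n) (a : 'rV[R]_n) :
  udiag (row_perm p s) (\row_i a 0 (p i)) = udiag s a.
Proof.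
apply/matrixP => i j; rewrite !udiagE [RHS](reindex_inj (@perm_inj _ p)) /=.
by apply: eq_bigr => l _; rewrite !mxE.
Qed.

Lemma adj_mul_perm n (p : 'S_n) (s : 'M[C]_n) :
  (row_perm p s)^t* *m row_perm p s = s^t* *m s.
Proof.
apply/matrixP => i j; rewrite !mxE [RHS](reindex_inj (@perm_inj _ p)) /=.
by apply: eq_bigr => l _; rewrite !mxE.
Qed.

Lemma weighted_adj r n (w : 'M[C]_(r, n)) (g : 'M[C]_n) d :
  w *m udiag g d *m w^t* = (w *m g^t*) *m rdg d *m (w *m g^t*)^t*.
Proof. by rewrite adjM adjK /udiag !mulmxA. Qed.

Lemma adj_adj r n (w : 'M[C]_(r, n)) (g : 'M[C]_n) :
  (w *m g^t*) *m (w *m g^t*)^t* = w *m (g^t* *m g) *m w^t*.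
Proof. by rewrite adjM adjK !mulmxA. Qed.

Section OneStep.
Variables (n : nat) (s s' g : 'M[C]_n) (a a' u : 'rV[R]_n).
Hypotheses (su : s \is unitarymx) (su' : s' \is unitarymx).
Hypotheses (xE : g^t* *m g = udiag s (map_mx expR a))
  (xE' : udiag g (map_mx expR u) = udiag s' (map_mx expR a')).
Hypotheses (am : nonincreasing_row a) (um : nonincreasing_row u).

(** Compress to the first r eigenvectors w of the new point x' = g^* exp(u) g: the determinant of
    the compression of x' is the exponential of the left side. Pulling out exp(u) leaves the
    compression of x = g^* g by the same w, from which exp(a) is pulled out in turn. *)
Lemma log_top_sum_le r : (r <= n)%N ->
  \sum_(i < n | (i < r)%N) a' 0 i <=
  \sum_(i < n | (i < r)%N) a 0 i + \sum_(i < n | (i < r)%N) u 0 i.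
Proof.
move=> rn; pose w : 'M[C]_(r, n) := rowsub (widen_ord rn) s'.
have winj : injective (widen_ord rn) by move=> i j /(congr1 val) /= /val_inj.
have ww : w *m s'^t* = \matrix_(i, j) ((widen_ord rn i == j)%:R).
  apply/matrixP => i j; have := unitary_mul_adj su' => /matrixP/(_ (widen_ord rn i) j).
  by rewrite !mxE => <-; apply: eq_bigr => k _; rewrite !mxE.
have detL : \det (w *m udiag s' (map_mx expR a') *m w^t*) = rc (expR (\sum_(i < n | (i < r)%N) a' 0 i)).
  rewrite (_ : _ *m _ = rdg (\row_i expR (a' 0 (widen_ord rn i)))); last first.
    rewrite weighted_adj ww mul_mx_diag; apply/matrixP => i j; rewrite !mxE.
    rewrite (bigD1 (widen_ord rn i)) //= !mxE eqxx mul1r big1 ?addr0; last first.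
      by move=> k ki; rewrite !mxE eq_sym (negbTE ki) !mul0r.
    rewrite [widen_ord rn j == _]eq_sym (inj_eq winj).
    case: (i == j); first by rewrite rmorph1 mulr1.
    by rewrite rmorph0 mulr0.
  rewrite det_rdg (big_ord_narrow rn) expR_sum; congr rc.
  by apply: eq_bigr => i _; rewrite mxE.
have detI : re (\det (w *m w^t*)) = 1.
  rewrite (_ : _ *m _ = 1%:M) ?det1 -?rc1 //.
  apply/matrixP => i j; have := unitary_mul_adj su' => /matrixP/(_ (widen_ord rn i) (widen_ord rn j)).
  rewrite !mxE (inj_eq winj) => <-; apply: eq_bigr => k _; rewrite !mxE //.
rewrite -ler_expR expRD -[leLHS]re_rc -detL -xE' weighted_adj.
apply: le_trans (det_weighted_le rn _ um) _.
rewrite adj_adj xE weighted_adj mulrC ler_wpM2r ?expR_ge0 //.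
apply: le_trans (det_weighted_le rn _ am) _.
by rewrite adj_adj (unitary_adj_mul su) mulmx1 detI mulr1.
Qed.

Lemma log_sum_eq : \sum_i a' 0 i = \sum_i a 0 i + \sum_i u 0 i.
Proof.
have detu (t : 'M[C]_n) (b : 'rV[R]_n) :
    \det (udiag t (map_mx expR b)) = rc (expR (\sum_i b 0 i)) * \det (t^t* *m t).
  rewrite /udiag !det_mulmx det_rdg expR_sum mulrAC mulrC; congr (rc _ * _).
  by apply: eq_bigr => i _; rewrite mxE.
apply: expR_inj; apply: (@rc_inj R); rewrite expRD rcM.
have := detu s' a'; rewrite (unitary_adj_mul su') det1 mulr1 => <-.
rewrite -xE' detu xE detu (unitary_adj_mul su) det1 mulr1.
by rewrite mulrC.
Qed.

(** The majorization by partial sums, with equality of totals, is integrated against the monotone c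
    by Abel summation. *)
Lemma log_inner_le (c : 'rV[R]_n) : nonincreasing_row c ->
  \sum_i c 0 i * a' 0 i <= \sum_i c 0 i * a 0 i + \sum_i c 0 i * u 0 i.
Proof.
move=> cm; rewrite -subr_ge0 -big_split /= -sumrB.
rewrite (eq_bigr (fun i => c 0 i * (a 0 i + u 0 i - a' 0 i))) => [|i _]; last by ring.
apply: abel_sum_ge0 => //.
  move=> r rn; rewrite sumrB big_split /= subr_ge0; exact: log_top_sum_le.
by rewrite sumrB big_split /= log_sum_eq subrr.
Qed.

End OneStep.
End Majorization.

(** * Weak duality *)

Section AdaptedBasis.
Variable C : numClosedFieldType.

Lemma exists_orthogonal n r (g : 'M[C]_n) (P : 'M[C]_(r, n)) (Z : {vspace 'rV[C]_n}) :
  g \in unitmx -> (r < \dim Z)%N ->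
  exists w : 'rV[C]_n, [/\ w != 0, w *m g \in Z & w *m P^t* = 0].
Proof.
move=> gu rZ; pose f := linfun (mulmxr (invmx g *m P^t*)) : 'Hom('rV[C]_n, 'rV[C]_r).
have d0 : (0 < \dim (Z :&: lker f))%N.
  have h1 : (\dim (f @: Z) <= r)%N.
    by rewrite (leq_trans (dimvS (subvf _))) // dimvf /dim /= mul1n.
  rewrite lt0n; apply/eqP => e; move: rZ.
  by rewrite -(limg_ker_dim f Z) e add0n ltnNge h1.
pose z := vpick (Z :&: lker f)%VS.
have z0 : z != 0 by rewrite vpick0 -dimv_eq0 -lt0n.
have := memv_pick (Z :&: lker f)%VS; rewrite memv_cap memv_ker lfunE /= => /andP[zZ /eqP zf].
exists (z *m invmx g); split.
- apply: contra z0 => /eqP e; rewrite -(mulmxKV gu z) e mul0mx; exact: eqxx.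
- by rewrite (mulmxKV gu).
- by rewrite -mulmxA.
Qed.

(** Orthonormal rows are chosen one after another: orthogonality to the r previous rows imposes r
    linear conditions, and the space for the next row has dimension larger than r. *)
Lemma adapted_unitary n (g : 'M[C]_n) (Z : nat -> {vspace 'rV[C]_n}) :
  g \in unitmx -> (forall r, (r < n)%N -> (r < \dim (Z r))%N) ->
  exists U : 'M[C]_n, U \is unitarymx /\ forall i : 'I_n, row i U *m g \in Z i.
Proof.
move=> gu dZ.
suff /(_ n (leqnn n))[w [wo wZ]] : forall r, (r <= n)%N -> exists w : nat -> 'rV[C]_n,
    (forall i j, (i < r)%N -> (j < r)%N -> (w i *m (w j)^t*) 0 0 = (i == j)%:R) /\
    (forall i, (i < r)%N -> w i *m g \in Z i).
  exists (\matrix_(i < n) w i); split; last by move=> i; rewrite rowK wZ.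
  apply/unitarymxP/matrixP => i j; rewrite [RHS]mxE -(wo i j) // !mxE.
  by apply: eq_bigr => k _; rewrite !mxE.
elim=> [_|r IH rn]; first by exists (fun=> 0).
have [w [wo wZ]] := IH (ltnW rn).
pose P := \matrix_(i < r) w i.
have [v [v0 vZ vP]] := exists_orthogonal P gu (dZ _ rn).
have vw i : (i < r)%N -> (v *m (w i)^t*) 0 0 = 0.
  move=> ir; have := vP => /matrixP/(_ 0 (Ordinal ir)); rewrite [RHS]mxE => <-.
  by rewrite !mxE; apply: eq_bigr => k _; rewrite !mxE.
have sym (a b : 'rV[C]_n) : (a *m b^t*) 0 0 = Num.conj ((b *m a^t*) 0 0).
  rewrite !mxE rmorph_sum; apply: eq_bigr => k _.
  by rewrite /= !mxE rmorphM /= conjCK mulrC.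
have wv i : (i < r)%N -> (w i *m v^t*) 0 0 = 0 by move=> ir; rewrite sym vw // conjC0.
have vv : 0 < (v *m v^t*) 0 0 by have := dotmx_is_dotmx v0; rewrite dotmxE.
pose c := (sqrtC ((v *m v^t*) 0 0))^-1.
have c0 : 0 <= c by rewrite invr_ge0 sqrtC_ge0 ltW.
have cc : Num.conj c = c by apply/CrealP/ger0_real.
have cE (a b : 'rV[C]_n) (x y : C) : ((x *: a) *m (y *: b)^t*) 0 0 = x * Num.conj y * (a *m b^t*) 0 0.
  rewrite !mxE mulr_sumr; apply: eq_bigr => k _; rewrite !mxE rmorphM; ring.
exists (fun k => if k == r then c *: v else w k); split.
  move=> i j; rewrite 2!ltnS (leq_eqVlt i) (leq_eqVlt j).
  case: (eqVneq i r) => [->|ir] /=; case: (eqVneq j r) => [->|jr] /=.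
  - move=> _ _; rewrite cE cc -expr2 /c exprVn sqrtCK mulVf //; exact: lt0r_neq0.
  - move=> _ jr'; by rewrite -[w j]scale1r cE vw // mulr0 // eq_sym (negbTE jr).
  - move=> ir' _; by rewrite -[w i]scale1r cE wv // mulr0 (negbTE ir).
  - exact: wo.
move=> i; rewrite ltnS (leq_eqVlt i); case: (eqVneq i r) => [->|ir] /=; last exact: wZ.
by rewrite -scalemxAl memvZ.
Qed.

End AdaptedBasis.

Section WeakDuality.
Variables (R : realType) (n m N : nat) (A : 'I_N -> 'M[Cx R]_(n, m)).
Local Notation C := (Cx R).
Variables (theta : nat) (X : nat -> {vspace 'rV[R[i]]_n}) (Y : nat -> {vspace 'rV[R[i]]_m}).
Hypotheses (n0 : (0 < n)%N) (m0 : (0 < m)%N) (hXY : EA_chain A theta X Y).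

Lemma EA_chain_X_sub a b : (a <= b <= theta)%N -> (X b <= X a)%VS.
Proof.
case/andP => /subnK <-; elim: (b - a)%N => [|d IH] h; first exact: subvv.
rewrite addSn; have [_ _ _ hX _] := hXY.
by have [h1 _] := hX _ h; exact: subv_trans h1 (IH (ltnW h)).
Qed.

Lemma EA_chain_Y_sub a b : (a <= b <= theta)%N -> (Y a <= Y b)%VS.
Proof.
case/andP => /subnK <-; elim: (b - a)%N => [|d IH] h; first exact: subvv.
rewrite addSn; have [_ _ _ _ hY] := hXY.
by have [h1 _] := hY _ h; exact: subv_trans (IH (ltnW h)) h1.
Qed.

Lemma adapted_rows (g : 'M[C]_n) : g \in unitmx ->
  exists U : 'M[C]_n, U \is unitarymx /\ forall (i : 'I_n) c, (c <= theta)%N ->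
    (n - \dim (X c) <= i)%N -> row i U *m g \in X c.
Proof.
move=> gu; pose D a := (n - \dim (X a))%N.
have [_ [X0 Xt] _ _ _] := hXY.
have D0 : D 0%N = 0%N by rewrite /D X0 dim_rV_full subnn.
have Dt : D theta = n by rewrite /D Xt dimv0 subn0.
have DS a : (a < theta)%N -> (D a < D a.+1)%N.
  by move=> h; have := EA_chain_dimX hXY h; have := dim_rV_le (X a); rewrite /D; lia.
pose blk i := block_index D theta i.
have blkP i : (i < n)%N -> (blk i < theta)%N /\ (D (blk i) <= i < D (blk i).+1)%N.
  by rewrite -{1}Dt => /(block_exists D0)[a ath ia]; rewrite /blk (block_indexE DS ath ia).
have dZ r : (r < n)%N -> (r < \dim (X (blk (n - r.+1))))%N.
  move=> rn; have [|h1 h2] := blkP (n - r.+1)%N; first lia.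
  by move: h2; rewrite {1}/D; have := dim_rV_le (X (blk (n - r.+1)%N)); lia.
have [U [Uu UZ]] := adapted_unitary (C := C) gu dZ.
(* The construction starts with the smallest spaces of the flag, whereas here these belong to the
   last rows; hence the reversal. *)
exists (row_perm (perm (@rev_ord_inj n)) U); split; first exact: unitary_row_perm.
move=> i c ct ci.
have -> : row i (row_perm (perm (@rev_ord_inj n)) U) = row (rev_ord i) U.
  by apply/rowP => j; rewrite !mxE permE.
have := UZ (rev_ord i); rewrite /= (_ : n - (n - i.+1).+1 = i)%N; last first.
  by have := ltn_ord i; lia.
move=> h; have [b1 b2] := blkP _ (ltn_ord i).
have cb : (c <= blk i)%N.
  rewrite leqNgt; apply/negP => bc.
  have := @block_bound_mono D theta DS (blk i).+1 c; rewrite bc ct => /(_ isT).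
  by case/andP: b2 => _ b2 /leq_trans/(_ ci); rewrite leqNgt b2.
apply: (subvP (EA_chain_X_sub (a := c) (b := blk i) _)); last exact: h.
by rewrite cb ltnW.
Qed.

Lemma adapted_cols (h : 'M[C]_m) : h \in unitmx ->
  exists V : 'M[C]_m, V \is unitarymx /\ forall (j : 'I_m) c, (c <= theta)%N ->
    (j < \dim (Y c))%N -> row j V *m h \in Y c.
Proof.
move=> hu; pose e a := \dim (Y a).
have [_ _ [Y0 Yt] _ _] := hXY.
have e0 : e 0%N = 0%N by rewrite /e Y0 dimv0.
have et : e theta = m by rewrite /e Yt dim_rV_full.
have eS a : (a < theta)%N -> (e a < e a.+1)%N by exact: (EA_chain_dimY hXY).
pose blk i := block_index e theta i.
have blkP i : (i < m)%N -> (blk i < theta)%N /\ (e (blk i) <= i < e (blk i).+1)%N.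
  by rewrite -{1}et => /(block_exists e0)[a ath ia]; rewrite /blk (block_indexE eS ath ia).
have dZ r : (r < m)%N -> (r < \dim (Y (blk r).+1))%N by case/blkP => _ /andP[].
have [V [Vu VZ]] := adapted_unitary (C := C) hu dZ.
exists V; split=> // j c ct jc; have [b1 b2] := blkP _ (ltn_ord j).
have cb : ((blk j).+1 <= c)%N.
  rewrite ltnNge; apply/negP => cb.
  have := @block_bound_mono e theta eS c (blk j); rewrite cb (ltnW b1) => /(_ isT).
  by case/andP: b2 => b2 _ /(leq_trans jc)/leq_trans/(_ b2); rewrite ltnn.
apply: (subvP (EA_chain_Y_sub (a := (blk j).+1) (b := c) _)); last exact: VZ.
by rewrite cb ct.
Qed.

(** At every scaling of A, unitary frames alone produce the zero pattern of the coarse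
    DM-decomposition, and unitary frames leave the norms of the moment map unchanged. *)
Lemma adapted_scaling (g : 'M[C]_n) (h : 'M[C]_m) : g \in unitmx -> h \in unitmx ->
  exists (U : 'M[C]_n) (V : 'M[C]_m), [/\ U \is unitarymx, V \is unitarymx &
    forall l (i : 'I_n) (j : 'I_m) c, (c <= theta)%N -> (n - \dim (X c) <= i)%N ->
      (j < \dim (Y c))%N -> scal (scal A g h) U V l i j = 0].
Proof.
move=> gu hu; have [U [Uu UX]] := adapted_rows gu; have [V [Vu VY]] := adapted_cols hu.
exists U, V; split=> // l i j c ct ic jc.
have [SP _ _] := EA_chain_mem hXY ct.
have E := SP _ _ l (UX i c ct ic) (VY j c ct jc).
have -> : scal (scal A g h) U V l i j = (row i U *m g *m A l *m (row j V *m h)^t*) 0 0.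
  rewrite scal_scal /scal -!row_mul -mulmxA.
  transitivity ((row i (U *m g) *m A l *m (V *m h)^t*) 0 j).
    by rewrite -!row_mul [RHS]mxE mulmxA.
  by rewrite -row_mul !mxE; apply: eq_bigr => k _; rewrite !mxE.
by apply: etrans (congr1 (fun M : 'M[C]_1 => M 0 0) E) _; rewrite mxE.
Qed.

Lemma fr2_udiag k (U : 'M[C]_k) (a : 'rV[R]_k) : U \is unitarymx ->
  fr2 (udiag U a) = \sum_i a 0 i ^+ 2.
Proof.
move=> Uu; apply: (@rc_inj R).
rewrite -tr_mul_adj adj_udiag (udiag_mul _ _ Uu) /udiag mxtrace_mulC mulmxA (unitary_mul_adj Uu).
rewrite mul1mx rc_sum; apply: eq_bigr => i _.
by rewrite rdgE mxE expr2.
Qed.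

Lemma re_tr_le k (M K : 'M[C]_k) : K^t* = K -> 2 * re (\tr (M *m K)) <= fr2 M + fr2 K.
Proof.
move=> Ka; have -> : re (\tr (M *m K)) = \sum_i \sum_j (re (M i j) * re (K i j) + im (M i j) * im (K i j)).
  rewrite -{1}Ka re_sum; apply: eq_bigr => i _; rewrite mxE re_sum; apply: eq_bigr => j _.
  by rewrite adjE reM re_conj im_conj; ring.
rewrite /fr2 -big_split mulr_sumr /=; apply: ler_sum => i _.
rewrite -big_split mulr_sumr /=; apply: ler_sum => j _; rewrite /abs2.
have := sqr_ge0 (re (M i j) - re (K i j)); have := sqr_ge0 (im (M i j) - im (K i j)); nra.
Qed.

Variables (p q : nat -> R) (c C0 : R).
Hypotheses (p1 : partial_sum p n = 1) (q1 : partial_sum q m = 1).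
Hypothesis sqC : partial_sum (fun i => p i ^+ 2) n + partial_sum (fun j => q j ^+ 2) m = C0.
Hypothesis blk : forall i j, (i < n)%N -> (j < m)%N ->
  ~ (exists a, [/\ (a <= theta)%N, (n - \dim (X a) <= i)%N & (j < \dim (Y a))%N]) ->
  C0 <= p i + q j.

Lemma sum_sqr_centered k (f : nat -> R) : (0 < k)%N -> partial_sum f k = 1 ->
  \sum_(i < k) (f i - k%:R^-1) ^+ 2 = partial_sum (fun i => f i ^+ 2) k - k%:R^-1.
Proof.
move=> k0 f1; have kn : k%:R != 0 :> R by rewrite pnatr_eq0 -lt0n.
transitivity (\sum_(i < k) (f i ^+ 2 - 2 * k%:R^-1 * f i + k%:R^-1 ^+ 2)).
  by apply: eq_bigr => i _; ring.
rewrite !big_split /= sumrN -mulr_sumr sumr_const card_ord.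
rewrite -(big_mkord xpredT f) -(big_mkord xpredT (fun i => f i ^+ 2)) -/(partial_sum f k) f1.
rewrite -/(partial_sum _ k) -[_ *+ k]mulr_natr; by field.
Qed.

(** Test the moment map, in the adapted frame, against K = (p - 1/n, q - 1/m). Mass sits only where
    p_i + q_j >= C0, so the pairing is at least kappa = |K|^2; then 2 <mu, K> <= |mu|^2 + |K|^2
    gives the claim. *)
Lemma weak_duality (g : 'M[C]_n) (h : 'M[C]_m) : g \in unitmx -> h \in unitmx ->
  0 < nrm2 A ->
  C0 - n%:R^-1 - m%:R^-1 <= fr2 (mu1 (scal A g h)) + fr2 (mu2 (scal A g h)).
Proof.
move=> gu hu A0; set B := scal A g h.
have B0 : 0 < nrm2 B by exact: nrm2_scal_gt0.
have [U [V [Uu Vu EZ]]] := adapted_scaling gu hu.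
pose p' : 'rV[R]_n := \row_i (p i - n%:R^-1); pose q' : 'rV[R]_m := \row_j (q j - m%:R^-1).
have sp' : \sum_i p' 0 i ^+ 2 = partial_sum (fun i => p i ^+ 2) n - n%:R^-1.
  by rewrite -sum_sqr_centered //; apply: eq_bigr => i _; rewrite mxE.
have sq' : \sum_j q' 0 j ^+ 2 = partial_sum (fun j => q j ^+ 2) m - m%:R^-1.
  by rewrite -sum_sqr_centered //; apply: eq_bigr => i _; rewrite mxE.
have s0 k (f : nat -> R) : (0 < k)%N -> partial_sum f k = 1 -> \sum_(i < k) (\row_(i < k) (f i - k%:R^-1)) 0 i = 0.
  move=> k0 f1; under eq_bigr do rewrite mxE.
  rewrite sumrB sumr_const card_ord -(big_mkord xpredT f) -/(partial_sum f k) f1 -[_^-1 *+ k]mulr_natr mulVf ?subrr //.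
  by rewrite pnatr_eq0 -lt0n.
have T1 := re_tr_le (mu1 B) (adj_udiag U p'); have T2 := re_tr_le (mu2 B) (adj_udiag V q').
rewrite (re_tr_mu1 B p' Uu Vu) (fr2_udiag _ Uu) sp' s0 // in T1.
rewrite (re_tr_mu2 B q' Uu Vu) (fr2_udiag _ Vu) sq' s0 // in T2.
rewrite mul0r subr0 in T1; rewrite mul0r subr0 in T2.
suff : C0 - n%:R^-1 - m%:R^-1 <=
    (\sum_(d : 'I_N * ('I_n * 'I_m)) abs2 (scal B U V d.1 d.2.1 d.2.2) * p' 0 d.2.1) / nrm2 B +
    (\sum_(d : 'I_N * ('I_n * 'I_m)) abs2 (scal B U V d.1 d.2.1 d.2.2) * q' 0 d.2.2) / nrm2 B.
  by rewrite -sqC in T1 T2 *; lra.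
rewrite -mulrDl ler_pdivlMr // -(nrm2_scal_unitary B Uu Vu) nrm2E mulr_sumr -big_split /=.
apply: ler_sum => -[l [i j]] _ /=; rewrite -mulrDr mulrC [p' 0 i]mxE [q' 0 j]mxE.
case: (asboolP (exists a, [/\ (a <= theta)%N, (n - \dim (X a) <= i)%N & (j < \dim (Y a))%N])).
  by case=> a [h1 h2 h3]; rewrite (EZ l i j a h1 h2 h3) abs2_0 !mul0r.
move=> /(blk (ltn_ord i) (ltn_ord j)) => hC.
apply: ler_wpM2l; first exact: abs2_ge0.
by lra.
Qed.

End WeakDuality.

Lemma increasing_seq_geid (f : nat -> nat) : increasing_seq f -> forall k, (k <= f k)%N.
Proof.
move=> /increasing_seqP fS; elim=> // k IH; exact: leq_ltn_trans IH (fS k).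
Qed.

Lemma increasing_seq_cvg (f : nat -> nat) : increasing_seq f -> f k @[k --> \oo] --> \oo.
Proof.
move=> fi; apply/cvgnyPge => K; near=> k.
apply: leq_trans (increasing_seq_geid fi k); near: k; exact: nbhs_infty_ge.
Unshelve. all: by end_near. Qed.

Lemma bolzano_weierstrass_finite (R : realType) (T : finType) (u : nat -> T -> R) (K : R) :
  (forall k t, `|u k t| <= K) ->
  exists (f : nat -> nat) (l : T -> R), increasing_seq f /\
    forall t, u (f k) t @[k --> \oo] --> l t.
Proof.
move=> uK; suff [f [l [fi fl]]] : exists (f : nat -> nat) (l : T -> R), increasing_seq f /\
    forall t, t \in enum T -> u (f k) t @[k --> \oo] --> l t.
  by exists f, l; split=> // t; apply: fl; rewrite mem_enum.
elim: (enum T) => [|t s [f [l [fi fl]]]]; first by exists id, (fun=> 0).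
have [|g gi /cvg_ex[x gx]] := @bolzano_weierstrass R (fun k => u (f k) t).
  by exists K; split; [exact: num_real | move=> y Ky k _; apply: le_trans (uK _ _) (ltW Ky)].
exists (f \o g), (fun t' => if t' == t then x else l t'); split.
  by move=> a b; exact: etrans (fi _ _) (gi _ _).
move=> t'; rewrite inE; case: eqVneq => [->|_] /=; first by move=> _; exact: gx.
by move=> /fl ft'; apply: cvg_comp (increasing_seq_cvg gi) ft'.
Qed.

(** * Compactness *)

Section ComplexLimits.
Variable R : realType.
Local Notation C := (Cx R).

Definition ccvg (u : nat -> C) (z : C) :=
  (re (u k) @[k --> \oo] --> re z) /\ (im (u k) @[k --> \oo] --> im z).

Lemma ccvg_unique u z w : ccvg u z -> ccvg u w -> z = w.
Proof.
move=> [zr zi] [wr wi]; apply: Cx_eqP.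
  exact: (cvg_unique (@Rhausdorff R) zr wr).
exact: (cvg_unique (@Rhausdorff R) zi wi).
Qed.

Lemma ccvg_ext u v z : u =1 v -> ccvg u z -> ccvg v z.
Proof. by move=> /funext ->. Qed.

Lemma ccvg_cst z : ccvg (fun=> z) z.
Proof. by split; exact: cvg_cst. Qed.

Lemma ccvgM u v z w : ccvg u z -> ccvg v w -> ccvg (fun k => u k * v k) (z * w).
Proof.
move=> [zr zi] [wr wi]; split.
  under eq_fun do rewrite reM.
  by rewrite reM; apply: cvgB; apply: cvgM.
under eq_fun do rewrite imM.
by rewrite imM; apply: cvgD; apply: cvgM.
Qed.

Lemma ccvg_conj u z : ccvg u z -> ccvg (fun k => Num.conj (u k)) (Num.conj z).
Proof.
move=> [zr zi]; split.
  by under eq_fun do rewrite re_conj; rewrite re_conj.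
by under eq_fun do rewrite im_conj; rewrite im_conj; apply: cvgN.
Qed.

Lemma ccvg_sum (I : finType) (u : nat -> I -> C) (z : I -> C) :
  (forall i, ccvg (u^~ i) (z i)) -> ccvg (fun k => \sum_i u k i) (\sum_i z i).
Proof.
move=> uz; split.
  under eq_fun do rewrite re_sum.
  by rewrite re_sum; apply: cvg_big => [|i _]; [exact: add_continuous | case: (uz i)].
have im_sum (F : I -> C) : im (\sum_i F i) = \sum_i im (F i) by exact: raddf_sum.
under eq_fun do rewrite im_sum.
by rewrite im_sum; apply: cvg_big => [|i _]; [exact: add_continuous | case: (uz i)].
Qed.

Lemma ccvg_abs2 u z : ccvg u z -> abs2 (u k) @[k --> \oo] --> abs2 z.
Proof.
by move=> [zr zi]; apply: cvgD; under eq_fun do rewrite expr2; rewrite expr2; apply: cvgM.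
Qed.

Definition mcvg n m (M : nat -> 'M[C]_(n, m)) (L : 'M[C]_(n, m)) :=
  forall i j, ccvg (fun k => M k i j) (L i j).

Lemma mcvg_unique n m (M : nat -> 'M[C]_(n, m)) L L' : mcvg M L -> mcvg M L' -> L = L'.
Proof. by move=> h h'; apply/matrixP => i j; exact: ccvg_unique (h i j) (h' i j). Qed.

Lemma mcvg_cst n m (L : 'M[C]_(n, m)) : mcvg (fun=> L) L.
Proof. by move=> i j; exact: ccvg_cst. Qed.

Lemma mcvgM n m p (M : nat -> 'M[C]_(n, m)) (M' : nat -> 'M[C]_(m, p)) L L' :
  mcvg M L -> mcvg M' L' -> mcvg (fun k => M k *m M' k) (L *m L').
Proof.
move=> h h' i j; rewrite mxE.
apply: (@ccvg_ext (fun k => \sum_l M k i l * M' k l j)) => [k|]; first by rewrite mxE.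
apply: (ccvg_sum (u := fun k l => M k i l * M' k l j)) => l.
by apply: ccvgM; [exact: h | exact: h'].
Qed.

Lemma mcvg_adj n m (M : nat -> 'M[C]_(n, m)) L : mcvg M L -> mcvg (fun k => (M k)^t*) (L^t*).
Proof.
move=> h i j; rewrite adjE.
apply: (@ccvg_ext (fun k => Num.conj (M k j i))) => [k|]; first by rewrite adjE.
exact: ccvg_conj (h j i).
Qed.

Lemma mcvg_unitary n (M : nat -> 'M[C]_n) L :
  (forall k, M k \is unitarymx) -> mcvg M L -> L \is unitarymx.
Proof.
move=> Mu ML; apply/unitarymxP; apply: (mcvg_unique (mcvgM ML (mcvg_adj ML))).
move=> i j; apply: (@ccvg_ext (fun=> (1%:M : 'M[C]_n) i j)); last exact: ccvg_cst.
by move=> k; rewrite (unitary_mul_adj (Mu k)).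
Qed.

Lemma unitary_entry_le n (M : 'M[C]_n) i j : M \is unitarymx -> abs2 (M i j) <= 1.
Proof.
move=> Mu; have : \sum_k abs2 (M i k) = 1.
  apply: (@rc_inj R); rewrite rc_sum rc1.
  have := unitary_mul_adj Mu => /matrixP/(_ i i); rewrite [RHS]mxE eqxx mulr1n => <-.
  by rewrite mxE; apply: eq_bigr => k _; rewrite adjE mul_conj_abs2.
rewrite (bigD1 j) //= => <-; rewrite lerDl sumr_ge0 // => k _; exact: abs2_ge0.
Qed.

Lemma unitary_pair_subsequence n m (S : nat -> 'M[C]_n) (T : nat -> 'M[C]_m) :
  (forall k, S k \is unitarymx) -> (forall k, T k \is unitarymx) ->
  exists (f : nat -> nat) (L : 'M[C]_n) (L' : 'M[C]_m),
  [/\ increasing_seq f, L \is unitarymx, L' \is unitarymx,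
      mcvg (S \o f) L & mcvg (T \o f) L'].
Proof.
move=> Su Tu.
(* All real coordinates of both sequences share one index type, so a single extraction serves
   both. *)
pose u k (t : ('I_n * 'I_n + 'I_m * 'I_m) * bool) : R :=
  let z := match t.1 with inl d => S k d.1 d.2 | inr d => T k d.1 d.2 end in
  if t.2 then re z else im z.
have bnd (z : C) : abs2 z <= 1 -> `|re z| <= 1 /\ `|im z| <= 1.
  rewrite /abs2 => h.
  have := sqr_ge0 (re z); have := sqr_ge0 (im z) => h1 h2.
  by split; rewrite -(@ler_sqr R) ?nnegrE // real_normK ?num_real // expr1n; lra.
have [k t|f [l [fi fl]]] := @bolzano_weierstrass_finite R _ u 1.
  have zb : abs2 (match t.1 with inl d => S k d.1 d.2 | inr d => T k d.1 d.2 end) <= 1.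
    by case: t.1 => d; exact: unitary_entry_le.
  by have [h1 h2] := bnd _ zb; rewrite /u; case: t.2.
pose L : 'M[C]_n := \matrix_(i, j) (l (inl (i, j), true) +i* l (inl (i, j), false)).
pose L' : 'M[C]_m := \matrix_(i, j) (l (inr (i, j), true) +i* l (inr (i, j), false)).
have SL : mcvg (S \o f) L.
  by move=> i j; split; rewrite mxE; [exact: (fl (inl (i, j), true)) | exact: (fl (inl (i, j), false))].
have TL : mcvg (T \o f) L'.
  by move=> i j; split; rewrite mxE; [exact: (fl (inr (i, j), true)) | exact: (fl (inr (i, j), false))].
exists f, L, L'; split=> //.
- exact: (mcvg_unitary (fun k => Su (f k)) SL).
- exact: (mcvg_unitary (fun k => Tu (f k)) TL).
Qed.

Lemma mcvg_scal n m N (A : 'I_N -> 'M[C]_(n, m)) (S : nat -> 'M[C]_n) (T : nat -> 'M[C]_m) L L' l :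
  mcvg S L -> mcvg T L' -> mcvg (fun k => scal A (S k) (T k) l) (scal A L L' l).
Proof.
by move=> h h'; apply: mcvgM; [apply: mcvgM => //; exact: mcvg_cst | exact: mcvg_adj].
Qed.

End ComplexLimits.

Section RowSpans.
Variable F : fieldType.

Lemma free_rows n (g : 'M[F]_n) (P : pred 'I_n) : g \in unitmx ->
  free [seq row i g | i : 'I_n <- enum 'I_n & P i].
Proof.
move=> gu; have fullE : <<[seq row i g | i : 'I_n <- enum 'I_n]>>%VS = fullv.
  apply/vspaceP => v; rewrite memvf -(mulmxKV gu v) mulmx_sum_row.
  by apply: memv_suml => i _; apply/memvZ/memv_span/map_f; rewrite mem_enum.
have fr : free [seq row i g | i : 'I_n <- enum 'I_n].
  by rewrite /free fullE dimvf /dim /= mul1n size_map size_enum_ord.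
have /perm_free E : perm_eq ([seq row i g | i <- [seq i <- enum 'I_n | P i]] ++
    [seq row i g | i <- [seq i <- enum 'I_n | predC P i]]) [seq row i g | i : 'I_n <- enum 'I_n].
  by rewrite -map_cat perm_map // perm_filterC.
by rewrite -E in fr; exact: catl_free fr.
Qed.

Lemma dim_span_rows n (g : 'M[F]_n) (P : pred 'I_n) : g \in unitmx ->
  \dim <<[seq row i g | i : 'I_n <- enum 'I_n & P i]>> = #|P|.
Proof.
move=> gu; have /eqP -> := free_rows P gu.
by rewrite size_map cardE /enum_mem size_filter size_filter count_filter; apply: eq_count => i; rewrite /= andbT.
Qed.

Lemma card_first n d : (d <= n)%N -> #|[pred i : 'I_n | (i < d)%N]| = d.
Proof. by move=> dn; rewrite -sum1_card (big_ord_narrow dn) sum1_card card_ord. Qed.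

Lemma card_last n d : (d <= n)%N -> #|[pred i : 'I_n | (n - d <= i)%N]| = d.
Proof.
move=> dn; have := cardC [pred i : 'I_n | (i < n - d)%N]; rewrite card_ord card_first ?leq_subr //.
rewrite (eq_card (B := [pred i : 'I_n | (n - d <= i)%N])) => [|i]; last by rewrite !inE -leqNgt.
by rewrite -[X in _ = X](subnK dn) => /addnI.
Qed.

End RowSpans.

Lemma span_rows_mulmx_eq0 (F : fieldType) n k (g : 'M[F]_n) (P : pred 'I_n) (M : 'M[F]_(n, k)) u :
  u \in <<[seq row i g | i : 'I_n <- enum 'I_n & P i]>>%VS ->
  (forall i, P i -> row i g *m M = 0) -> u *m M = 0.
Proof.
move=> uS SM; pose f := linfun (mulmxr M) : 'Hom('rV[F]_n, 'rV[F]_k).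
have /subvP/(_ _ uS) : (<<[seq row i g | i : 'I_n <- enum 'I_n & P i]>> <= lker f)%VS.
  rewrite span_def big_map big_filter; apply: (big_ind (fun K => (K <= lker f)%VS)).
  - exact: sub0v.
  - by move=> K K' hK hK'; rewrite subv_add hK.
  - by move=> i Pi; rewrite -memvE memv_ker lfunE /= SM.
by rewrite memv_ker lfunE => /eqP.
Qed.

Section ZeroBlocks.
Variables (R : realType) (n m N : nat) (A : 'I_N -> 'M[Cx R]_(n, m)).
Local Notation C := (Cx R).

Lemma SA_span_rows (s : 'M[C]_n) (t : 'M[C]_m) (P : pred 'I_n) (Q : pred 'I_m) :
  (forall l i j, P i -> Q j -> scal A s t l i j = 0) ->
  SA A (<<[seq row i s | i : 'I_n <- enum 'I_n & P i]>>%VS,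
        <<[seq row j t | j : 'I_m <- enum 'I_m & Q j]>>%VS).
Proof.
move=> z u v l /= us vt.
have E : u *m (A l *m (v : 'rV[C]_m)^t*) = 0.
  apply: (span_rows_mulmx_eq0 us) => i Pi.
  have F : (v : 'rV[C]_m) *m ((A l)^t* *m (row i s)^t*) = 0.
    apply: (span_rows_mulmx_eq0 vt) => j Qj.
    have Z : row i s *m A l *m (row j t)^t* = 0.
      apply/matrixP => a b; rewrite (ord1 a) (ord1 b) [RHS]mxE -(z l i j Pi Qj) -row_mul.
      by rewrite /scal !mxE; apply: eq_bigr => k _; rewrite !mxE.
    have -> : row j t *m ((A l)^t* *m (row i s)^t*) = (row i s *m A l *m (row j t)^t*)^t*.
      by rewrite !adjM adjK.
    by rewrite Z trmx0 map_mx0.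
  rewrite -[LHS]adjK.
  have -> : (row i s *m (A l *m (v : 'rV[C]_m)^t*))^t* = (v : 'rV[C]_m) *m ((A l)^t* *m (row i s)^t*).
    by rewrite !adjM adjK mulmxA.
  by rewrite F trmx0 map_mx0.
by rewrite -mulmxA; exact: E.
Qed.

(** Otherwise there are unitary frames whose entries in this block tend to 0; a limit of them has an
    exactly zero block, and its rows span a pair of S_A with the excluded dimensions. *)
Lemma nonzero_block (r s : nat) : (r <= n)%N -> (s <= m)%N ->
  (forall P, SA A P -> (\dim P.1, \dim P.2) <> (r, s)) ->
  exists2 eps : R, 0 < eps & forall (S : 'M[C]_n) (T : 'M[C]_m),
    S \is unitarymx -> T \is unitarymx ->
    exists l (i : 'I_n) (j : 'I_m), [/\ (n - r <= i)%N, (j < s)%N & eps <= abs2 (scal A S T l i j)].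
Proof.
move=> rn sm noSA; apply: contrapT => h.
have {h} bad k : exists ST : 'M[C]_n * 'M[C]_m, [/\ ST.1 \is unitarymx, ST.2 \is unitarymx &
    forall l (i : 'I_n) (j : 'I_m), (n - r <= i)%N -> (j < s)%N ->
      abs2 (scal A ST.1 ST.2 l i j) <= k.+1%:R^-1].
  apply: contrapT => h'; apply: h; exists k.+1%:R^-1; first by rewrite invr_gt0 ltr0n.
  move=> S T Su Tu; apply: contrapT => h; apply: h'; exists (S, T); split=> // l i j ri js.
  by rewrite leNgt; apply/negP => lt; apply: h; exists l, i, j; split=> //; exact: ltW.
have [ST STP] := choice bad.
have [f [L [L' [fi Lu L'u SL TL]]]] := @unitary_pair_subsequence R n m (fun k => (ST k).1) (fun k => (ST k).2)
  (fun k => let: And3 h _ _ := STP k in h) (fun k => let: And3 _ h _ := STP k in h).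
have zero l (i : 'I_n) (j : 'I_m) : (n - r <= i)%N -> (j < s)%N -> scal A L L' l i j = 0.
  move=> ri js; apply: abs2_eq0.
  have cv := ccvg_abs2 (mcvg_scal A l SL TL i j).
  apply/eqP; rewrite eq_le abs2_ge0 andbT.
  have c0 : (f k).+1%:R^-1 @[k --> \oo] --> (0 : R).
    exact: (cvg_comp _ _ (increasing_seq_cvg fi) (@cvg_harmonic R)).
  apply: (ler_cvg_to cv c0); near=> k.
  by case: (STP (f k)) => _ _; apply.
apply: (noSA _ (SA_span_rows (P := fun i => (n - r <= i)%N) (Q := fun j => (j < s)%N) zero)) => /=.
congr (_, _).
  apply: etrans (dim_span_rows _ (unitarymx_unit Lu)) _; exact: card_last.
apply: etrans (dim_span_rows _ (unitarymx_unit L'u)) _; exact: card_first.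
Unshelve. all: by end_near. Qed.

End ZeroBlocks.

Lemma finite_uniform_pos (R : realFieldType) (I : finType) (P : I -> R -> Prop) :
  (forall i, exists2 e, 0 < e & P i e) ->
  (forall i e e', 0 < e' -> e' <= e -> P i e -> P i e') ->
  exists2 e, 0 < e & forall i, P i e.
Proof.
move=> Pe Pd; suff [e e0 h] : exists2 e, 0 < e & forall i, i \in enum I -> P i e.
  by exists e => // i; apply: h; rewrite mem_enum.
elim: (enum I) => [|i s [e e0 h]]; first by exists 1.
have [e' e'0 h'] := Pe i.
have m0 : 0 < Num.min e e' by rewrite lt_min e0.
exists (Num.min e e') => // j; rewrite inE => /predU1P[->|js].
  by apply: Pd h' => //; rewrite ge_min lexx orbT.
by apply: Pd (h j js) => //; rewrite ge_min lexx.
Qed.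

(** * Lower bound on the Kempf-Ness function *)

Section LowerBound.
Variables (R : realType) (n m N : nat) (A : 'I_N -> 'M[Cx R]_(n, m)).
Local Notation C := (Cx R).
Variables (p q : nat -> R).
Hypotheses (p0 : forall i, 0 < p i) (q0 : forall j, 0 < q j).
Hypotheses (p1 : partial_sum p n = 1) (q1 : partial_sum q m = 1).
Hypothesis SApq : forall P, SA A P -> partial_sum q (\dim P.2) <= partial_sum p (n - \dim P.1).

(** If P i < Q j.+1, then no pair of S_A has dimensions (n - i, j + 1), so in every unitary frame
    some entry weakly below and to the left of (i, j) has squared modulus at least a fixed e. By the
    order of a and b its exponential weight is at least that of (i, j). So a_i + b_j is bounded
    wherever the coupling of p and q has mass. *)
Lemma kempf_ness_lower_bound :
  exists c : R, forall (S : 'M[C]_n) (T : 'M[C]_m) (a : 'rV[R]_n) (b : 'rV[R]_m),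
    S \is unitarymx -> T \is unitarymx -> nondecreasing_row a -> nonincreasing_row b ->
    \sum_(i < n) p i * a 0 i + \sum_(j < m) q j * b 0 j <=
    ln (\sum_(d : 'I_N * ('I_n * 'I_m)) abs2 (scal A S T d.1 d.2.1 d.2.2) *
         expR (1 * (a 0 d.2.1 + b 0 d.2.2))) - c.
Proof.
pose good (d : 'I_n * 'I_m) (e : R) := partial_sum p d.1 < partial_sum q d.2.+1 ->
  forall (S : 'M[C]_n) (T : 'M[C]_m), S \is unitarymx -> T \is unitarymx ->
  exists l (i : 'I_n) (j : 'I_m), [/\ (d.1 <= i)%N, (j <= d.2)%N & e <= abs2 (scal A S T l i j)].
have [[i j]|d e e' e'0 ee' h pq S T Su Tu|e e0 he] := @finite_uniform_pos R _ good.
- case: (ltP (partial_sum p i) (partial_sum q j.+1)) => [lt|ge]; last first.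
    by exists 1 => //; rewrite /good /= ltNge ge.
  have [||P SP dP|e e0 he] := @nonzero_block R n m N A (n - i) j.+1.
  + exact: leq_subr.
  + exact: ltn_ord.
  + have := SApq SP; case: dP => -> ->; rewrite subKn; last exact: ltnW.
    by rewrite leNgt lt.
  exists e => // _ S T Su Tu; have [l [i' [j' [h1 h2 h3]]]] := he S T Su Tu.
  by exists l, i', j'; split=> //; move: h1; rewrite subKn // ltnW.
- by have [l [i [j [h1 h2 h3]]]] := h pq S T Su Tu; exists l, i, j; split=> //; exact: le_trans h3.
exists (ln e) => S T a b Su Tu am bm.
apply: (coupling_le (p := p) (q := q)) => // [i|j|i j pq]; try exact: ltW.
have [l [i' [j' [/= h1 h2 h3]]]] := he (i, j) pq S T Su Tu.
rewrite -[a 0 i + b 0 j](expRK) lerBrDr -lnM ?posrE ?expR_gt0 //.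
have lo : expR (a 0 i + b 0 j) * e <= \sum_(d : 'I_N * ('I_n * 'I_m)) abs2 (scal A S T d.1 d.2.1 d.2.2) *
         expR (1 * (a 0 d.2.1 + b 0 d.2.2)).
  rewrite (bigD1 (l, (i', j'))) //= mul1r.
  apply: le_trans (_ : abs2 (scal A S T l i' j') * expR (a 0 i' + b 0 j') <= _).
    rewrite mulrC; apply: ler_pM; rewrite ?expR_ge0 ?(ltW e0) //.
    by rewrite ler_expR lerD ?am ?bm.
  by rewrite lerDl sumr_ge0 // => d _; rewrite mulr_ge0 ?abs2_ge0 ?expR_ge0.
by rewrite ler_ln ?posrE ?mulr_gt0 ?expR_gt0 // (lt_le_trans _ lo) // mulr_gt0 ?expR_gt0.
Qed.

End LowerBound.

(** * Energy, gradient and spectra across one step *)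

Section StepFacts.
Variables (R : realType) (n m N : nat) (A : 'I_N -> 'M[Cx R]_(n, m)).
Local Notation C := (Cx R).
Hypotheses (n0 : (0 < n)%N) (m0 : (0 < m)%N) (A0 : 0 < nrm2 A).

(** The squared norm of the gradient at (g^* g, h^* h). It does not depend on the chosen factors,
    which differ by unitaries. *)
Definition grad_sqr (g : 'M[C]_n) (h : 'M[C]_m) : R :=
  fr2 (mu1 (scal A g h)) + fr2 (mu2 (scal A g h)).

Lemma fr2_unitary k (w M : 'M[C]_k) : w \is unitarymx -> fr2 (w *m M *m w^t*) = fr2 M.
Proof.
move=> wu; apply: (@rc_inj R); rewrite -!tr_mul_adj !adjM adjK.
transitivity (\tr (w *m (M *m (w^t* *m w) *m M^t*) *m w^t*)); first by rewrite !mulmxA.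
by rewrite (unitary_adj_mul wu) mulmx1 mxtrace_mulC [w^t* *m _]mulmxA (unitary_adj_mul wu) mul1mx.
Qed.

Lemma unitary_ratio k (g g' : 'M[C]_k) : g \in unitmx -> g^t* *m g = g'^t* *m g' ->
  exists2 w, w \is unitarymx & g' = w *m g.
Proof.
move=> gu gg; exists (g' *m invmx g); last by rewrite (mulmxKV gu).
have wu : (g' *m invmx g)^t* *m (g' *m invmx g) = 1%:M.
  rewrite adjM (adj_inv gu); have gu' : g^t* \in unitmx by rewrite unitmx_adj.
  transitivity (invmx (g^t*) *m (g'^t* *m g') *m invmx g); first by rewrite !mulmxA.
  by rewrite -gg mulmxA (mulVmx gu') mul1mx (mulmxV gu).
by apply/unitarymxP; rewrite (mulmx1C wu).
Qed.

Lemma grad_sqr_factor (g g' : 'M[C]_n) (h h' : 'M[C]_m) :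
  g \in unitmx -> h \in unitmx -> g^t* *m g = g'^t* *m g' -> h^t* *m h = h'^t* *m h' ->
  grad_sqr g' h' = grad_sqr g h.
Proof.
move=> gu hu /(unitary_ratio gu)[w wu ->] /(unitary_ratio hu)[z zu ->].
rewrite /grad_sqr -scal_scal -(mu1_conj _ wu zu) -(mu2_conj _ wu zu).
by rewrite (fr2_unitary _ wu) (fr2_unitary _ zu).
Qed.

Lemma fr2_rdg k (a : 'rV[R]_k) : fr2 (rdg a) = \sum_i a 0 i ^+ 2.
Proof.
apply: (@rc_inj R); rewrite -tr_mul_adj adj_rdg rdg_mul rc_sum.
by apply: eq_bigr => i _; rewrite rdgE mxE expr2.
Qed.

(** The row side is sorted increasingly, so the majorization is transferred by reversing the
    indices. *)
Lemma log_inner_le_rev k (s s' g : 'M[C]_k) (a a' u c : 'rV[R]_k) :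
  s \is unitarymx -> s' \is unitarymx ->
  g^t* *m g = udiag s (map_mx expR a) -> udiag g (map_mx expR u) = udiag s' (map_mx expR a') ->
  nondecreasing_row a -> nondecreasing_row u -> nondecreasing_row c ->
  \sum_i c 0 i * a' 0 i <= \sum_i c 0 i * a 0 i + \sum_i c 0 i * u 0 i.
Proof.
move=> su su' E E' am um cm; pose r := perm (@rev_ord_inj k).
pose R' (b : 'rV[R]_k) : 'rV[R]_k := \row_i b 0 (r i).
have mono b : nondecreasing_row b -> nonincreasing_row (R' b).
  by move=> bm i j ij; rewrite !mxE !permE bm //= leq_sub2l.
have mapR b : map_mx expR (R' b) = \row_i (map_mx expR b) 0 (r i) by apply/rowP => i; rewrite !mxE.
have := @log_inner_le R k (row_perm r s) (row_perm r s') (row_perm r g) (R' a) (R' a') (R' u)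
  (unitary_row_perm r su) (unitary_row_perm r su') _ _ (mono _ am) (mono _ um) (R' c) (mono _ cm).
have sumR (b d : 'rV[R]_k) : \sum_i R' b 0 i * R' d 0 i = \sum_i b 0 i * d 0 i.
  by rewrite [RHS](reindex_inj (@perm_inj _ r)) /=; apply: eq_bigr => i _; rewrite !mxE.
rewrite !sumR; apply; first by rewrite adj_mul_perm E mapR udiag_perm.
by rewrite !mapR !udiag_perm.
Qed.

Lemma nondecreasing_scale k (a : 'rV[R]_k) (t : R) : 0 <= t -> nondecreasing_row a ->
  nondecreasing_row (t *: a).
Proof. by move=> t0 am i j ij; rewrite !mxE ler_wpM2l ?am. Qed.

Lemma gradient_step_facts (S S' : 'M[C]_n) (T T' : 'M[C]_m) (a a' : 'rV[R]_n) (b b' : 'rV[R]_m) :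
  let x := udiag S (map_mx expR a) in let y := udiag T (map_mx expR b) in
  let x' := udiag S' (map_mx expR a') in let y' := udiag T' (map_mx expR b') in
  [/\ S \is unitarymx, T \is unitarymx, S' \is unitarymx & T' \is unitarymx] ->
  nondecreasing_row a -> nonincreasing_row b ->
  x' = riem_exp x (- 2^-1 *: (riem_grad A x y).1) ->
  y' = riem_exp y (- 2^-1 *: (riem_grad A x y).2) ->
  exists (g g' : 'M[C]_n) (h h' : 'M[C]_m) (u : 'rV[R]_n) (v : 'rV[R]_m),
  [/\ [/\ g \in unitmx, h \in unitmx, x = g^t* *m g & y = h^t* *m h],
      [/\ g' \in unitmx, h' \in unitmx, x' = g'^t* *m g' & y' = h'^t* *m h'],
      kempf_ness A x' y' <= kempf_ness A x y - grad_sqr g' h' / 2,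
      grad_sqr g h = \sum_i u 0 i ^+ 2 + \sum_j v 0 j ^+ 2 &
      [/\ \sum_i a' 0 i = \sum_i a 0 i, \sum_j b' 0 j = \sum_j b 0 j &
      forall c d, nondecreasing_row c -> nonincreasing_row d ->
      \sum_i c 0 i * a' 0 i + \sum_j d 0 j * b' 0 j <=
      \sum_i c 0 i * a 0 i + \sum_j d 0 j * b 0 j +
       2^-1 * (\sum_i c 0 i * u 0 i + \sum_j d 0 j * v 0 j)]].
Proof.
move=> x y x' y' [Su Tu S'u T'u] am bm xE' yE'.
have [g [h [u [v [[gu hu xE yE] uE vE [xS yS] [um vm]]]]]] := gradient_step n0 m0 A0 a b Su Tu.
rewrite -/x -/y in xE yE xS yS.
have half (k : nat) (w : 'rV[R]_k) (f : 'M[C]_k) :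
    (rdg (map_mx expR (4^-1 *: w)) *m f)^t* *m (rdg (map_mx expR (4^-1 *: w)) *m f) =
    f^t* *m rdg (map_mx expR (2^-1 *: w)) *m f.
  rewrite adjM adj_rdg; transitivity (f^t* *m (rdg (map_mx expR (4^-1 *: w)) *m
    rdg (map_mx expR (4^-1 *: w))) *m f); first by rewrite !mulmxA.
  rewrite expR_rdg_mul; suff -> : 4^-1 *: w + 4^-1 *: w = 2^-1 *: w by [].
  by apply/rowP => i; rewrite !mxE; field.
have eu k (w : 'rV[R]_k) : rdg (map_mx expR w) \in unitmx :> bool.
  have := expR_rdg_mul w (- w); rewrite subrr expR_rdg0 => E.
  exact: (mulmx1_unit E).1.
(* The new point g^* exp(u/2) g has exp(u/4) g as a factor. *)
exists g, (rdg (map_mx expR (4^-1 *: u)) *m g), h, (rdg (map_mx expR (4^-1 *: v)) *m h), u, v.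
have xE2 : x' = (rdg (map_mx expR (4^-1 *: u)) *m g)^t* *m (rdg (map_mx expR (4^-1 *: u)) *m g).
  by rewrite half xE' xS.
have yE2 : y' = (rdg (map_mx expR (4^-1 *: v)) *m h)^t* *m (rdg (map_mx expR (4^-1 *: v)) *m h).
  by rewrite half yE' yS.
have B0 : 0 < nrm2 (scal A g h) by exact: nrm2_scal_gt0.
have ux : udiag g (map_mx expR (2^-1 *: u)) = udiag S' (map_mx expR a').
  by rewrite -/x' xE' xS.
have uy : udiag h (map_mx expR (2^-1 *: v)) = udiag T' (map_mx expR b').
  by rewrite -/y' yE' yS.
have vm' : nonincreasing_row v.
  by move=> i j ij; have := vm i j ij; rewrite !mxE lerN2.
have su0 : \sum_i u 0 i = 0.
  apply: oppr_inj; rewrite oppr0 -sumrN; apply: (@rc_inj R); rewrite rc0 -(tr_mu1 n0 B0) uE rc_sum.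
  by apply: eq_bigr => i _; rewrite rdgE mxE.
have sv0 : \sum_j v 0 j = 0.
  apply: oppr_inj; rewrite oppr0 -sumrN; apply: (@rc_inj R); rewrite rc0 -(tr_mu2 m0 B0) vE rc_sum.
  by apply: eq_bigr => i _; rewrite rdgE mxE.
have sum_half k (w : 'rV[R]_k) : \sum_i w 0 i = 0 -> \sum_i (2^-1 *: w) 0 i = 0.
  by move=> w0; under eq_bigr do rewrite mxE; rewrite -mulr_sumr w0 mulr0.
have scal_sum k (w c : 'rV[R]_k) : \sum_i c 0 i * (2^-1 *: w) 0 i = 2^-1 * \sum_i c 0 i * w 0 i.
  by rewrite mulr_sumr; apply: eq_bigr => i _; rewrite mxE; ring.
split.
- by split.
- by split=> //; rewrite unitmx_mul eu.
- rewrite xE2 yE2 xE yE !kempf_nessE.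
  have := descent n0 m0 B0 uE vE erefl.
  by rewrite scal_scal.
- rewrite /grad_sqr uE vE !fr2_rdg; congr (_ + _);
    by apply: eq_bigr => i _; rewrite mxE sqrrN.
- split.
  + by rewrite (log_sum_eq Su S'u (esym xE) ux) (sum_half _ _ su0) addr0.
  + by rewrite (log_sum_eq Tu T'u (esym yE) uy) (sum_half _ _ sv0) addr0.
  move=> c d cm dm.
  have half0 : (0 : R) <= 2^-1 by rewrite invr_ge0.
  have h1 := log_inner_le_rev Su S'u (esym xE) ux am (nondecreasing_scale half0 um) cm.
  have vm2 : nonincreasing_row (2^-1 *: v) by move=> i j ij; rewrite !mxE ler_wpM2l ?vm'.
  have h2 := log_inner_le Tu T'u (esym yE) uy bm vm2 dm.
  rewrite !scal_sum in h1 h2; lra.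
Qed.

End StepFacts.

(** * Asymptotic velocity and exponential decay *)

Section Descent.
Variables (R : realType) (n m N : nat) (A : 'I_N -> 'M[Cx R]_(n, m)).
Local Notation C := (Cx R).

Lemma kempf_ness_udiag (S : 'M[C]_n) (T : 'M[C]_m) (a : 'rV[R]_n) (b : 'rV[R]_m) :
  kempf_ness A (udiag S (map_mx expR a)) (udiag T (map_mx expR b)) =
  ln (\sum_(d : 'I_N * ('I_n * 'I_m)) abs2 (scal A S T d.1 d.2.1 d.2.2) *
         expR (1 * (a 0 d.2.1 + b 0 d.2.2))).
Proof.
have E k (s : 'M[C]_k) (w : 'rV[R]_k) : udiag s (map_mx expR w) =
    (rdg (map_mx expR ((1 / 2) *: w)) *m s)^t* *m (rdg (map_mx expR ((1 / 2) *: w)) *m s).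
  have := adj_exp_mul s 1%:M w; rewrite !mulmx1 adj1 mul1mx => -> //.
by rewrite (E n) (E m) kempf_nessE -scal_scal nrm2_scal_exp.
Qed.

Variables (theta : nat) (X : nat -> {vspace 'rV[R[i]]_n}) (Y : nat -> {vspace 'rV[R[i]]_m}).
Hypotheses (n0 : (0 < n)%N) (m0 : (0 < m)%N) (A0 : 0 < nrm2 A) (hXY : EA_chain A theta X Y).

Definition in_zero_block (i j : nat) :=
  exists a, [/\ (a <= theta)%N, (n - \dim (X a) <= i)%N & (j < \dim (Y a))%N].

Variables (S : nat -> 'M[C]_n) (T : nat -> 'M[C]_m) (al : nat -> 'rV[R]_n) (be : nat -> 'rV[R]_m).
Hypotheses (Su : forall k, S k \is unitarymx) (Tu : forall k, T k \is unitarymx).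
Hypotheses (alm : forall k, nondecreasing_row (al k)) (bem : forall k, nonincreasing_row (be k)).
Hypotheses (al0 : al 0%N = 0) (be0 : be 0%N = 0).
Let x k := udiag (S k) (map_mx expR (al k)).
Let y k := udiag (T k) (map_mx expR (be k)).
Hypotheses (xS : forall k, x k.+1 = riem_exp (x k) (- 2^-1 *: (riem_grad A (x k) (y k)).1))
  (yS : forall k, y k.+1 = riem_exp (y k) (- 2^-1 *: (riem_grad A (x k) (y k)).2)).
Let F k := kempf_ness A (x k) (y k).

Lemma descent_sequence (kap : R) :
  (forall (g : 'M[C]_n) (h : 'M[C]_m), g \in unitmx -> h \in unitmx -> kap <= grad_sqr A g h) ->
  exists (s2 : nat -> R) (u : nat -> 'rV[R]_n) (v : nat -> 'rV[R]_m),
  [/\ forall k, F k.+1 <= F k - s2 k.+1 / 2,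
      forall k, s2 k = \sum_i u k 0 i ^+ 2 + \sum_j v k 0 j ^+ 2,
      forall k, kap <= s2 k,
      forall k, \sum_i al k 0 i = 0 /\ \sum_j be k 0 j = 0 &
      forall k c d, nondecreasing_row c -> nonincreasing_row d ->
      \sum_i c 0 i * al k 0 i + \sum_j d 0 j * be k 0 j <=
       2^-1 * \sum_(l < k) (\sum_i c 0 i * u l 0 i + \sum_j d 0 j * v l 0 j)].
Proof.
move=> kapP.
have facts k := gradient_step_facts n0 m0 A0 (And4 (Su k) (Tu k) (Su k.+1) (Tu k.+1))
  (alm k) (bem k) (xS k) (yS k).
have /choice[D HD] : forall k, exists d : ('M[C]_n * 'M[C]_n) * ('M[C]_m * 'M[C]_m) * ('rV[R]_n * 'rV[R]_m),
    [/\ [/\ d.1.1.1 \in unitmx, d.1.2.1 \in unitmx, x k = (d.1.1.1)^t* *m d.1.1.1 & y k = (d.1.2.1)^t* *m d.1.2.1],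
      [/\ d.1.1.2 \in unitmx, d.1.2.2 \in unitmx, x k.+1 = (d.1.1.2)^t* *m d.1.1.2 & y k.+1 = (d.1.2.2)^t* *m d.1.2.2],
      F k.+1 <= F k - grad_sqr A d.1.1.2 d.1.2.2 / 2,
      grad_sqr A d.1.1.1 d.1.2.1 = \sum_i d.2.1 0 i ^+ 2 + \sum_j d.2.2 0 j ^+ 2 &
      [/\ \sum_i al k.+1 0 i = \sum_i al k 0 i, \sum_j be k.+1 0 j = \sum_j be k 0 j &
      forall c e, nondecreasing_row c -> nonincreasing_row e ->
      \sum_i c 0 i * al k.+1 0 i + \sum_j e 0 j * be k.+1 0 j <=
      \sum_i c 0 i * al k 0 i + \sum_j e 0 j * be k 0 j +
       2^-1 * (\sum_i c 0 i * d.2.1 0 i + \sum_j e 0 j * d.2.2 0 j)]].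
  move=> k; have [g [g' [h [h' [u [v H]]]]]] := facts k.
  by exists (((g, g'), (h, h')), (u, v)); exact: H.
exists (fun k => grad_sqr A (D k).1.1.1 (D k).1.2.1), (fun k => (D k).2.1), (fun k => (D k).2.2).
split.
- move=> k; have [_ [_ _ xE yE] FS _ _] := HD k; have [[gu hu xE' yE'] _ _ _ _] := HD k.+1.
  (* The step from k measures the gradient at its end point in its own factor; the next step has
     another factor of the same point. *)
  apply: le_trans FS _; rewrite (@grad_sqr_factor _ _ _ _ A _ (D k).1.1.2 _ (D k).1.2.2 gu hu) //.
    by rewrite -xE' xE.
  by rewrite -yE' yE.
- by move=> k; case: (HD k).
- by move=> k; case: (HD k) => -[gu hu _ _] _ _ _ _; exact: kapP.
- elim=> [|k [IH1 IH2]].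
    by rewrite al0 be0; split; rewrite big1 // => i _; rewrite mxE.
  by have [_ _ _ _ [-> -> _]] := HD k.
elim=> [|k IH] c d cm dm.
  rewrite al0 be0 big_ord0 mulr0 !big1 ?addr0 // => i _; by rewrite mxE mulr0.
have [_ _ _ _ [_ _ h]] := HD k.
apply: le_trans (h c d cm dm) _.
by rewrite big_ord_recr /= [leRHS]mulrDr lerD2r; exact: IH.
Qed.

Variables (p q : nat -> R) (C0 c : R).
Hypotheses (p0 : forall i, 0 < p i) (q0 : forall j, 0 < q j).
Hypotheses (p1 : partial_sum p n = 1) (q1 : partial_sum q m = 1).
Hypothesis sqC : partial_sum (fun i => p i ^+ 2) n + partial_sum (fun j => q j ^+ 2) m = C0.
Hypothesis SApq : forall P, SA A P -> partial_sum q (\dim P.2) <= partial_sum p (n - \dim P.1).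
Hypothesis c0 : 0 < c.
Hypothesis zero_blk : forall i j, (i < n)%N -> (j < m)%N -> in_zero_block i j -> p i + q j <= C0 - c.
Hypothesis nonzero_blk : forall i j, (i < n)%N -> (j < m)%N -> ~ in_zero_block i j -> C0 <= p i + q j.

Let kap := C0 - n%:R^-1 - m%:R^-1.
Let xi (i : 'I_n) : R := n%:R^-1 - p i.
Let eta (j : 'I_m) : R := m%:R^-1 - q j.

Let sqr_xi : \sum_i xi i ^+ 2 + \sum_j eta j ^+ 2 = kap.
Proof.
rewrite /kap -sqC (eq_bigr (fun i : 'I_n => (p i - n%:R^-1) ^+ 2)) => [|i _]; last by rewrite /xi -sqrrN opprB.
rewrite (eq_bigr (fun j : 'I_m => (q j - m%:R^-1) ^+ 2)) => [|j _]; last by rewrite /eta -sqrrN opprB.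
rewrite !sum_sqr_centered //; ring.
Qed.

(** [Sm k] is the sum of the first k squared gradients. In the expansion of the squared deviation
    the terms k [Sm k]/4 and -k [Sm k]/2 combine to -k [Sm k]/4, which cancels k^2 kap / 4. *)
Lemma deviation_bound : exists K0 : R, forall k, (0 < k)%N ->
  F k <= K0 - k%:R * kap / 2 /\
  \sum_i (al k 0 i - k%:R / 2 * xi i) ^+ 2 + \sum_j (be k 0 j - k%:R / 2 * eta j) ^+ 2 <= k%:R * K0.
Proof.
have kapP (g : 'M[C]_n) (h : 'M[C]_m) : g \in unitmx -> h \in unitmx -> kap <= grad_sqr A g h.
  by move=> gu hu; exact: (weak_duality n0 m0 hXY p1 q1 sqC nonzero_blk gu hu A0).
have [s2 [u [v [FS s2E s2k sum0 inner]]]] := descent_sequence kapP.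
have [c1 low] := kempf_ness_lower_bound p0 q0 p1 q1 SApq.
have lowF k : \sum_(i < n) p i * al k 0 i + \sum_(j < m) q j * be k 0 j <= F k - c1.
  by have := low _ _ _ _ (Su k) (Tu k) (alm k) (bem k); rewrite -kempf_ness_udiag.
move: FS lowF {low}; generalize F => G FS lowF.
pose Sm k := \sum_(l < k) s2 l.
have s20 k : 0 <= s2 k by rewrite s2E addr_ge0 // sumr_ge0 // => i _; exact: sqr_ge0.
have Gk k : G k <= G 0%N - (Sm k.+1 - s2 0%N) / 2.
  elim: k => [|k IH]; first by rewrite /Sm big_ord1; lra.
  by apply: le_trans (FS k) _; rewrite /Sm big_ord_recr /= -/(Sm k.+1); lra.
have Sk k : k%:R * kap <= Sm k.
  rewrite mulr_natl -[X in _ *+ X]card_ord -sumr_const; exact: ler_sum.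
exists (`|G 0%N| + s2 0%N + `|G 0%N + s2 0%N / 2 - c1|) => k k0.
have kR : 0 < k%:R :> R by rewrite ltr0n.
split.
  apply: le_trans (Gk k) _.
  have : (k%:R + 1) * kap <= Sm k.+1 by rewrite natr1 Sk.
  have SkS : k%:R * kap <= Sm k.+1 - s2 0%N.
    rewrite /Sm big_ord_recl /= addrC addKr mulr_natl -[X in _ *+ X]card_ord -sumr_const.
    by apply: ler_sum => i _; exact: s2k.
  have := ler_norm (G 0%N); have := normr_ge0 (G 0%N + s2 0%N / 2 - c1); have := s20 0%N; lra.
set W := \sum_i al k 0 i ^+ 2 + \sum_j be k 0 j ^+ 2.
have WS : W <= k%:R / 4 * Sm k.
  (* The growth estimate is tested against the logarithmic spectra themselves, which bounds their
     own squared norm. *)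
  have := inner k _ _ (alm k) (bem k).
  rewrite -(eq_bigr _ (fun i _ => expr2 (al k 0 i))) -(eq_bigr _ (fun j _ => expr2 (be k 0 j))) -/W.
  have young (a b : R) : a * b <= k%:R^-1 * a ^+ 2 + k%:R / 4 * b ^+ 2.
    have -> : k%:R^-1 * a ^+ 2 + k%:R / 4 * b ^+ 2 = a * b + k%:R^-1 * (a - k%:R / 2 * b) ^+ 2.
      by field; rewrite gt_eqF.
    by rewrite lerDl mulr_ge0 ?sqr_ge0 // invr_ge0 ltW.
  have term (l : 'I_k) : \sum_i al k 0 i * u l 0 i + \sum_j be k 0 j * v l 0 j <=
      k%:R^-1 * W + k%:R / 4 * s2 l.
    rewrite s2E /W !mulrDr addrACA !mulr_sumr -!big_split /=.
    by apply: lerD; apply: ler_sum => i _; exact: young.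
  have : \sum_(l < k) (\sum_i al k 0 i * u l 0 i + \sum_j be k 0 j * v l 0 j) <= W + k%:R / 4 * Sm k.
    apply: le_trans (ler_sum _ (fun l _ => term l)) _.
    rewrite big_split /= sumr_const card_ord -mulr_sumr -/(Sm k) -[_ *+ k]mulr_natl mulrA.
    by rewrite mulfV ?gt_eqF // mul1r.
  lra.
have [sa sb] := sum0 k.
have lowk := lowF k.
have xiE : \sum_i xi i * al k 0 i + \sum_j eta j * be k 0 j =
    - (\sum_(i < n) p i * al k 0 i + \sum_(j < m) q j * be k 0 j).
  transitivity (n%:R^-1 * \sum_i al k 0 i - \sum_(i < n) p i * al k 0 i +
    (m%:R^-1 * \sum_j be k 0 j - \sum_(j < m) q j * be k 0 j)).
    rewrite !mulr_sumr -!sumrB; congr (_ + _); apply: eq_bigr => i _; rewrite /xi /eta; ring.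
  by rewrite sa sb; ring.
have -> : \sum_i (al k 0 i - k%:R / 2 * xi i) ^+ 2 + \sum_j (be k 0 j - k%:R / 2 * eta j) ^+ 2 =
    W - k%:R * (\sum_i xi i * al k 0 i + \sum_j eta j * be k 0 j) + k%:R ^+ 2 / 4 * kap.
  rewrite -sqr_xi /W !mulrDr !mulr_sumr opprD !addrA.
  rewrite [RHS](_ : _ = (\sum_i al k 0 i ^+ 2 - \sum_i k%:R * (xi i * al k 0 i) + \sum_i k%:R ^+ 2 / 4 * xi i ^+ 2) +
     (\sum_j be k 0 j ^+ 2 - \sum_j k%:R * (eta j * be k 0 j) + \sum_j k%:R ^+ 2 / 4 * eta j ^+ 2)); last by ring.
  rewrite -!sumrN -!big_split /=; congr (_ + _); apply: eq_bigr => i _; by field.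
rewrite xiE.
have SS : Sm k <= Sm k.+1 by rewrite /Sm big_ord_recr /= lerDl.
have h1 := Gk k; have h2 := Sk k.
have h3 := ler_norm (G 0%N + s2 0%N / 2 - c1).
have h4 := normr_ge0 (G 0%N); have h5 := s20 0%N.
have g1 : k%:R * (\sum_(i < n) p i * al k 0 i + \sum_(j < m) q j * be k 0 j) <= k%:R * (G 0%N - (Sm k - s2 0%N) / 2 - c1).
  by rewrite ler_pM2l //; lra.
have g2 : k%:R * (k%:R * kap) <= k%:R * Sm k by rewrite ler_pM2l.
have g3 : k%:R * (G 0%N + s2 0%N / 2 - c1) <= k%:R * (`|G 0%N| + s2 0%N + `|G 0%N + s2 0%N / 2 - c1|).
  by rewrite ler_pM2l //; lra.
lra.
Qed.

Lemma zero_block_decay : exists (c' : R) (M : nat),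
  [/\ 0 < c', (0 < M)%N & forall k l (i : 'I_n) (j : 'I_m), (M <= k)%N -> in_zero_block i j ->
    Normc.normc (scal A (S k) (T k) l i j) <= expR (- (c' * k%:R))].
Proof.
have [K0 dev] := deviation_bound.
(* The logarithm of the squared entry is at most -ck/2 from the deficit of p_i + q_j, plus 2 (ck/16
   + 4 K0/c) from the two deviations, plus K0 from the bound on f_A; the constants add up to L. The
   threshold on k ensures L <= ck/4, which leaves -ck/8, twice the rate c/16. *)
pose L := K0 + 8 * K0 / c.
exists (c / 16), (Num.bound `|4 * L / c|).+1; split=> //; first by rewrite divr_gt0.
move=> k l i j Mk zij.
have k0 : (0 < k)%N by exact: leq_trans Mk.
have kR : 0 < k%:R :> R by rewrite ltr0n.
have Lk : 4 * L <= c * k%:R.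
  rewrite -ler_pdivrMl // mulrC; apply: le_trans (ler_norm _) _.
  apply: ltW; apply: lt_le_trans (archi_boundP (normr_ge0 _)) _.
  rewrite ler_nat; apply: leq_trans (leqnSn _) _.
  by move: Mk; apply: leq_trans; rewrite ltnS.
have [Fk devk] := dev k k0.
have nonneg (r : nat) (f : 'I_r -> R) (i0 : 'I_r) : f i0 ^+ 2 <= \sum_i f i ^+ 2.
  by rewrite (bigD1 i0) //= lerDl sumr_ge0 // => ? _; exact: sqr_ge0.
have d1 := nonneg _ (fun i => al k 0 i - k%:R / 2 * xi i) i.
have d2 := nonneg _ (fun j => be k 0 j - k%:R / 2 * eta j) j.
have s1 : 0 <= \sum_i (al k 0 i - k%:R / 2 * xi i) ^+ 2 by apply: sumr_ge0 => ? _; exact: sqr_ge0.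
have s2 : 0 <= \sum_j (be k 0 j - k%:R / 2 * eta j) ^+ 2 by apply: sumr_ge0 => ? _; exact: sqr_ge0.
have absorb (z : R) : z ^+ 2 <= k%:R * K0 -> - z <= k%:R * c / 16 + 4 * K0 / c.
  move=> zK; have kc : 0 < k%:R * c by rewrite mulr_gt0.
  have e1 : - z <= k%:R * c / 16 + 4 / (k%:R * c) * z ^+ 2.
    have -> : k%:R * c / 16 + 4 / (k%:R * c) * z ^+ 2 =
      - z + 4 / (k%:R * c) * (z + k%:R * c / 8) ^+ 2.
      by field; rewrite !gt_eqF.
    by rewrite lerDl mulr_ge0 ?sqr_ge0 // divr_ge0 // ltW.
  apply: le_trans e1 _; rewrite lerD2l.
  have -> : 4 * K0 / c = 4 / (k%:R * c) * (k%:R * K0) by field; rewrite !gt_eqF.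
  by rewrite ler_pM2l // divr_gt0.
have {}d1 : - (al k 0 i - k%:R / 2 * xi i) <= k%:R * c / 16 + 4 * K0 / c.
  by apply: absorb; apply: le_trans d1 (le_trans _ devk); rewrite lerDl.
have {}d2 : - (be k 0 j - k%:R / 2 * eta j) <= k%:R * c / 16 + 4 * K0 / c.
  by apply: absorb; apply: le_trans d2 (le_trans _ devk); rewrite lerDr.
have pq := zero_blk (ltn_ord i) (ltn_ord j) zij.
have E1 : abs2 (scal A (S k) (T k) l i j) * expR (al k 0 i + be k 0 j) <= expR (F k).
  rewrite /F /x /y kempf_ness_udiag.
  set Z := \sum_d _.
  have lo : abs2 (scal A (S k) (T k) l i j) * expR (al k 0 i + be k 0 j) <= Z.
    rewrite /Z (bigD1 (l, (i, j))) //= mul1r lerDl sumr_ge0 // => d _.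
    by rewrite mulr_ge0 ?abs2_ge0 ?expR_ge0.
  (* When Z is not positive, the logarithm cannot be inverted, but then the left side is at most
     0. *)
  have [Z0|Z0] := ltP 0 Z; first by rewrite lnK.
  by apply: le_trans lo (le_trans Z0 (expR_ge0 _)).
have E2 : abs2 (scal A (S k) (T k) l i j) <= expR (- (c / 16 * k%:R)) ^+ 2.
  rewrite -(ler_pM2r (expR_gt0 (al k 0 i + be k 0 j))); apply: le_trans E1 _.
  rewrite -expRM_natl -expRD ler_expR.
  rewrite /xi /eta /kap in d1 d2 Fk; rewrite /L in Lk.
  have pqk : k%:R * (p i + q j) <= k%:R * (C0 - c) by rewrite ler_pM2l.
  lra.
by move: E2; rewrite abs2_normc ler_sqr ?nnegrE ?normc_ge0 ?expR_ge0.
Qed.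

End Descent.

(** * Accumulation points *)

Section Accumulation.
Variables (R : realType) (n m N : nat) (A : 'I_N -> 'M[Cx R]_(n, m)).
Local Notation C := (Cx R).
Variables (theta : nat) (X : nat -> {vspace 'rV[R[i]]_n}) (Y : nat -> {vspace 'rV[R[i]]_m}).
Hypothesis hXY : EA_chain A theta X Y.

(* Membership in E_A depends only on dimensions. *)
Lemma SA_dim_eq a P : (a <= theta)%N -> SA A P ->
  \dim P.1 = \dim (X a) -> \dim P.2 = \dim (Y a) -> P = (X a, Y a).
Proof.
move=> ath SP d1 d2; have [_ nz ext] := EA_chain_mem hXY ath.
have dE : dimpair P = dimpair (X a, Y a) by rewrite /dimpair d1 d2.
have : EA A P by split; rewrite ?dE.
have [-> _ _ _ _] := hXY; case=> b bth PE; rewrite PE; suff -> : b = a by [].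
have db : \dim (X b) = \dim (X a) by rewrite -d1 PE.
have lt e f : (e < f)%N -> (f <= theta)%N -> (\dim (X f) < \dim (X e))%N.
  move=> ef fth; have e1 : (e < theta)%N by exact: leq_trans fth.
  apply: leq_ltn_trans (EA_chain_dimX hXY e1); apply: dimvS.
  by apply: (EA_chain_X_sub hXY); rewrite ef.
case: (ltngtP b a) => // ba.
  by have := lt _ _ ba ath; rewrite db ltnn.
by have := lt _ _ ba bth; rewrite db ltnn.
Qed.

Lemma zero_blocks_coarse_DM (S : 'M[C]_n) (T : 'M[C]_m) :
  S \is unitarymx -> T \is unitarymx ->
  (forall l (i : 'I_n) (j : 'I_m), in_zero_block theta X Y i j -> scal A S T l i j = 0) ->
  coarse_DM A theta X Y (scal A S T).
Proof.
move=> Su Tu zero; exists S, T.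
have pairE a : (a <= theta)%N ->
    (<<last_rows (\dim (X a)) S>>%VS, <<first_rows (\dim (Y a)) T>>%VS) = (X a, Y a).
  move=> ath; apply: SA_dim_eq => //.
  - apply: (@SA_span_rows R n m N A S T (fun i => (n - \dim (X a) <= i)%N) (fun j => (j < \dim (Y a))%N)).
    by move=> l i j hi hj; apply: zero; exists a.
  - apply: etrans (dim_span_rows _ (unitarymx_unit Su)) _; exact: card_last (dim_rV_le _).
  - apply: etrans (dim_span_rows _ (unitarymx_unit Tu)) _; exact: card_first (dim_rV_le _).
split.
- exact: unitarymx_unit Su.
- exact: unitarymx_unit Tu.
- move=> a ath; have [E _] := pairE a ath; apply/andP; split; first exact/eqP.
  exact: free_rows (unitarymx_unit Su).
- move=> a ath; have [_ E] := pairE a ath; apply/andP; split; first exact/eqP.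
  exact: free_rows (unitarymx_unit Tu).
- by [].
Qed.

(** Along a further subsequence both unitary frames converge, so B is A in the limit frames; the
    decay makes its zero blocks exact. *)
Lemma accumulation_coarse_DM (S : nat -> 'M[C]_n) (T : nat -> 'M[C]_m) (c : R) (M : nat)
    (B : 'I_N -> 'M[R[i]]_(n, m)) :
  (forall k, S k \is unitarymx) -> (forall k, T k \is unitarymx) -> 0 < c ->
  (forall k l (i : 'I_n) (j : 'I_m), (M <= k)%N -> in_zero_block theta X Y i j ->
    Normc.normc (scal A (S k) (T k) l i j) <= expR (- (c * k%:R))) ->
  (forall eps : R, 0 < eps -> forall K : nat, exists2 k, (K <= k)%N &
    forall l i j, Normc.normc (scal A (S k) (T k) l i j - B l i j) < eps) ->
  coarse_DM A theta X Y B.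
Proof.
move=> Su Tu c0 decay acc.
have /choice[f hf] : forall r : nat, exists k, (M + r <= k)%N /\
    forall l i j, Normc.normc (scal A (S k) (T k) l i j - B l i j) < r.+1%:R^-1.
  move=> r; have r0 : 0 < r.+1%:R^-1 :> R by rewrite invr_gt0 ltr0n.
  by have [k k1 k2] := acc _ r0 (M + r)%N; exists k.
have [g [L [L' [gi Lu L'u SL TL]]]] := @unitary_pair_subsequence R n m (S \o f) (T \o f)
  (fun k => Su (f k)) (fun k => Tu (f k)).
have harm : (g k).+1%:R^-1 @[k --> \oo] --> (0 : R).
  exact: (cvg_comp _ _ (increasing_seq_cvg gi) (@cvg_harmonic R)).
have small (u : nat -> C) (z : C) : ccvg u z ->
    (forall k, Normc.normc (u k) <= (g k).+1%:R^-1) -> z = 0.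
  move=> uz ub; apply: abs2_eq0; apply/eqP; rewrite eq_le abs2_ge0 andbT.
  apply: (ler_cvg_to (ccvg_abs2 uz) harm); near=> k.
  rewrite abs2_normc expr2; apply: le_trans (ub k).
  rewrite ler_piMl ?normc_ge0 //; apply: le_trans (ub k) _.
  by rewrite invf_le1 ?ler1n ?ltr0n.
have BE : B = scal A L L'.
  apply/funext => l; apply/matrixP => i j; apply/esym/eqP; rewrite -subr_eq0; apply/eqP.
  have cv : ccvg (fun k => scal A (S (f (g k))) (T (f (g k))) l i j - B l i j) (scal A L L' l i j - B l i j).
    have [h1 h2] := mcvg_scal A l SL TL i j.
    have -> : (fun k => scal A (S (f (g k))) (T (f (g k))) l i j - B l i j) =
       (fun k => scal A (S (f (g k))) (T (f (g k))) l i j + (-1) * B l i j).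
      by apply/funext => k; rewrite mulN1r.
    split.
      rewrite -[X in _ --> X]/(re (scal A L L' l i j - B l i j)) raddfB /=.
      under eq_fun do rewrite mulN1r raddfB /=.
      by apply: cvgB => //; exact: cvg_cst.
    rewrite -[X in _ --> X]/(im (scal A L L' l i j - B l i j)) raddfB /=.
    under eq_fun do rewrite mulN1r raddfB /=.
    by apply: cvgB => //; exact: cvg_cst.
  by apply: (small _ _ cv) => k; have [_ h] := hf (g k); exact: ltW.
rewrite BE; apply: zero_blocks_coarse_DM => // l i j zij.
(* The exponential is compared with a harmonic sequence: exp(c f) >= 1 + c f >= d (1 + g k). *)
pose d := Num.min 1 c; have d0 : 0 < d by rewrite lt_min ltr01.
have expc : d^-1 * (g k).+1%:R^-1 @[k --> \oo] --> (0 : R).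
  by rewrite -(mulr0 d^-1); apply: cvgMr harm.
have expb k : expR (- (c * (f (g k))%:R)) <= d^-1 * (g k).+1%:R^-1.
  have [h1 _] := hf (g k).
  rewrite expRN -invfM lef_pV2 ?posrE ?expR_gt0 ?mulr_gt0 ?ltr0n //.
  apply: le_trans (expR_ge1Dx _); rewrite -natr1 mulrDr mulr1 addrC lerD //.
    by rewrite ge_min lexx.
  apply: ler_pM; rewrite ?ler0n ?(ltW d0) ?ge_min ?lexx ?orbT // ler_nat.
  exact: leq_trans (leq_addl _ _) h1.
apply: abs2_eq0; apply/eqP; rewrite eq_le abs2_ge0 andbT.
apply: (ler_cvg_to (ccvg_abs2 (mcvg_scal A l SL TL i j)) expc); near=> k.
have [h1 _] := hf (g k).
have dec := decay (f (g k)) l i j (leq_trans (leq_addr _ _) h1) zij.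
rewrite abs2_normc expr2; apply: le_trans (le_trans dec (expb k)).
rewrite ler_piMl ?normc_ge0 //; apply: le_trans dec _.
by rewrite expR_le1 oppr_le0 mulr_ge0 ?ler0n ?(ltW c0).
Unshelve. all: by end_near. Qed.

End Accumulation.

(** * Assembly of the theorem *)

Section Frames.
Variables (R : realType) (r : nat).
Local Notation C := (Cx R).

(** The eigenframes are given only from k = 1 on; at k = 0, where the iterate is the identity, any
    unitary would serve. *)
Definition frame (s : nat -> 'M[C]_r) (k : nat) : 'M[C]_r := if k is 0%N then 1%:M else s k.

Lemma frame_unitary s : (forall k, (1 <= k)%N -> s k \is unitarymx) ->
  forall k, frame s k \is unitarymx.
Proof.
move=> su [|k]; last exact: su.
by apply/unitarymxP; rewrite /= mul1mx; exact: adj1.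
Qed.

Lemma iterate_udiag (z G s : nat -> 'M[C]_r) (a : nat -> 'rV[R]_r) :
  z 0%N = 1%:M ->
  (forall k, (1 <= k)%N -> z k = mexp ((k%:R / 2) *: G k)) ->
  (forall k, (1 <= k)%N -> s k \is unitarymx) ->
  (forall k, (1 <= k)%N -> G k = udiag (s k) (a k)) ->
  z = fun k => udiag (frame s k) (map_mx expR ((k%:R / 2) *: a k)).
Proof.
move=> z0 zE su GE; apply/funext => -[|k].
  by rewrite z0 mul0r scale0r (udiag_exp0 (frame_unitary su 0)).
have half : (k.+1%:R / 2 : C) = rc (k.+1%:R / 2) by rewrite fmorph_div !rmorph_nat.
by rewrite (zE k.+1 isT) (GE k.+1 isT) half udiagZ (mexp_udiag _ (su k.+1 isT)).
Qed.

End Frames.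

Theorem theorem4p28 (R : realType) (n m N : nat)
    (hn : (0 < n)%N) (hm : (0 < m)%N) (hN : (0 < N)%N)
    (A : 'I_N -> 'M[R[i]]_(n, m))
    (hker : forall v : 'cV[R[i]]_m, (forall l, A l *m v = 0) -> v = 0)
    (hcoker : forall u : 'cV[R[i]]_n, (forall l, (A l)^t* *m u = 0) -> u = 0)
    (hA : ~ op_scalable A)
    (theta : nat)
    (X : nat -> {vspace 'rV[R[i]]_n}) (Y : nat -> {vspace 'rV[R[i]]_m})
    (hXY : EA_chain A theta X Y)
    (x : nat -> 'M[R[i]]_n) (y : nat -> 'M[R[i]]_m)
    (hx0 : x 0%N = 1%:M) (hy0 : y 0%N = 1%:M)
    (hxS : forall k, x k.+1 =
       riem_exp (x k) (- 2^-1 *: (riem_grad A (x k) (y k)).1))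
    (hyS : forall k, y k.+1 =
       riem_exp (y k) (- 2^-1 *: (riem_grad A (x k) (y k)).2))
    (G : nat -> 'M[R[i]]_n) (H : nat -> 'M[R[i]]_m)
    (hG : forall k, (1 <= k)%N ->
       G k \is hermsymmx /\ x k = mexp ((k%:R / 2) *: G k))
    (hH : forall k, (1 <= k)%N ->
       H k \is hermsymmx /\ y k = mexp ((k%:R / 2) *: H k))
    (sigma : nat -> 'M[R[i]]_n) (tau : nat -> 'M[R[i]]_m)
    (a : nat -> 'rV[R]_n) (b : nat -> 'rV[R]_m)
    (hsigma : forall k, (1 <= k)%N ->
       sigma k \is unitarymx /\ G k = (sigma k)^t* *m rdiag (a k) *m sigma k)
    (htau : forall k, (1 <= k)%N ->
       tau k \is unitarymx /\ H k = (tau k)^t* *m rdiag (b k) *m tau k)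
    (ha : forall k (i j : 'I_n), (1 <= k)%N -> (i <= j)%N ->
       a k 0 i <= a k 0 j)
    (hb : forall k (i j : 'I_m), (1 <= k)%N -> (i <= j)%N ->
       b k 0 j <= b k 0 i) :
  (forall B : 'I_N -> 'M[R[i]]_(n, m),
     accumulation_point (fun k => conj_tuple (sigma k) A (tau k)) B ->
     coarse_DM A theta X Y B)
  /\
  (exists (c : R) (M : nat),
     [/\ 0 < c, (0 < M)%N &
       forall (k : nat) (l : 'I_N) (alpha alpha' : nat) (i : 'I_n) (j : 'I_m),
         (M <= k)%N ->
         (1 <= alpha <= theta)%N -> (1 <= alpha' <= theta)%N ->
         (alpha' < alpha)%N ->
         i \in Iblock X alpha -> j \in Jblock Y alpha' ->
         Normc.normc ((sigma k *m A l *m (tau k)^t*) i j)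
           <= expR (- (c * k%:R))]).
Proof.
have su k : (1 <= k)%N -> sigma k \is unitarymx by move=> /hsigma[].
have tu k : (1 <= k)%N -> tau k \is unitarymx by move=> /htau[].
have xE := iterate_udiag hx0 (fun k k1 => (hG k k1).2) su (fun k k1 => (hsigma k k1).2).
have yE := iterate_udiag hy0 (fun k k1 => (hH k k1).2) tu (fun k k1 => (htau k k1).2).
(* If A were zero, the all-ones vector would lie in the common kernel. *)
have A0 : 0 < nrm2 A.
  rewrite lt_neqAle nrm2_ge0 andbT eq_sym; apply/eqP => /nrm2_eq0 zA.
  have /matrixP/(_ (Ordinal hm) ord0) : const_mx 1 = 0 :> 'cV[R[i]]_m.
    by apply: hker => l; rewrite zA mul0mx.
  by rewrite !mxE => /eqP; rewrite oner_eq0.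
have am k : nondecreasing_row ((k%:R / 2) *: a k).
  move=> i j ij; rewrite !mxE; case: k => [|k]; first by rewrite !mul0r.
  by rewrite ler_wpM2l ?divr_ge0 ?ler0n // ha.
have bm k : nonincreasing_row ((k%:R / 2) *: b k).
  move=> i j ij; rewrite !mxE; case: k => [|k]; first by rewrite !mul0r.
  by rewrite ler_wpM2l ?divr_ge0 ?ler0n // hb.
have [p [q [C [c [[p0 q0] _ [p1 q1 sqC] SApq [c0 blk]]]]]] := block_marginals hn hm hXY.
have a0 : (0%:R / 2) *: a 0%N = 0 by rewrite mul0r scale0r.
have b0 : (0%:R / 2) *: b 0%N = 0 by rewrite mul0r scale0r.
rewrite xE yE in hxS hyS.
have zero_blk i j (i_n : (i < n)%N) (j_m : (j < m)%N) (z : in_zero_block theta X Y i j) :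
    p i + q j <= C - c.
  by have := blk i j i_n j_m; case: asboolP.
have nonzero_blk i j (i_n : (i < n)%N) (j_m : (j < m)%N) (z : ~ in_zero_block theta X Y i j) :
    C <= p i + q j.
  by have := blk i j i_n j_m; case: asboolP.
have [c' [M [c'0 M0 decay]]] := zero_block_decay hn hm A0 hXY (frame_unitary su) (frame_unitary tu)
  am bm a0 b0 hxS hyS p0 q0 p1 q1 sqC SApq c0 zero_blk nonzero_blk.
have frameE r (s : nat -> 'M[Cx R]_r) k : (0 < k)%N -> frame s k = s k by case: k.
split=> [B acc|].
  apply: (accumulation_coarse_DM hXY (frame_unitary su) (frame_unitary tu) c'0 decay).
  (* Index 0 is skipped, the only place where [frame] can differ from sigma and tau. *)
  move=> eps eps0 K; have [k Kk kB] := acc _ eps0 (maxn K 1).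
  move: Kk; rewrite geq_max => /andP[Kk k1]; exists k; first exact: Kk.
  by rewrite (frameE _ sigma _ k1) (frameE _ tau _ k1).
exists c', M; split=> // k l al al' i j Mk /andP[al1 alt] /andP[al'1 al't] lt.
rewrite !inE => /andP[iX _] /andP[jY _].
have k1 := leq_trans M0 Mk.
have := decay k l i j Mk; rewrite (frameE _ sigma _ k1) (frameE _ tau _ k1); apply.
(* As alpha' <= alpha - 1, the space X (alpha - 1) lies in X alpha', so row i is among the last dim
   (X alpha') rows, while column j is among the first dim (Y alpha'). *)
exists al'; split=> //; apply: leq_trans iX; apply: leq_sub2l; apply: dimvS.
by apply: (EA_chain_X_sub hXY); rewrite -ltnS prednK // lt (leq_trans (leq_pred _) alt).
Qed.
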